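(* Let $\mu$ be a balanced measure on $\mathbb{R}$, $w$ a weight, $p\in(1,\infty)$ and $N\ge1$ an integer. There exists a constant $C$ such that all operators $$T\in\bigcup_{\substack{s,t\ge0:\\ s+t\le N}}\mathrm{HS}(s,t)$$ satisfy $\|T\|_{L^p(w\,d\mu)\to L^p(w\,d\mu)}\le C$ if and only if $w\in A_p^b(\mu)$.
   Context: $\mathscr{D}$ is the standard dyadic system of half-open intervals $2^{-k}[j,j+1)$, $j,k\in\mathbb{Z}$. For $I\in\mathscr{D}$, $I_-$ and $I_+$ are its left and right dyadic children, $\widehat{I}$ its dyadic parent, $I^b$ its dyadic sibling (the other child of $\widehat{I}$), $I^b_\pm$ the right/left children of $I^b$, and $I^{(j)}$ its $j$-th dyadic ancestor ($I^{(0)}=I$); $\mathscr{D}_j(I)=\{J\in\mathscr{D}:J^{(j)}=I\}$. $\mu$ is a Borel measure on $\mathbb{R}$ with $0<\mu(I)<\infty$ for all $I\in\mathscr{D}$. Pairings and averages are with respect to $\mu$: $\langle f,g\rangle=\int fg\,d\mu$, $\langle f\rangle_I=\mu(I)^{-1}\int_I f\,d\mu$. Set $m(I)=\mu(I_-)\mu(I_+)/\mu(I)$. The measure $\mu$ is balanced if it has no atoms and there is $c\ge1$ with $c^{-1}m(\widehat{I})\le m(I)\le c\,m(\widehat{I})$ for all $I\in\mathscr{D}$. A weight is a $\mu$-a.e. positive function $w\in L^1_{\mathrm{loc}}(\mu)$; $p'$ is the conjugate exponent of $p$. The Haar function of $I$ is $h_I=\sqrt{m(I)}\left(\frac{1_{I_-}}{\mu(I_-)}-\frac{1_{I_+}}{\mu(I_+)}\right)$.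 $\mathrm{HS}(s,t)$ is the family of Haar shifts of complexity $(s,t)$, i.e. operators on $L^2(\mu)$ of the form $Tf=\sum_{I\in\mathscr{D}}\sum_{J\in\mathscr{D}_s(I)}\sum_{K\in\mathscr{D}_t(I)}\alpha^I_{J,K}\langle f,h_J\rangle h_K$ with $\sup|\alpha^I_{J,K}|\le1$. $\|T\|_{L^p(w\,d\mu)\to L^p(w\,d\mu)}$ is the least constant $A$ with $\|Tf\|_{L^p(w\,d\mu)}\le A\|f\|_{L^p(w\,d\mu)}$ for all $f\in L^2(\mu)\cap L^p(w\,d\mu)$. $w\in A_p^b(\mu)$ means $\sup c_p^b(I,J)\langle w\rangle_I\langle w^{1-p'}\rangle_J^{p-1}<\infty$, the supremum being over $I,J\in\mathscr{D}$ with $J\in\{I,I^b_-,I^b_+\}$ or $I\in\{J^b_-,J^b_+\}$, where $c_p^b(I,J)=1$ if $I=J$ and $c_p^b(I,J)=\frac{m(I)^{p/2}m(J)^{p/2}}{\mu(J)\mu(I)^{p-1}}$ otherwise. *)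

(* Defs.v *)
From mathcomp Require Import all_boot all_order all_algebra.
From mathcomp Require Import finmap.
From mathcomp Require Import all_classical all_reals all_analysis.

Set Implicit Arguments.
Unset Strict Implicit.
Unset Printing Implicit Defensive.

Import Order.TTheory GRing.Theory Num.Theory.
Import numFieldNormedType.Exports.

Local Open Scope classical_set_scope.
Local Open Scope ring_scope.

(* The pair (k, j) encodes the interval 2^{-k}[j, j+1); the encoding is
   injective, so quantifying over pairs is quantifying over intervals. *)
Definition dyadic : Type := (int * int)%type.

Definition dset (R : realType) (I : dyadic) : set (measurableTypeR R) :=
  `[(I.2%:~R * 2 ^ (- I.1) : R), (I.2 + 1)%:~R * 2 ^ (- I.1)[.

Arguments dset : clear implicits.

Definition lchild (I : dyadic) : dyadic := (I.1 + 1, I.2 * 2).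
Definition rchild (I : dyadic) : dyadic := (I.1 + 1, I.2 * 2 + 1).
(* floor division: this is also the parent when the index is negative *)
Definition parent (I : dyadic) : dyadic := (I.1 - 1, (I.2 %/ 2)%Z).
Definition sibling (I : dyadic) : dyadic :=
  if I == lchild (parent I) then rchild (parent I) else lchild (parent I).
Definition ancestor (n : nat) (I : dyadic) : dyadic := iter n parent I.
Definition descendants (n : nat) (I : dyadic) : set dyadic :=
  [set J | ancestor n J = I].

Section defs.
Variables (R : realType) (mu : {measure set (measurableTypeR R) -> \bar R}).

Implicit Types (I J K : dyadic) (f g w : measurableTypeR R -> R) (p : R).

Definition dyadic_pos_finite : Prop :=
  forall I, (0 < mu (dset R I) < +oo)%E.

(* mu(I) and m(I) as real numbers; meaningful under dyadic_pos_finite *)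
Definition dmu I : R := fine (mu (dset R I)).
Definition mI I : R := dmu (lchild I) * dmu (rchild I) / dmu I.

Definition balanced : Prop :=
  (forall x : R, mu [set x] = 0%E) /\
  exists2 c : R, 1 <= c &
    forall I, c^-1 * mI (parent I) <= mI I <= c * mI (parent I).

Definition L1loc f : Prop :=
  measurable_fun setT f /\
  forall K : set R, compact K -> (\int[mu]_(x in K) `|f x|%:E < +oo)%E.

Definition weight w : Prop := L1loc w /\ {ae mu, forall x, 0 < w x}.

Definition haar I : measurableTypeR R -> R := fun x =>
  Num.sqrt (mI I) * (\1_(dset R (lchild I)) x / dmu (lchild I)
                     - \1_(dset R (rchild I)) x / dmu (rchild I)).

Definition pairing f g : R := \int[mu]_x (f x * g x).

Definition haar_block (s t : nat) (alpha : dyadic -> dyadic -> dyadic -> R)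
    f I : measurableTypeR R -> R := fun x =>
  \sum_(J \in descendants s I) \sum_(K \in descendants t I)
    alpha I J K * pairing f (haar J) * haar K x.

(* g is the sum of the family F in L^2(mu), i.e. the limit of the net of its
   finite partial sums (unconditional convergence) *)
Definition L2_sum (F : dyadic -> measurableTypeR R -> R) g : Prop :=
  g \in Lfun mu 2%:E /\
  forall e : R, 0 < e -> exists A0 : {fset dyadic}, forall A : {fset dyadic},
    (A0 `<=` A)%fset ->
    ('N[mu]_2%:E [EFin \o (fun x => g x - \sum_(I <- A) F I x)%R] < e%:E)%E.

(* An operator on L^2(mu) is given on representatives; its values outside
   L^2(mu) are irrelevant, and its values on L^2(mu) are determined up to
   mu-null sets by the series. *)
Definition HS (s t : nat) :
    set ((measurableTypeR R -> R) -> (measurableTypeR R -> R)) :=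
  [set T | exists alpha : dyadic -> dyadic -> dyadic -> R,
     (forall I J K, descendants s I J -> descendants t I K ->
        `|alpha I J K| <= 1) /\
     (forall f, f \in Lfun mu 2%:E -> L2_sum (haar_block s t alpha f) (T f))].

(* norm of L^p(w dmu) *)
Definition wnorm w p f : \bar R :=
  ((\int[mu]_x (`|f x| `^ p * w x)%:E) `^ p^-1)%E.

Definition wLp w p f : Prop :=
  measurable_fun setT f /\ (wnorm w p f < +oo)%E.

(* equals +oo when there is no admissible constant *)
Definition opnorm w p (T : (measurableTypeR R -> R) -> measurableTypeR R -> R)
    : \bar R :=
  ereal_inf [set A%:E | A in [set A : R | 0 <= A /\
    forall f, f \in Lfun mu 2%:E -> wLp w p f ->
      (wnorm w p (T f) <= A%:E * wnorm w p f)%E]].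

(* extended-real valued, as w^{1-p'} need not be locally integrable *)
Definition avg I f : \bar R :=
  ((dmu I)^-1%:E * \int[mu]_(x in dset R I) (f x)%:E)%E.

Definition cpb p I J : R :=
  if I == J then 1
  else mI I `^ (p / 2) * mI J `^ (p / 2) / (dmu J * dmu I `^ (p - 1)).

Definition Apb_pair I J : Prop :=
  (J = I \/ J = lchild (sibling I) \/ J = rchild (sibling I)) \/
  (I = lchild (sibling J) \/ I = rchild (sibling J)).

Definition Apb p w : Prop :=
  let p' := fine (hoelder_conjugate p%:E) in
  let w' := fun x => w x `^ (1 - p') in
  (ereal_sup [set ((cpb p IJ.1 IJ.2)%:E * avg IJ.1 w
                   * (avg IJ.2 w') `^ (p - 1)%R)
             | IJ in [set IJ : dyadic * dyadic | Apb_pair IJ.1 IJ.2]]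
   < +oo)%E.

End defs.

(* Main.v *)
(* Sufficiency: by duality it is enough to bound, uniformly in the depth, the sum over
   the intervals [I] of the products of the sizes of the Haar coefficients of [f] over
   the descendants [J] of [I] with those of [g] over the descendants [K].  The jump of
   the averages of [f] at [J] is split at the height [a] of the running maximum of the
   averages of [f] along the ancestors of [I].  The parts below [a] are summed by a
   potential in which the running maximum [b] of [g] is a frozen weight, the parts
   above [2 a] grow geometrically along branches, and the cross conditions relate
   [sqrt (m J) * sqrt (m K)] to the two weights at the children of [J] and [K].
   Everything is thereby controlled by the maximal functions of [f] and [g].
   Necessity: an operator whose kernel is constant on a product [B * A] bounds
   [w(B) sigma(A)^(p-1)], where [sigma = w^(1-p')].  The shifts of complexity (1,0) and
   (0,1) built on an interval and one of its children give the pairs [I <> J].  The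
   diagonal terms follow from the Haar projections along a branch from [I] to a
   descendant whose mass lies between 3/8 and 3/4 of that of [I], which exists since
   there are no atoms. *)

Require Import Defs.
From mathcomp Require Import all_boot all_order all_algebra.
From mathcomp Require Import finmap.
From mathcomp Require Import all_classical all_reals all_analysis measurable_realfun.
From mathcomp Require Import ring lra zify.

Set Implicit Arguments.
Unset Strict Implicit.
Unset Printing Implicit Defensive.
Import Order.TTheory GRing.Theory Num.Theory.
Import numFieldNormedType.Exports.
Local Open Scope classical_set_scope.
Local Open Scope ring_scope.

(** * Weighted estimates on the binary tree *)

(** The measure need not be doubling: the average over a child is not controlled by the average over
    its parent, and only [m] is comparable between generations. So a jump may overshoot the running
    maximum by any amount. If at least one of the two functions stays below twice its height, the
    overshoot of the other is paid by its mass, because [m J] is at most the mass of each child of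
    [J]. If both overshoot, what is needed is a lower bound of [w(J')^(1/p) sigma(L')^(1/q)] by a
    multiple of [m I], for children [J'] and [L'] of two different descendants of [I]. The weight
    condition only gives upper bounds of such products, and Hoelder's inequality gives the lower
    bound [mu <= w^(1/p) sigma^(1/q)] only when both factors live on the same interval. Two upper
    bounds, with the roles of [w] and [sigma] exchanged, are multiplied and compared with the
    Hoelder bounds at three intervals; this reverses the inequality. Freezing the maximum of the
    other function is legitimate because a running maximum only grows along branches. *)

(* A node is the list of turns leading to it, the last turn first, so that
   [J ++ I] is a descendant of [I] *)
Section gsum.
Context {R : realType}.
Implicit Types (I J : seq bool) (phi psi : seq bool -> R) (n : nat).

Fixpoint gsum n phi I : R :=
  if n is n'.+1 then gsum n' phi (false :: I) + gsum n' phi (true :: I)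
  else phi I.

Definition tree_additive phi := forall I, phi I = phi (false :: I) + phi (true :: I).

(** Peels off the last generation instead of the first; inequalities between a node and its two
    children are summed over a level in this form. *)
Lemma gsumSr n phi I :
  gsum n.+1 phi I = gsum n (fun J => phi (false :: J) + phi (true :: J)) I.
Proof. by elim: n I => //= n IH I; rewrite -!IH. Qed.

Lemma gsum_add m n phi I : gsum (m + n) phi I = gsum m (gsum n phi) I.
Proof. by elim: m I => //= m IH I; rewrite !IH. Qed.

Lemma ler_gsum n phi psi I :
  (forall J, size J = n -> phi (J ++ I) <= psi (J ++ I)) ->
  gsum n phi I <= gsum n psi I.
Proof.
elim: n I => [I H|n IH I H]; first exact: (H [::]).
by rewrite /= lerD// IH// => J sJ; rewrite -cat_rcons H// size_rcons sJ.
Qed.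

Lemma eq_gsum n phi psi I :
  (forall J, size J = n -> phi (J ++ I) = psi (J ++ I)) ->
  gsum n phi I = gsum n psi I.
Proof.
by move=> H; apply/eqP; rewrite eq_le !ler_gsum// => J /H ->.
Qed.

Lemma gsumD n phi psi I :
  gsum n (fun J => phi J + psi J) I = gsum n phi I + gsum n psi I.
Proof. by elim: n I => //= n IH I; rewrite !IH addrACA. Qed.

Lemma gsumZ n c phi I : gsum n (fun J => c * phi J) I = c * gsum n phi I.
Proof. by elim: n I => //= n IH I; rewrite !IH mulrDr. Qed.

Lemma gsumN n phi I : gsum n (fun J => - phi J) I = - gsum n phi I.
Proof. by elim: n I => //= n IH I; rewrite !IH opprD. Qed.

Lemma gsum_cst n c I : gsum n (fun=> c) I = 2 ^+ n * c.
Proof.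
by elim: n I => [|n IH] I /=; rewrite ?expr0 ?mul1r// !IH exprS -mulrA; ring.
Qed.

Lemma gsum_additive n phi I : tree_additive phi -> gsum n phi I = phi I.
Proof. by move=> H; elim: n I => //= n IH I; rewrite !IH -H. Qed.

Lemma gsum_ge0 n phi I : (forall J, 0 <= phi J) -> 0 <= gsum n phi I.
Proof. by move=> H; elim: n I => //= n IH I; rewrite addr_ge0. Qed.

Lemma gsum_mul s t phi psi I :
  gsum s phi I * gsum t psi I = gsum s (fun J => gsum t (fun K => phi J * psi K) I) I.
Proof.
rewrite mulrC -gsumZ; apply: eq_gsum => J _.
by rewrite mulrC -gsumZ.
Qed.

(** A term depending on [J] alone is counted once for each of the [2 ^+ t] nodes [K], and
    symmetrically. The loss depends on the complexity only. *)
Lemma gsum_pair_le s t phi psi al be I :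
  (forall J K, size J = s -> size K = t ->
    phi (J ++ I) * psi (K ++ I) <= al (J ++ I) + be (K ++ I)) ->
  gsum s phi I * gsum t psi I <= 2 ^+ t * gsum s al I + 2 ^+ s * gsum t be I.
Proof.
move=> H; rewrite gsum_mul.
apply: (@le_trans _ _ (gsum s (fun J => gsum t (fun K => al J + be K) I) I)).
  by apply: ler_gsum => J sJ; apply: ler_gsum => K sK; exact: H.
rewrite (@eq_gsum s _ (fun J => 2 ^+ t * al J + gsum t be I)); last first.
  by move=> J _; rewrite gsumD gsum_cst.
by rewrite gsumD gsumZ gsum_cst.
Qed.

(** A difference at distance [k] splits into [k] unit steps; each of these telescopes in [n] and
    costs at most one value of [u]. *)
Lemma telescope_le (u : nat -> R) k n0 B :
  (forall n, 0 <= u n) -> (forall n, (n <= n0 + k)%N -> u n <= B) ->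
  \sum_(n < n0) (u (n + k)%N - u n) <= k%:R * B.
Proof.
move=> u0; elim: k => [|k IH] H.
  by rewrite mul0r big1// => i _; rewrite addn0 subrr.
have -> : \sum_(n < n0) (u (n + k.+1)%N - u n) =
   \sum_(n < n0) (u (n + k)%N - u n) + \sum_(n < n0) (u (n.+1 + k)%N - u (n + k)%N).
  by rewrite -big_split /=; apply: eq_bigr => i _; rewrite addnS addSn; lra.
have -> : \sum_(n < n0) (u (n.+1 + k)%N - u (n + k)%N) = u (n0 + k)%N - u k.
  by rewrite -(big_mkord xpredT (fun n => u (n.+1 + k)%N - u (n + k)%N))
             (telescope_sumr (fun n => u (n + k)%N))// add0n.
rewrite -natr1 mulrDl mul1r lerD//; first by apply: IH => n Hn; apply: H; lia.
by rewrite lerBlDr (le_trans (H _ _)) ?lerDl//; lia.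
Qed.

Fixpoint runmax phi I : R :=
  if I is _ :: I' then Num.max (runmax phi I') (phi I) else phi I.

Lemma runmax_ge phi I : phi I <= runmax phi I.
Proof. by case: I => //= c I; rewrite le_max lexx orbT. Qed.

Lemma runmax_mono phi I J : runmax phi I <= runmax phi (J ++ I).
Proof. by elim: J => //= c J IH; rewrite le_max IH. Qed.

Lemma runmax_ge0 phi I : (forall J, 0 <= phi J) -> 0 <= runmax phi I.
Proof. by move=> H; exact: le_trans (H I) (runmax_ge _ _). Qed.

End gsum.

(** * Conjugate exponents and Young's inequality *)

Section conjugate.
Context {R : realType}.
Variables (p q : R).
Hypotheses (p1 : 1 < p) (pq : p^-1 + q^-1 = 1).

Lemma conj_gt1 : 1 < q.
Proof.
have [hp hpq] := (p1, pq).
have p0 : 0 < p by lra.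
have ip : 0 < p^-1 by rewrite invr_gt0.
have ip1 : p^-1 < 1 by rewrite invf_lt1.
have q0 : 0 < q by rewrite -invr_gt0; lra.
by rewrite -invf_lt1//; lra.
Qed.

Lemma conj_mul : (p - 1) * q = p.
Proof.
have hp := p1.
have q1 := conj_gt1.
have p0 : p != 0 by lra.
have q0 : q != 0 by lra.
have : (p^-1 + q^-1) * (p * q) = p * q by rewrite pq mul1r.
rewrite mulrDl mulrA mulVf// mul1r mulrCA mulVf// mulr1; lra.
Qed.

Lemma conj_mulD : (q - 1) * p = q.
Proof. have := conj_mul; lra. Qed.

Lemma powRB1 (a : R) : 0 <= a -> a `^ (p - 1) * a = a `^ p.
Proof.
have hp := p1.
rewrite le_eqVlt => /predU1P[<-|a0]; last first.
  rewrite -{2}(powRr1 (ltW a0)) -powRD ?subrK//.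
  by rewrite (gt_eqF a0) implybT.
by rewrite mulr0 powR0//; lra.
Qed.

Lemma youngB1 (x y : R) : 0 <= x -> 0 <= y ->
  x `^ (p - 1) * y <= x `^ p / q + y `^ p / p.
Proof.
move=> x0 y0; have q1 := conj_gt1; have hp := p1; have hpq := pq.
have := @conjugate_powR R (x `^ (p - 1)) y q p (powR_ge0 _ _) y0.
rewrite -powRrM conj_mul; apply; lra.
Qed.

Lemma young (x y : R) : 0 <= x -> 0 <= y -> x * y <= x `^ p + y `^ q.
Proof.
move=> x0 y0; have q1 := conj_gt1; have hp := p1; have hpq := pq.
have H : x * y <= x `^ p / p + y `^ q / q by apply: conjugate_powR => //; lra.
apply: (le_trans H); rewrite lerD// ler_piMr ?powR_ge0// invf_le1; lra.
Qed.

End conjugate.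

(** * Doob's maximal inequality on a finite tree *)

Section doob.
Context {R : realType}.
Variables (p q : R).
Hypotheses (p1 : 1 < p) (pq : p^-1 + q^-1 = 1).
Variables (sg F : seq bool -> R) (M : nat).
Hypotheses (sg0 : forall I, 0 < sg I) (sgD : tree_additive sg).
Hypotheses (F0 : forall I, 0 <= F I).
(** Additivity is asked above depth [M] only, since the inequality is also applied to sums over the
    nodes of depth [M], which are additive no further down. *)
Hypothesis FD : forall I, (size I < M)%N -> F I = F (false :: I) + F (true :: I).

Let y I := F I / sg I.
Let a := runmax y.
(** Affine in [y] for a frozen [a], so that its [sg]-weighted sum passes from a node to its children
    unchanged. The factor 2 leaves [- a^p] at the leaves after Young's inequality has consumed one
    [a^p]. *)
Let U (y a : R) := 2 * q * (a `^ (p - 1) * y) - 2 * a `^ p.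

(** Updating the height to the current value can only help: by Young's inequality
    [q b^(p-1) x <= b^p + (q-1) x^p]. *)
Let U_mono x b : 0 <= b -> 0 <= x -> U x b <= U x (Num.max b x).
Proof.
move=> b0 x0; have [xb|bx] := leP x b => //.
have q1 := conj_gt1 p1 pq; have [hp hpq] := (p1, pq).
rewrite /U powRB1//.
have := youngB1 p1 pq b0 x0.
have -> : p^-1 = 1 - q^-1 by lra.
move=> H.
have : q * (b `^ (p - 1) * x) <= q * (b `^ p / q + x `^ p * (1 - q^-1)).
  by rewrite ler_pM2l//; lra.
have -> : q * (b `^ p / q + x `^ p * (1 - q^-1)) = b `^ p + (q - 1) * x `^ p.
  by field; lra.
lra.
Qed.

(* The potential [sg * U y a] is a submartingale along the tree; at the root it
   is nonnegative and at the leaves it is at most [C y^p - a^p] *)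
Lemma doob_tree :
  gsum M (fun I => a I `^ p * sg I) [::] <=
  (2 * q) `^ p * gsum M (fun I => y I `^ p * sg I) [::].
Proof.
have q1 := conj_gt1 p1 pq; have [hp hpq] := (p1, pq).
have y0 I : 0 <= y I by rewrite divr_ge0// ltW.
have a0 I : 0 <= a I by apply: runmax_ge0.
have step n : (n <= M)%N -> 0 <= gsum n (fun I => sg I * U (y I) (a I)) [::].
  elim: n => [_|n IH nM] /=.
    rewrite mulr_ge0 ?(ltW (sg0 _))// /U /a /= powRB1//.
    rewrite -mulrBl mulr_ge0 ?powR_ge0//; lra.
  have : 0 <= gsum n.+1 (fun I => sg I * U (y I) (a I)) [::]; last by [].
  rewrite gsumSr; apply: (le_trans (IH (ltnW nM))); apply: ler_gsum => J sJ.
  rewrite cats0.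
  have H c : sg (c :: J) * U (y (c :: J)) (a J) <=
             sg (c :: J) * U (y (c :: J)) (a (c :: J)).
    by rewrite ler_pM2l// U_mono.
  apply: le_trans (lerD (H false) (H true)).
  have sy c : sg (c :: J) * y (c :: J) = F (c :: J).
    by rewrite /y mulrC divfK// gt_eqF.
  have sy' : sg J * y J = F J by rewrite /y mulrC divfK// gt_eqF.
  have HF : F J = F (false :: J) + F (true :: J) by apply: FD; rewrite sJ.
  have E K b : sg K * U (y K) b = 2 * q * b `^ (p - 1) * (sg K * y K) - 2 * b `^ p * sg K.
    by rewrite /U; ring.
  rewrite !E !sy sy' HF {1}sgD; lra.
have := step M (leqnn _).
have : gsum M (fun I => sg I * U (y I) (a I)) [::] <=
       gsum M (fun I => (2 * q) `^ p * (y I `^ p * sg I) + - (a I `^ p * sg I)) [::].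
  apply: ler_gsum => J _; move: (J ++ [::]) => I.
  have H : U (y I) (a I) <= (2 * q) `^ p * y I `^ p - a I `^ p.
    rewrite /U -powRM//; last by lra.
    have Q0 : 0 <= 2 * q * y I by rewrite mulr_ge0//; lra.
    have := youngB1 p1 pq (a0 I) Q0.
    have E1 : a I `^ p / q <= a I `^ p by rewrite ler_piMr ?powR_ge0// invf_le1; lra.
    have E2 : (2 * q * y I) `^ p / p <= (2 * q * y I) `^ p.
      by rewrite ler_piMr ?powR_ge0// invf_le1; lra.
    lra.
  have := ler_pM2l (sg0 I) (U (y I) (a I)) ((2 * q) `^ p * y I `^ p - a I `^ p).
  rewrite H; lra.
by rewrite gsumD gsumN gsumZ; lra.
Qed.

End doob.

(** * The maximal function in weighted spaces under the diagonal condition *)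

Section weighted_maximal.
Context {R : realType}.
Variables (p q : R).
Hypotheses (p1 : 1 < p) (pq : p^-1 + q^-1 = 1).
Variables (mu w sg : seq bool -> R) (K : R).
Hypotheses (mu0 : forall I, 0 < mu I) (muD : tree_additive mu).
Hypotheses (w0 : forall I, 0 < w I) (wD : tree_additive w).
Hypotheses (sg0 : forall I, 0 < sg I) (sgD : tree_additive sg).
Hypothesis K0 : 0 < K.
Hypothesis muwsg : forall I, mu I <= w I `^ p^-1 * sg I `^ q^-1.
Hypothesis wsgmu : forall I, w I `^ p^-1 * sg I `^ q^-1 <= K * mu I.

Lemma conj_divl : p / q = p - 1.
Proof.
have hp := p1; have hq := conj_gt1 p1 pq.
apply: (@mulIf _ q); first by lra.
by rewrite divfK ?conj_mul//; lra.
Qed.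

Lemma conj_divr : q / p = q - 1.
Proof.
have hp := p1; have hq := conj_gt1 p1 pq.
apply: (@mulIf _ p); first by lra.
by rewrite divfK ?(conj_mulD p1)//; lra.
Qed.

Lemma powR_dual_le (F X S : R) : 0 <= F -> 0 <= X -> 0 <= S ->
  F <= X `^ p^-1 * S `^ q^-1 -> F `^ p <= X * S `^ (p - 1).
Proof.
move=> F0 X0 S0 H; have hp := p1.
have : F `^ p <= (X `^ p^-1 * S `^ q^-1) `^ p.
  by apply: ge0_ler_powR => //; rewrite ?nnegrE ?mulr_ge0 ?powR_ge0//; lra.
rewrite powRM ?powR_ge0// -!powRrM (mulrC q^-1) conj_divl mulVf ?powRr1//.
by lra.
Qed.

Lemma dual_le I : mu I `^ q <= w I `^ (q - 1) * sg I.
Proof.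
have hp := p1; have hq := conj_gt1 p1 pq.
have : mu I `^ q <= (w I `^ p^-1 * sg I `^ q^-1) `^ q.
  apply: ge0_ler_powR => //; rewrite ?nnegrE ?mulr_ge0 ?powR_ge0 ?(ltW (mu0 _))//; lra.
rewrite powRM ?powR_ge0// -!powRrM (mulrC p^-1) conj_divr mulVf ?powRr1//.
  exact: ltW.
by lra.
Qed.

(** The diagonal condition raised to the power [p]; the ratio [mu / w] is what later turns a
    [mu]-sum into a [w]-average. *)
Lemma Ap_le I : (sg I / mu I) `^ (p - 1) <= K `^ p * (mu I / w I).
Proof.
have hp := p1; have hq := conj_gt1 p1 pq.
have : (w I `^ p^-1 * sg I `^ q^-1) `^ p <= (K * mu I) `^ p.
  apply: ge0_ler_powR => //; rewrite ?nnegrE ?mulr_ge0 ?powR_ge0 ?(ltW (mu0 _)) ?(ltW K0)//; lra.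
rewrite powRM ?powR_ge0// -!powRrM (mulrC q^-1) conj_divl mulVf ?powRr1 ?(ltW (w0 _))//; last by lra.
rewrite (powRM _ (ltW K0) (ltW (mu0 _))) -(powRB1 p1 (ltW (mu0 I))) => H.
rewrite powRM ?invr_ge0 ?(ltW (sg0 _)) ?(ltW (mu0 _))//.
have -> : (mu I)^-1 `^ (p - 1) = (mu I `^ (p - 1))^-1.
  by rewrite -powR_inv1 ?(ltW (mu0 _))// powRAC powR_inv1 ?powR_ge0.
rewrite ler_pdivrMr ?powR_gt0//.
have -> : K `^ p * (mu I / w I) * mu I `^ (p - 1) =
  K `^ p * (mu I `^ (p - 1) * mu I) / w I by ring.
by rewrite ler_pdivlMr// mulrC.
Qed.

Variables (F : seq bool -> R) (M : nat).
Hypotheses (F0 : forall I, 0 <= F I) (FD : tree_additive F).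

Let y I := F I / sg I.
Let A := runmax y.
Let h I := A I `^ (p - 1) * mu I.
(** For [J] of depth at most [M], [H J / w J] is the [w]-average over [J] of the function equal to
    [A^(p-1) mu / w] on the nodes of depth [M]. *)
Let H J := gsum (M - size J) h J.

Let y0 I : 0 <= y I.
Proof. by rewrite divr_ge0// ltW. Qed.

Let A0 I : 0 <= A I.
Proof. exact: runmax_ge0. Qed.

Let h0 I : 0 <= h I.
Proof. by rewrite mulr_ge0 ?powR_ge0// ltW. Qed.

Let H0 I : 0 <= H I.
Proof. exact: gsum_ge0. Qed.

(** Factor [F / mu] as [F / sg] times [sg / mu]: the first factor is at most [A] at every leaf below
    [I], and [Ap_le] converts the second. *)
Let ptw I : (size I <= M)%N -> (F I / mu I) `^ (p - 1) <= K `^ p * (H I / w I).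
Proof.
move=> sI; have hp := p1.
have HI : y I `^ (p - 1) * mu I <= H I.
  rewrite -{1}(gsum_additive (M - size I) I muD) -gsumZ.
  apply: ler_gsum => J _; rewrite ler_pM2r//.
  apply: ge0_ler_powR; rewrite ?nnegrE//; first by lra.
  exact: le_trans (runmax_ge y I) (runmax_mono _ _ _).
have -> : F I / mu I = y I * (sg I / mu I).
  by rewrite /y mulrA divfK// gt_eqF.
rewrite powRM ?divr_ge0 ?(ltW (mu0 _)) ?(ltW (sg0 _))//.
apply: (le_trans (ler_wpM2l (powR_ge0 _ _) (Ap_le I))).
rewrite mulrCA ler_pM2l ?powR_gt0// mulrA ler_pM2r ?invr_gt0//.
Qed.

Let run I : (size I <= M)%N ->
  runmax (fun I => F I / mu I) I `^ (p - 1) <= K `^ p * runmax (fun I => H I / w I) I.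
Proof.
elim: I => [|c I IH] sI; first exact: ptw.
rewrite [runmax _ _]/= [X in _ * X]/=.
have [_|_] := leP (runmax (fun I => F I / mu I) I) (F (c :: I) / mu (c :: I)).
  apply: (le_trans (ptw sI)).
  by rewrite ler_pM2l ?powR_gt0// le_max lexx orbT.
apply: (le_trans (IH (ltnW sI))).
by rewrite ler_pM2l ?powR_gt0// le_max lexx.
Qed.

(* Lerner's argument: [(M f)^(p-1)] is dominated by the [w]-maximal function of
   [(M_sigma (f/sigma))^(p-1) / w], and Doob's inequality is applied twice *)
Lemma weighted_maximal :
  gsum M (fun I => runmax (fun I => F I / mu I) I `^ p * w I) [::] <=
  (K `^ p) `^ q * (2 * p) `^ q * (2 * q) `^ p *
     gsum M (fun I => y I `^ p * sg I) [::].
Proof.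
have hp := p1; have hq := conj_gt1 p1 pq.
have mp I : 0 <= F I / mu I by rewrite divr_ge0// ltW.
have Hw I : 0 <= H I / w I by rewrite divr_ge0// ltW.
apply: (@le_trans _ _ (gsum M (fun I => (K `^ p) `^ q * (runmax (fun I => H I / w I) I `^ q * w I)) [::])).
  apply: ler_gsum => J sJ; rewrite cats0 mulrA ler_pM2r//.
  rewrite -powRM ?powR_ge0 ?runmax_ge0//.
  rewrite -{1}(conj_mul p1 pq) powRrM.
  apply: ge0_ler_powR; rewrite ?nnegrE ?powR_ge0 ?mulr_ge0 ?powR_ge0 ?runmax_ge0//; first by lra.
  by apply: run; rewrite sJ.
rewrite gsumZ -!mulrA ler_pM2l ?powR_gt0//.
have qp : q^-1 + p^-1 = 1 by rewrite addrC.
have HD I : (size I < M)%N -> H I = H (false :: I) + H (true :: I).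
  by move=> sI; rewrite /H /= -(subnSK sI).
apply: (le_trans (doob_tree hq qp w0 wD H0 HD)).
rewrite ler_pM2l ?powR_gt0//; last by lra.
apply: le_trans (doob_tree p1 pq sg0 sgD F0 (M := M) _); last first.
  by move=> I _; exact: FD.
apply: ler_gsum => J sJ; rewrite cats0.
(* At depth [M] the sum [H] reduces to [h], and [(h / w)^q w = A^p mu^q w^(1-q) <= A^p sg] by
   [dual_le] and [(p - 1) q = p]. *)
rewrite /H sJ subnn /= /h -/y.
rewrite powRM ?mulr_ge0 ?powR_ge0 ?invr_ge0 ?(ltW (mu0 _)) ?(ltW (w0 _))//.
rewrite powRM ?powR_ge0 ?(ltW (mu0 _))// -powRrM conj_mul// -!mulrA ler_wpM2l ?powR_ge0//.
have -> : (w J)^-1 `^ q = (w J `^ q)^-1.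
  by rewrite -powR_inv1 ?(ltW (w0 _))// powRAC powR_inv1 ?powR_ge0.
rewrite mulrA -(powRB1 hq (ltW (w0 J))) -mulrA invfM -mulrA mulVf ?gt_eqF// mulr1.
by rewrite ler_pdivrMr ?powR_gt0// mulrC dual_le.
Qed.

End weighted_maximal.

(** * Energy of the truncated jumps against a frozen weight *)

Section telescoping.
Context {R : realType}.

Lemma gsum_telescope (Phi : seq bool -> R) k n0 B :
  (forall I, 0 <= Phi I) -> (forall n, (n <= n0 + k)%N -> gsum n Phi [::] <= B) ->
  \sum_(n < n0) gsum n (fun I => gsum k Phi I - Phi I) [::] <= k%:R * B.
Proof.
move=> P0 PB.
have := @telescope_le R (fun n => gsum n Phi [::]) k n0 B.
move=> /(_ (fun n => gsum_ge0 n _ P0) PB).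
by under eq_bigr do rewrite gsum_add -gsumN -gsumD.
Qed.

Lemma gsum_mono n M (Phi : seq bool -> R) :
  (n <= M)%N -> (forall k I, Phi I <= gsum k Phi I) ->
  gsum n Phi [::] <= gsum M Phi [::].
Proof.
by move=> nM H; rewrite -(subnKC nM) gsum_add; apply: ler_gsum => J _.
Qed.

End telescoping.

Section energy_real.
Context {R : realType}.
Implicit Types a y : R.

(* Convex and C^1 in [y], uniformly convex on [[0, a]] and linear beyond [a] *)
Definition hub a y : R := Num.min y a ^+ 2 / a + 2 * (y - Num.min y a) + a.

(** With [t = min y a], [hub a y] is [2 y + a] plus [t^2 / a - 2 t], which decreases for [t <= a].
    The mean of the truncated values is at most the truncated mean, so truncation errs in the right
    direction, and the variance of two points supplies the quadratic gain. *)
Lemma hub_step (m0 m1 y0 y1 a : R) : 0 < m0 -> 0 < m1 -> 0 < a ->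
  (m0 + m1) * hub a ((m0 * y0 + m1 * y1) / (m0 + m1)) +
  a^-1 * (m0 * m1 / (m0 + m1) * (Num.min y0 a - Num.min y1 a) ^+ 2) <=
  m0 * hub a y0 + m1 * hub a y1.
Proof.
move=> m00 m10 a0; have m_0 : 0 < m0 + m1 by exact: addr_gt0.
set x := (_ / (m0 + m1)).
set t0 := Num.min y0 a; set t1 := Num.min y1 a.
pose tb := (m0 * t0 + m1 * t1) / (m0 + m1).
have tbx : tb <= Num.min x a.
  rewrite le_min; apply/andP; split.
    rewrite ler_pM2r ?invr_gt0// lerD// ler_pM2l// ge_min lexx//.
  rewrite ler_pdivrMr// mulrDr lerD// mulrC ler_pM2r// ge_min lexx orbT//.
have tx : Num.min x a <= a by rewrite ge_min lexx orbT.
have ex : (m0 + m1) * x = m0 * y0 + m1 * y1 by rewrite /x mulrC divfK// gt_eqF.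
rewrite /hub -/t0 -/t1.
move: tbx tx; set tx := Num.min x a => tbx txa.
have Hq : tx ^+ 2 / a - 2 * tx <= tb ^+ 2 / a - 2 * tb.
  rewrite -subr_ge0.
  have -> : tb ^+ 2 / a - 2 * tb - (tx ^+ 2 / a - 2 * tx) =
     (tx - tb) * (2 * a - tb - tx) / a by field; rewrite gt_eqF.
  by rewrite divr_ge0 ?(ltW a0)// mulr_ge0//; lra.
have Hm : m0 * (t0 ^+ 2 / a - 2 * t0) + m1 * (t1 ^+ 2 / a - 2 * t1) =
   (m0 + m1) * (tb ^+ 2 / a - 2 * tb) + a^-1 * (m0 * m1 / (m0 + m1) * (t0 - t1) ^+ 2).
  by rewrite /tb; field; rewrite !gt_eqF.
have := ler_wpM2l (ltW m_0) Hq.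
have -> : (m0 + m1) * (tx ^+ 2 / a + 2 * (x - tx) + a) =
   (m0 + m1) * (tx ^+ 2 / a - 2 * tx) + 2 * ((m0 + m1) * x) + (m0 + m1) * a by ring.
rewrite ex; lra.
Qed.

(** The price of unfreezing the height. For [y > a] the left side is [4 y], and the claim is
    [(a' - y) (3 a' - y) >= 0]; this is the origin of the coefficient 3 in [Psi]. *)
Lemma hub_le (a a' y : R) : 0 < a -> 0 <= y -> a <= a' -> y <= a' ->
  hub a y + 2 * Num.max 0 (y - a) + 2 * a <= y ^+ 2 / a' + 3 * a'.
Proof.
move=> a0 y0 aa' ya'; have a'0 : 0 < a' by lra.
rewrite /hub; have [ya|ay] := leP y a.
  have -> : Num.max 0 (y - a) = 0 by apply/max_l; lra.
  suff : y ^+ 2 / a <= y ^+ 2 / a' + (a' - a) by lra.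
  rewrite -subr_ge0.
  have -> : y ^+ 2 / a' + (a' - a) - y ^+ 2 / a = (a' - a) * (a * a' - y * y) / (a * a').
    by field; rewrite !gt_eqF.
  rewrite divr_ge0 ?mulr_ge0 ?(ltW a0) ?(ltW a'0)//; first by lra.
  by rewrite subr_ge0 ler_pM.
have -> : Num.max 0 (y - a) = y - a by apply/max_r; lra.
have -> : a ^+ 2 / a = a by field; rewrite gt_eqF.
suff : 4 * y <= y ^+ 2 / a' + 3 * a' by lra.
rewrite -subr_ge0.
have -> : y ^+ 2 / a' + 3 * a' - 4 * y = (a' - y) * (3 * a' - y) / a'.
  by field; rewrite !gt_eqF.
by rewrite divr_ge0 ?mulr_ge0 ?(ltW a'0)//; lra.
Qed.

End energy_real.

Section energy.
Context {R : realType}.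
Variables (mu F b : seq bool -> R).
Hypotheses (mu0 : forall I, 0 < mu I) (muD : tree_additive mu).
Hypotheses (F0 : forall I, 0 <= F I) (FD : tree_additive F).
Hypotheses (b0 : forall I, 0 <= b I) (b_mono : forall I J, b I <= b (J ++ I)).

Let y I := F I / mu I.
Let a := runmax y.

(** The quantity [m] on the tree; it lies between half the mass of the lighter child and that
    mass. *)
Definition mass_min (mu : seq bool -> R) I := mu (false :: I) * mu (true :: I) / mu I.

Definition trunc_jump (mu F : seq bool -> R) (a : R) I :=
  Num.min (F (false :: I) / mu (false :: I)) a - Num.min (F (true :: I) / mu (true :: I)) a.

Let y0 I : 0 <= y I.
Proof. by rewrite divr_ge0// ltW. Qed.

Let a0 I : 0 <= a I.
Proof. exact: runmax_ge0. Qed.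

Let muy I : mu I * y I = F I.
Proof. by rewrite mulrC divfK// gt_eqF. Qed.

Let hub_node c I : 0 < c ->
  mu I * hub c (y I) + c^-1 * (mass_min mu I * trunc_jump mu F c I ^+ 2) <=
  mu (false :: I) * hub c (y (false :: I)) + mu (true :: I) * hub c (y (true :: I)).
Proof.
move=> c0.
have := hub_step (y (false :: I)) (y (true :: I)) (mu0 (false :: I)) (mu0 (true :: I)) c0.
by rewrite !muy -muD -FD.
Qed.

Let hub_desc c s I : 0 < c ->
  mu I * hub c (y I) + c^-1 * gsum s (fun J => mass_min mu J * trunc_jump mu F c J ^+ 2) I <=
  gsum s.+1 (fun J => mu J * hub c (y J)) I.
Proof.
move=> c0.
have jens n : mu I * hub c (y I) <= gsum n (fun J => mu J * hub c (y J)) I.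
  elim: n => [//|n IH]; apply: (le_trans IH); rewrite gsumSr.
  apply: ler_gsum => J _; apply: le_trans (hub_node _ c0).
  rewrite lerDl mulr_ge0 ?invr_ge0 ?(ltW c0)// mulr_ge0 ?sqr_ge0//.
  by rewrite divr_ge0 ?mulr_ge0 ?(ltW (mu0 _)).
rewrite gsumSr -gsumZ.
apply: (le_trans (lerD (jens s) (lexx _))); rewrite -gsumD.
by apply: ler_gsum => J _; exact: hub_node.
Qed.

Let Psi I := mu I * (b I * (y I ^+ 2 / a I + 3 * a I)).

Let Psi0 I : 0 <= Psi I.
Proof.
by rewrite mulr_ge0 ?(ltW (mu0 _))// mulr_ge0// addr_ge0 ?divr_ge0 ?sqr_ge0// mulr_ge0.
Qed.

(** The potential frozen at height [a I] gains the energy of the truncated jumps; [hub_le] then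
    restores the running height at the descendants and leaves twice the excess over [a I]. Replacing
    [b I] by its value at a descendant only increases the right side. *)
Let energy_node s I :
  b I * ((a I)^-1 * gsum s (fun J => mass_min mu J * trunc_jump mu F (a I) J ^+ 2) I
         + 2 * gsum s.+1 (fun J => mu J * Num.max 0 (y J - a I)) I)
  <= gsum s.+1 Psi I - Psi I.
Proof.
have ya : y I <= a I by exact: runmax_ge.
have := a0 I; rewrite le_eqVlt => /predU1P[ea|aI0].
  (* Height zero forces [F I = 0]: the energy term disappears through [0^-1 = 0], and the excess
     sums to [F I]. *)
  have yI0 : y I = 0 by apply: le_anti; rewrite y0 andbT ea.
  have -> : Psi I = 0 by rewrite /Psi -ea yI0 expr0n /= mul0r mulr0 addr0 !mulr0.
  rewrite -ea subr0 invr0 mul0r add0r.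
  rewrite (@eq_gsum _ s.+1 _ F); last first.
    by move=> J _; rewrite subr0 (max_idPr _) ?muy.
  rewrite gsum_additive// -muy yI0 !mulr0.
  by apply: gsum_ge0.
have H : gsum s.+1 (fun J => b I * (mu J * hub (a I) (y J) +
     2 * (mu J * Num.max 0 (y J - a I)) + 2 * a I * mu J)) I <= gsum s.+1 Psi I.
  apply: ler_gsum => J _; set K := J ++ I.
  rewrite /Psi.
  have -> : mu K * hub (a I) (y K) + 2 * (mu K * Num.max 0 (y K - a I)) + 2 * a I * mu K =
    mu K * (hub (a I) (y K) + 2 * Num.max 0 (y K - a I) + 2 * a I) by ring.
  rewrite [leRHS]mulrCA.
  apply: le_trans (ler_wpM2l (b0 I) (ler_wpM2l (ltW (mu0 K)) (hub_le aI0 (y0 K) (runmax_mono y I J) (runmax_ge y K)))) _.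
  apply: ler_wpM2r; last exact: b_mono.
  rewrite mulr_ge0 ?(ltW (mu0 _))// addr_ge0 ?divr_ge0 ?sqr_ge0// mulr_ge0//.
move: H; rewrite gsumZ !gsumD !gsumZ (gsum_additive _ _ muD) => H.
have := ler_wpM2l (b0 I) (hub_desc s I aI0).
have : hub (a I) (y I) = y I ^+ 2 / a I + a I.
  by rewrite /hub min_l//; lra.
move: H; rewrite /Psi => H ->; lra.
Qed.

(** Since [y <= a], [Psi] is at most [4 mu a b]. As [a b] grows along branches, the sums of [mu a b]
    over a level increase with the level, and the level [M] dominates. *)
Lemma energy_tree s n0 M : (n0 + s < M)%N ->
  \sum_(n < n0) gsum n (fun I =>
    b I * ((a I)^-1 * gsum s (fun J => mass_min mu J * trunc_jump mu F (a I) J ^+ 2) I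
         + 2 * gsum s.+1 (fun J => mu J * Num.max 0 (y J - a I)) I)) [::]
  <= s.+1%:R * (4 * gsum M (fun I => mu I * (a I * b I)) [::]).
Proof.
move=> nsM; apply: le_trans (@gsum_telescope _ Psi s.+1 n0 _ Psi0 _).
  by apply: ler_sum => n _; apply: ler_gsum => J _; exact: energy_node.
move=> n nn0; rewrite -gsumZ.
apply: (@le_trans _ _ (gsum n (fun I => 4 * (mu I * (a I * b I))) [::])).
  apply: ler_gsum => J _; move: (J ++ [::]) => I; rewrite /Psi [leRHS]mulrCA ler_pM2l//.
  rewrite [leRHS]mulrA mulrC ler_wpM2r//.
  suff : y I ^+ 2 / a I <= a I by lra.
  have := a0 I; rewrite le_eqVlt => /predU1P[<-|aI0]; first by rewrite invr0 mulr0.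
  by rewrite ler_pdivrMr// -expr2 ler_pXn2r ?nnegrE//; exact: runmax_ge.
apply: gsum_mono; first by lia.
move=> k I; rewrite gsumZ ler_pM2l//.
apply: (@le_trans _ _ (gsum k (fun J => (a I * b I) * mu J) I)).
  by rewrite gsumZ gsum_additive// mulrC.
apply: ler_gsum => J _; rewrite mulrC ler_pM2l// ler_pM//; exact: runmax_mono.
Qed.

End energy.

(** * Values exceeding twice the running maximum *)

Section doubling.
Context {R : realType}.
Variables (w y : seq bool -> R) (p : R).
Hypotheses (p1 : 1 < p).
Hypotheses (w0 : forall I, 0 < w I) (wD : tree_additive w) (y0 : forall I, 0 <= y I).
Let a := runmax y.

Definition big_value (a p y : R) : R := if y > 2 * a then y `^ p else 0.

Let a0 I : 0 <= a I.
Proof. exact: runmax_ge0. Qed.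

(* Along a branch, the values exceeding twice the earlier maximum grow
   geometrically, so the sum of their [p]-th powers telescopes *)
Lemma doubling_tree s n0 M : (n0 + s < M)%N ->
  \sum_(n < n0) gsum n (fun I => gsum s.+1 (fun J => big_value (a I) p (y J) * w J) I) [::]
  <= 2 * s.+1%:R * gsum M (fun I => a I `^ p * w I) [::].
Proof.
move=> nsM; have hp := p1.
pose Q I := a I `^ p * w I.
have mono I J : a I `^ p <= a (J ++ I) `^ p.
  by apply: ge0_ler_powR; rewrite ?nnegrE//; [lra|exact: runmax_mono].
have B n : (n <= n0 + s.+1)%N -> gsum n Q [::] <= gsum M Q [::].
  move=> nn; apply: gsum_mono; first by lia.
  move=> k I; rewrite /Q -{1}(gsum_additive k I wD) -gsumZ.
  by apply: ler_gsum => J _; rewrite ler_pM2r.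
have Q0 I : 0 <= Q I by rewrite mulr_ge0 ?powR_ge0// ltW.
have := gsum_telescope Q0 B; rewrite -/Q => H.
rewrite -mulrA -ler_pdivrMl//; apply: le_trans H.
rewrite mulr_sumr; apply: ler_sum => n _; rewrite -gsumZ.
apply: ler_gsum => J _; move: (J ++ [::]) => I {J}.
rewrite -gsumZ {2}/Q -{1}(gsum_additive s.+1 I wD) -gsumZ -gsumN -gsumD.
apply: ler_gsum => J _; move: (mono I J) (runmax_ge y (J ++ I)); rewrite -/a.
move: (J ++ I) => K mK yaK.
rewrite /Q -mulrBl mulrA ler_pM2r// /big_value; case: ifP => [yI|_]; last by lra.
have h1 : y K `^ p <= a K `^ p by apply: ge0_ler_powR; rewrite ?nnegrE//; lra.
have h2 : (2 * a I) `^ p <= y K `^ p.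
  by apply: ge0_ler_powR; rewrite ?nnegrE ?mulr_ge0//; lra.
(* For [p >= 1] a value above [2 a I] has at least twice the power, so the growth of [a^p] from [I]
   to [K] is at least half of [y K^p]; hence the factor 2 in the statement. *)
have h3 : 2 * a I `^ p <= (2 * a I) `^ p.
  by rewrite powRM// ler_wpM2r ?powR_ge0// le1r_powR//; lra.
lra.
Qed.

End doubling.

(** * Comparing distant nodes through chains of cross conditions *)

Section chain.
Context {R : realType}.
Variables (mu u v : seq bool -> R) (K kappa : R).
Hypotheses (mu0 : forall I, 0 < mu I) (muD : tree_additive mu).
Hypotheses (u0 : forall I, 0 < u I) (v0 : forall I, 0 < v I).
Hypotheses (uS : forall I, u I <= u (false :: I) + u (true :: I)).
Hypotheses (vS : forall I, v I <= v (false :: I) + v (true :: I)).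
Hypotheses (K0 : 0 < K) (kappa1 : 1 <= kappa).
Hypothesis muuv : forall I, mu I <= u I * v I.
Hypothesis uvmu : forall I, u I * v I <= K * mu I.
Let m := mass_min mu.
Hypothesis bal : forall c I, m I <= kappa * m (c :: I).
Hypothesis cross : forall c d I,
  m I * (u (c :: I) * v (d :: ~~ c :: I)) <= K * (mu (c :: I) * mu (d :: ~~ c :: I)).

Lemma mass_min_gt0 I : 0 < m I.
Proof. by rewrite divr_gt0 ?mulr_gt0. Qed.

Lemma mass_min_le c I : m I <= mu (c :: I).
Proof.
rewrite /m /mass_min ler_pdivrMr// (muD I).
have := mu0 (false :: I); have := mu0 (true :: I).
by case: c => h1 h2; nra.
Qed.

(** The lighter child, of mass between [m I] and [2 * m I]: the right place to chain, since the
    estimates gain exactly a factor [m]. *)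
Let small I := (mu (true :: I) < mu (false :: I)) :: I.

Let mu_child c I : mu (c :: I) <= mu I.
Proof.
rewrite (muD I); have := mu0 (false :: I); have := mu0 (true :: I).
by case: c; lra.
Qed.

Let small_le I : mu (small I) <= 2 * m I.
Proof.
rewrite /small /m /mass_min mulrA ler_pdivlMr// (muD I).
have := mu0 (false :: I); have := mu0 (true :: I).
by case: (ltP (mu (true :: I)) (mu (false :: I))) => h h1 h2; nra.
Qed.

(** In this normalization a cross condition reads [m I * r <= K], and either argument can be
    replaced by its two children at the cost of a sum. *)
Definition cross_ratio (u v mu : seq bool -> R) I J := u I * v J / (mu I * mu J).
Let r := cross_ratio u v mu.

Let r0 I J : 0 <= r I J.
Proof. by rewrite divr_ge0 ?mulr_ge0 ?(ltW (u0 _)) ?(ltW (v0 _)) ?(ltW (mu0 _)). Qed.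

Let m0 I : 0 <= m I := ltW (mass_min_gt0 I).

Let mr_le I J L C : m I * (u J * v L) <= C * (mu J * mu L) -> m I * r J L <= C.
Proof. by move=> H; rewrite /r /cross_ratio mulrA ler_pdivrMr ?mulr_gt0. Qed.

Let r_subl I J : r I J <= r (false :: I) J + r (true :: I) J.
Proof.
have H c : u (c :: I) * v J / (mu I * mu J) <= r (c :: I) J.
  rewrite ler_wpM2l ?mulr_ge0 ?(ltW (u0 _)) ?(ltW (v0 _))// lef_pV2 ?posrE ?mulr_gt0//.
  by rewrite ler_pM2r.
apply: le_trans (lerD (H false) (H true)).
by rewrite -!mulrDl ler_pM2r ?invr_gt0 ?mulr_gt0// ler_pM2r.
Qed.

Let r_subr I J : r I J <= r I (false :: J) + r I (true :: J).
Proof.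
have H c : u I * v (c :: J) / (mu I * mu J) <= r I (c :: J).
  rewrite ler_wpM2l ?mulr_ge0 ?(ltW (u0 _)) ?(ltW (v0 _))// lef_pV2 ?posrE ?mulr_gt0//.
  by rewrite ler_pM2l.
apply: le_trans (lerD (H false) (H true)).
by rewrite -mulrDl -mulrDr ler_pM2r ?invr_gt0 ?mulr_gt0// ler_pM2l.
Qed.

Let r_same c I : m I * r (c :: I) (c :: I) <= K.
Proof.
apply: mr_le; rewrite [leRHS]mulrA [leRHS]mulrC.
apply: ler_pM => //; last exact: mass_min_le.
by rewrite mulr_ge0 ?(ltW (u0 _)) ?(ltW (v0 _)).
Qed.

Let r_children c d I : m I * r (c :: I) (d :: I) <= 2 * K.
Proof.
have [->|cd] := eqVneq c d.
  by apply: (le_trans (r_same d I)); have := K0; lra.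
have -> : d = ~~ c by case: c d cd => [] [].
apply: (le_trans (ler_wpM2l (m0 I) (r_subr _ _))).
by rewrite mulrDr mulrDl mul1r lerD//; apply: mr_le.
Qed.

Let r_up c I : m I * r I (c :: I) <= 4 * K.
Proof.
apply: (le_trans (ler_wpM2l (m0 I) (r_subl _ _))).
by have := r_children false c I; have := r_children true c I; lra.
Qed.

(** An intermediate node can be inserted because [u J * v J >= mu J]. The factor [mu J] is
    affordable when [J] is a lighter child. *)
Let r_trans I J L : r I L <= mu J * (r I J * r J L).
Proof.
have -> : mu J * (r I J * r J L) = r I L * (u J * v J / mu J).
  by rewrite /r /cross_ratio; field; rewrite !gt_eqF.
by rewrite ler_peMr// ler_pdivlMr// mul1r.
Qed.

(** If the step enters the lighter child, balance moves the estimate to [c :: I]. Otherwise the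
    lighter child and the lighter grandchild lie on opposite sides of [I] and form a cross pair. *)
Let r_small_step c I : m I * r (small I) (small (c :: I)) <= 4 * kappa * K.
Proof.
have kK : K <= 4 * kappa * K.
  by rewrite -[leLHS]mul1r ler_pM2r//; have := kappa1; lra.
rewrite {1}/small /=; set d := (_ < _).
have [->|dc] := eqVneq d c.
  apply: (@le_trans _ _ (kappa * m (c :: I) * r (c :: I) (small (c :: I)))).
    by rewrite ler_wpM2r.
  rewrite -(mulrA kappa) (mulrC 4) -(mulrA kappa) ler_pM2l; first exact: r_up.
  by have := kappa1; lra.
have -> : c = ~~ d by case: c d dc => [] [].
by apply: le_trans kK; apply: mr_le; exact: cross.
Qed.

Let r_small_desc J I :
  m I * r (small I) (small (J ++ I)) <= 2 * K * (8 * kappa * K) ^+ size J.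
Proof.
elim: J => [|c J IH] /=; first by rewrite expr0 mulr1 r_children.
apply: (le_trans (ler_wpM2l (m0 I) (r_trans _ (small (J ++ I)) _))).
have -> : m I * (mu (small (J ++ I)) * (r (small I) (small (J ++ I)) *
   r (small (J ++ I)) (small (c :: J ++ I)))) = (m I * r (small I) (small (J ++ I))) *
   (mu (small (J ++ I)) * r (small (J ++ I)) (small (c :: J ++ I))) by ring.
rewrite exprSr [leRHS]mulrA; apply: ler_pM => //;
  [by rewrite mulr_ge0|by rewrite mulr_ge0 ?(ltW (mu0 _))|].
have : mu (small (J ++ I)) * r (small (J ++ I)) (small (c :: J ++ I)) <=
  2 * m (J ++ I) * r (small (J ++ I)) (small (c :: J ++ I)) by rewrite ler_wpM2r.
by have := r_small_step c (J ++ I); lra.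
Qed.

(** The chain runs through the lighter children of the nodes on the branch from [I]. Each generation
    costs [8 kappa K]: 4 from the step, 2 from the mass of the intermediate node. The two ends cost
    [2 K] and [4 K]. *)
Lemma chain_down c J I :
  m I * r (small I) (c :: J ++ I) <= 8 * K ^+ 2 * (8 * kappa * K) ^+ size J.
Proof.
apply: (le_trans (ler_wpM2l (m0 I) (r_trans _ (small (J ++ I)) _))).
have -> : m I * (mu (small (J ++ I)) * (r (small I) (small (J ++ I)) *
   r (small (J ++ I)) (c :: J ++ I))) = (m I * r (small I) (small (J ++ I))) *
   (mu (small (J ++ I)) * r (small (J ++ I)) (c :: J ++ I)) by ring.
have -> : 8 * K ^+ 2 * (8 * kappa * K) ^+ size J =
  (2 * K * (8 * kappa * K) ^+ size J) * (4 * K) by ring.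
apply: ler_pM; [by rewrite mulr_ge0|by rewrite mulr_ge0 ?(ltW (mu0 _))|exact: r_small_desc|].
have : mu (small (J ++ I)) * r (small (J ++ I)) (c :: J ++ I) <=
  2 * m (J ++ I) * r (small (J ++ I)) (c :: J ++ I) by rewrite ler_wpM2r.
have := r_children (mu (true :: J ++ I) < mu (false :: J ++ I)) c (J ++ I).
rewrite -/(small (J ++ I)); lra.
Qed.

End chain.

Section chain_both.
Context {R : realType}.
Variables (mu u v : seq bool -> R) (K kappa : R).
Hypotheses (mu0 : forall I, 0 < mu I) (muD : tree_additive mu).
Hypotheses (u0 : forall I, 0 < u I) (v0 : forall I, 0 < v I).
Hypotheses (uS : forall I, u I <= u (false :: I) + u (true :: I)).
Hypotheses (vS : forall I, v I <= v (false :: I) + v (true :: I)).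
Hypotheses (K0 : 0 < K) (kappa1 : 1 <= kappa).
Hypothesis muuv : forall I, mu I <= u I * v I.
Hypothesis uvmu : forall I, u I * v I <= K * mu I.
Let m := mass_min mu.
Hypothesis bal : forall c I, m I <= kappa * m (c :: I).
Hypothesis cross : forall c d I,
  m I * (u (c :: I) * v (d :: ~~ c :: I)) <= K * (mu (c :: I) * mu (d :: ~~ c :: I)).
Hypothesis cross' : forall c d I,
  m I * (u (d :: ~~ c :: I) * v (c :: I)) <= K * (mu (c :: I) * mu (d :: ~~ c :: I)).

Definition chain_cst K kappa s t : R :=
  2 * (8 * K ^+ 2 * (8 * kappa * K) ^+ s) * (8 * K ^+ 2 * (8 * kappa * K) ^+ t).

(* Two descendants are compared through smaller children, whose mass is
   comparable to [m I]; there the two-weight condition may be inverted *)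
Lemma mass_min_le_cross c d J L I :
  m I <= chain_cst K kappa (size J) (size L) * (u (c :: J ++ I) * v (d :: L ++ I)).
Proof.
set J' := c :: J ++ I; set L' := d :: L ++ I.
set S := (mu (true :: I) < mu (false :: I)) :: I.
have mS : 0 < mu S by exact: mu0.
have mI : 0 < m I by exact: mass_min_gt0.
have SL : mu S <= 2 * m I.
  rewrite /S /m /mass_min mulrA ler_pdivlMr// (muD I).
  have := mu0 (false :: I); have := mu0 (true :: I).
  case: (ltP (mu (true :: I)) (mu (false :: I))) => h h1 h2.
    by nra.
  by nra.
have H1 : m I * (u S * v J' / (mu S * mu J')) <= 8 * K ^+ 2 * (8 * kappa * K) ^+ size J.
  by apply: (@chain_down _ mu u v K kappa).
have H2 : m I * (v S * u L' / (mu S * mu L')) <= 8 * K ^+ 2 * (8 * kappa * K) ^+ size L.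
  apply: (@chain_down _ mu v u K kappa) => //.
  - by move=> e; rewrite mulrC.
  - by move=> e; rewrite mulrC.
  - by move=> e f g; rewrite [v _ * u _]mulrC cross'.
move: H1 H2; rewrite /chain_cst.
set C1 := (X in _ <= X -> _); set C2 := (X in _ -> _ <= X -> _) => H1 H2.
have H : (m I * (u S * v J' / (mu S * mu J'))) * (m I * (v S * u L' / (mu S * mu L'))) <= C1 * C2.
  by apply: ler_pM => //; apply: mulr_ge0 (ltW mI) _; apply: divr_ge0; apply: mulr_ge0; apply: ltW.
have uvS : mu S <= u S * v S by exact: muuv.
have HJ := muuv J'; have HL := muuv L'.
have C0 : 0 <= C1 * C2.
  by apply: le_trans H; apply: mulr_ge0; apply: mulr_ge0 (ltW mI) _; apply: divr_ge0; apply: mulr_ge0; apply: ltW.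
(* One power of [m I] compensates [mu S <= 2 m I]; the other survives, and [v J' * u L'] cancels
   once [mu J'] and [mu L'] are replaced by the products [u v]. *)
have H3 : m I ^+ 2 * (v J' * u L') / (mu S * mu J' * mu L') <= C1 * C2.
  apply: le_trans H.
  have -> : m I * (u S * v J' / (mu S * mu J')) * (m I * (v S * u L' / (mu S * mu L'))) =
    m I ^+ 2 * (v J' * u L') / (mu S * mu J' * mu L') * (u S * v S / mu S).
    by field; rewrite !gt_eqF.
  apply: ler_peMr; last by rewrite ler_pdivlMr// mul1r.
  apply: divr_ge0; last first.
    by apply: mulr_ge0; [apply: mulr_ge0|]; apply: ltW.
  by apply: mulr_ge0; [exact: sqr_ge0|apply: mulr_ge0; apply: ltW].
move: H3; rewrite ler_pdivrMr ?mulr_gt0// => H3.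
have H4 : m I ^+ 2 * (v J' * u L') <= C1 * C2 * (2 * m I * (u J' * v J') * (u L' * v L')).
  apply: (le_trans H3); rewrite ler_wpM2l//.
  apply: ler_pM => //; [by apply: mulr_ge0; apply: ltW|exact: ltW|].
  by apply: ler_pM => //; exact: ltW.
rewrite -(ler_pM2r (mulr_gt0 mI (mulr_gt0 (v0 J') (u0 L')))).
move: H4.
have -> : m I ^+ 2 * (v J' * u L') = m I * (m I * (v J' * u L')) by ring.
by move/le_trans; apply; rewrite le_eqVlt; apply/orP; left; apply/eqP; rewrite /C1 /C2; ring.
Qed.

End chain_both.

(** * The product of two jumps, split at the two heights *)

Section product_bound.
Context {R : realType}.

(** The weights [b / a] and [a / b] attach to each energy the height of the other function. At
    height zero the convention [0^-1 = 0] must be matched by a vanishing jump. *)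
Lemma amgm_weighted (a b x y : R) : 0 <= a -> 0 <= b -> 0 <= x -> 0 <= y ->
  (a = 0 -> x = 0) -> (b = 0 -> y = 0) ->
  x * y <= b * (a^-1 * x ^+ 2) + a * (b^-1 * y ^+ 2).
Proof.
move=> a0 b0 x0 y0 ha hb.
have nn : 0 <= b * (a^-1 * x ^+ 2) + a * (b^-1 * y ^+ 2).
  by rewrite addr_ge0// !mulr_ge0 ?invr_ge0 ?sqr_ge0.
have [/ha xE|an0] := eqVneq a 0; first by rewrite {1}xE mul0r.
have [/hb yE|bn0] := eqVneq b 0; first by rewrite {1}yE mulr0.
have ap : 0 < a by rewrite lt_def an0.
have bp : 0 < b by rewrite lt_def bn0.
rewrite -subr_ge0.
have -> : b * (a^-1 * x ^+ 2) + a * (b^-1 * y ^+ 2) - x * y =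
  ((b * x - a * y) ^+ 2 + a * b * (x * y)) / (a * b) by field; rewrite an0 bn0.
by rewrite divr_ge0 ?addr_ge0 ?sqr_ge0 ?mulr_ge0.
Qed.

(** Each difference is at most a truncated jump plus two excesses. Truncated times truncated is the
    weighted mean inequality; truncated times excess uses [|T| <= a] and [S <= B nu']. So does a
    product of excesses, unless both values exceed twice their heights: only there is the hypothesis
    on [S * (Y c * Y' d)] used. The 3 counts an excess once against a truncated jump and twice
    against the excesses of the other function. *)
Lemma product_bound (a b B S mJ mK p q : R) (Y Y' nu nu' w sg : bool -> R)
    (T := Num.min (Y false) a - Num.min (Y true) a)
    (T' := Num.min (Y' false) b - Num.min (Y' true) b)
    (e := fun c => nu c * Num.max 0 (Y c - a))
    (e' := fun c => nu' c * Num.max 0 (Y' c - b))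
    (g := fun c => big_value a p (Y c) * w c)
    (g' := fun c => big_value b q (Y' c) * sg c) :
  0 <= a -> 0 <= b -> 1 <= B -> 0 <= mJ -> 0 <= mK ->
  (forall c, 0 <= Y c) -> (forall c, 0 <= Y' c) ->
  (forall c, 0 <= nu c) -> (forall c, 0 <= nu' c) ->
  (forall c, 0 <= w c) -> (forall c, 0 <= sg c) ->
  S = Num.sqrt mJ * Num.sqrt mK ->
  (forall c, S <= B * nu c) -> (forall c, S <= B * nu' c) ->
  (forall c d, S * (Y c * Y' d) <= B * (Y c `^ p * w c + Y' d `^ q * sg d)) ->
  Num.sqrt mJ * `|Y false - Y true| * (Num.sqrt mK * `|Y' false - Y' true|) <=
  3 * B * (b * (a^-1 * (mJ * T ^+ 2) + (e false + e true)) + (g false + g true)) +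
  3 * B * (a * (b^-1 * (mK * T' ^+ 2) + (e' false + e' true)) + (g' false + g' true)).
Proof.
move=> a0 b0 B1 mJ0 mK0 Y0 Y'0 nu0 nu'0 w0 sg0 SE Sn Sn' SY.
pose x c := Num.max 0 (Y c - a); pose x' c := Num.max 0 (Y' c - b).
have x0 c : 0 <= x c by rewrite le_max lexx.
have x'0 c : 0 <= x' c by rewrite le_max lexx.
have S0 : 0 <= S by rewrite SE mulr_ge0 ?sqrtr_ge0.
have Yx c : Y c = Num.min (Y c) a + x c.
  by rewrite /x; case: (leP (Y c) a) => h; [rewrite max_l|rewrite max_r]; lra.
have Y'x c : Y' c = Num.min (Y' c) b + x' c.
  by rewrite /x'; case: (leP (Y' c) b) => h; [rewrite max_l|rewrite max_r]; lra.
have dY : `|Y false - Y true| <= `|T| + (x false + x true).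
  have -> : Y false - Y true = T + (x false - x true).
    by rewrite {1}(Yx false) {1}(Yx true) /T; lra.
  apply: (le_trans (ler_normD _ _)); rewrite lerD2l.
  by rewrite (le_trans (ler_normB _ _))// !ger0_norm.
have dY' : `|Y' false - Y' true| <= `|T'| + (x' false + x' true).
  have -> : Y' false - Y' true = T' + (x' false - x' true).
    by rewrite {1}(Y'x false) {1}(Y'x true) /T'; lra.
  apply: (le_trans (ler_normD _ _)); rewrite lerD2l.
  by rewrite (le_trans (ler_normB _ _))// !ger0_norm.
have min_bd (u c : R) : 0 <= u -> 0 <= c -> 0 <= Num.min u c <= c.
  by move=> u0 c0; rewrite le_min u0 c0 ge_min lexx orbT.
have Ta : `|T| <= a.
  have /andP[h1 h2] := min_bd _ _ (Y0 false) a0.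
  have /andP[h3 h4] := min_bd _ _ (Y0 true) a0.
  by rewrite ler_norml /T; apply/andP; split; lra.
have T'b : `|T'| <= b.
  have /andP[h1 h2] := min_bd _ _ (Y'0 false) b0.
  have /andP[h3 h4] := min_bd _ _ (Y'0 true) b0.
  by rewrite ler_norml /T'; apply/andP; split; lra.
have E0 c : 0 <= e c by rewrite mulr_ge0// x0.
have E'0 c : 0 <= e' c by rewrite mulr_ge0// x'0.
have G0 c : 0 <= g c.
  by rewrite mulr_ge0// /big_value; case: ifP => // _; exact: powR_ge0.
have G'0 c : 0 <= g' c.
  by rewrite mulr_ge0// /big_value; case: ifP => // _; exact: powR_ge0.
have t1 : S * (`|T| * `|T'|) <= b * (a^-1 * (mJ * T ^+ 2)) + a * (b^-1 * (mK * T' ^+ 2)).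
  have -> : S * (`|T| * `|T'|) = (Num.sqrt mJ * `|T|) * (Num.sqrt mK * `|T'|).
    by rewrite SE; ring.
  apply: le_trans (amgm_weighted a0 b0 _ _ _ _) _; rewrite ?mulr_ge0 ?sqrtr_ge0//.
  - move=> aE; rewrite aE in Ta.
    by rewrite (_ : `|T| = 0) ?mulr0//; apply: le_anti; rewrite Ta normr_ge0.
  - move=> bE; rewrite bE in T'b.
    by rewrite (_ : `|T'| = 0) ?mulr0//; apply: le_anti; rewrite T'b normr_ge0.
  by rewrite !exprMn !sqr_sqrtr// !real_normK ?num_real.
have t2 c : S * (`|T| * x' c) <= B * (a * e' c).
  have : S * (`|T| * x' c) <= (B * nu' c) * (a * x' c).
    by apply: ler_pM => //; [rewrite mulr_ge0|rewrite ler_wpM2r].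
  by rewrite /e' -/(x' c); lra.
have t3 c : S * (x c * `|T'|) <= B * (b * e c).
  have : S * (x c * `|T'|) <= (B * nu c) * (x c * b).
    by apply: ler_pM => //; [rewrite mulr_ge0|rewrite ler_wpM2l].
  by rewrite /e -/(x c); lra.
have t4 c d : S * (x c * x' d) <= B * (a * e' d + b * e c + g c + g' d).
  have B0 : 0 <= B by lra.
  have ae : 0 <= a * e' d by rewrite mulr_ge0.
  have be : 0 <= b * e c by rewrite mulr_ge0.
  have gc := G0 c; have gd := G'0 d.
  have [Yc|Yc] := leP (Y c) (2 * a).
    have xa : x c <= a by rewrite ge_max a0; lra.
    have : S * (x c * x' d) <= (B * nu' d) * (a * x' d).
      by apply: ler_pM => //; [rewrite mulr_ge0|rewrite ler_wpM2r].
    move/le_trans; apply.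
    have -> : B * nu' d * (a * x' d) = B * (a * e' d) by rewrite /e' -/(x' d); ring.
    by rewrite ler_wpM2l//; lra.
  have [Yd|Yd] := leP (Y' d) (2 * b).
    have xb : x' d <= b by rewrite ge_max b0; lra.
    have : S * (x c * x' d) <= (B * nu c) * (x c * b).
      by apply: ler_pM => //; [rewrite mulr_ge0|rewrite ler_wpM2l].
    move/le_trans; apply.
    have -> : B * nu c * (x c * b) = B * (b * e c) by rewrite /e -/(x c); ring.
    by rewrite ler_wpM2l//; lra.
  have xY : x c <= Y c by rewrite ge_max Y0; lra.
  have xY' : x' d <= Y' d by rewrite ge_max Y'0; lra.
  have : S * (x c * x' d) <= S * (Y c * Y' d) by rewrite ler_wpM2l// ler_pM.
  move/le_trans; apply; apply: (le_trans (SY c d)).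
  by rewrite ler_wpM2l// /g /g' /big_value Yc Yd; lra.
have : Num.sqrt mJ * `|Y false - Y true| * (Num.sqrt mK * `|Y' false - Y' true|) <=
   S * ((`|T| + (x false + x true)) * (`|T'| + (x' false + x' true))).
  have -> : Num.sqrt mJ * `|Y false - Y true| * (Num.sqrt mK * `|Y' false - Y' true|) =
    S * (`|Y false - Y true| * `|Y' false - Y' true|) by rewrite SE; ring.
  by rewrite ler_wpM2l// ler_pM.
move/le_trans; apply.
have X1 : 0 <= b * (a^-1 * (mJ * T ^+ 2)).
  by apply: mulr_ge0 => //; apply: mulr_ge0; rewrite ?invr_ge0//; apply: mulr_ge0; rewrite ?sqr_ge0.
have X2 : 0 <= a * (b^-1 * (mK * T' ^+ 2)).
  by apply: mulr_ge0 => //; apply: mulr_ge0; rewrite ?invr_ge0//; apply: mulr_ge0; rewrite ?sqr_ge0.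
move: t1 X1 X2.
set X1 := b * (a^-1 * (mJ * T ^+ 2)); set X2 := a * (b^-1 * (mK * T' ^+ 2)) => t1 X10 X20.
have BX : X1 + X2 <= 3 * B * X1 + 3 * B * X2.
  by apply: lerD; rewrite ler_peMl//; lra.
have := t2 false; have := t2 true; have := t3 false; have := t3 true.
have := t4 false false; have := t4 false true; have := t4 true false; have := t4 true true.
have BE c : 0 <= B * g c by rewrite mulr_ge0//; lra.
have BE' c : 0 <= B * g' c by rewrite mulr_ge0//; lra.
have := BE false; have := BE true; have := BE' false; have := BE' true.
rewrite [b * (_ + _)]mulrDr [a * (_ + (e' _ + _))]mulrDr -/X1 -/X2.
lra.
Qed.

End product_bound.

(** * The bilinear form of a shift on one tree *)

Section tree_shift.
Context {R : realType}.

Lemma powR_subadditive (x y r : R) : 0 < x -> 0 < y -> r <= 1 ->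
  (x + y) `^ r <= x `^ r + y `^ r.
Proof.
move=> x0 y0 r1; have xy : 0 < x + y by lra.
have H z : 0 < z -> z <= x + y -> z / (x + y) * (x + y) `^ r <= z `^ r.
  move=> z0 zxy.
  have -> : z `^ r = (z / (x + y)) `^ r * (x + y) `^ r.
    by rewrite -powRM ?divfK ?gt_eqF// ltW// divr_gt0.
  rewrite ler_wpM2r ?powR_ge0// ger1_powR// divr_gt0//=.
  by rewrite ler_pdivrMr// mul1r.
apply: le_trans (lerD (H x x0 _) (H y y0 _)); [|lra|lra].
by rewrite -mulrDl -mulrDl divff ?mul1r// gt_eqF.
Qed.

(** What the tree below one root inherits from the hypotheses: [tw_lower] is Hoelder's inequality,
    [tw_upper] the diagonal condition, [tw_bal] and [tw_bal'] balance, and the last two fields the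
    off-diagonal conditions, rewritten with [m] of the top interval. *)
Record tree_weights (p q K kappa : R) (mu w sg : seq bool -> R) : Prop := {
  tw_mu_gt0 : forall I, 0 < mu I;
  tw_muD : tree_additive mu;
  tw_w_gt0 : forall I, 0 < w I;
  tw_wD : tree_additive w;
  tw_sg_gt0 : forall I, 0 < sg I;
  tw_sgD : tree_additive sg;
  tw_lower : forall I, mu I <= w I `^ p^-1 * sg I `^ q^-1;
  tw_upper : forall I, w I `^ p^-1 * sg I `^ q^-1 <= K * mu I;
  tw_bal : forall c I, mass_min mu I <= kappa * mass_min mu (c :: I);
  tw_bal' : forall c I, mass_min mu (c :: I) <= kappa * mass_min mu I;
  tw_cross : forall c d I,
    mass_min mu I * (w (c :: I) `^ p^-1 * sg (d :: ~~ c :: I) `^ q^-1) <=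
    K * (mu (c :: I) * mu (d :: ~~ c :: I));
  tw_cross' : forall c d I,
    mass_min mu I * (w (d :: ~~ c :: I) `^ p^-1 * sg (c :: I) `^ q^-1) <=
    K * (mu (c :: I) * mu (d :: ~~ c :: I)) }.

Definition haar_size (mu F : seq bool -> R) I :=
  Num.sqrt (mass_min mu I) *
  `|F (false :: I) / mu (false :: I) - F (true :: I) / mu (true :: I)|.

Variables (p q K kappa : R).
Hypotheses (p1 : 1 < p) (pq : p^-1 + q^-1 = 1) (K0 : 0 < K) (kappa1 : 1 <= kappa).
Variables (s t : nat).

(** One factor [kappa ^+ (s + t)] replaces [sqrt (m J) * sqrt (m L)] by [m I], another one returns
    from [m I] to [m J] or [m L]; the chain constant serves the two-weight bound. *)
Let B := kappa ^+ (2 * (s + t)) * (1 + chain_cst K kappa s t).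

Let one_trees (mu w sg F G : seq bool -> R) (M n0 : nat) :
  tree_weights p q K kappa mu w sg ->
  (forall I, 0 <= F I) -> tree_additive F ->
  (forall I, 0 <= G I) -> tree_additive G ->
  forall I,
  let y I := F I / mu I in let z I := G I / mu I in
  let a := runmax y in let b := runmax z in
  gsum s (haar_size mu F) I * gsum t (haar_size mu G) I <=
  2 ^+ t * (3 * B * (b I * ((a I)^-1 * gsum s (fun J => mass_min mu J * trunc_jump mu F (a I) J ^+ 2) I
         + gsum s.+1 (fun J => mu J * Num.max 0 (y J - a I)) I) +
    gsum s.+1 (fun J => big_value (a I) p (y J) * w J) I)) +
  2 ^+ s * (3 * B * (a I * ((b I)^-1 * gsum t (fun J => mass_min mu J * trunc_jump mu G (b I) J ^+ 2) I
         + gsum t.+1 (fun J => mu J * Num.max 0 (z J - b I)) I) +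
    gsum t.+1 (fun J => big_value (b I) q (z J) * sg J) I)).
Proof.
case=> mu0 muD w0 wD sg0 sgD mulow muup bal bal' cross cross' F0 FD G0 GD I.
cbv zeta.
set y := fun I => F I / mu I; set z := fun I => G I / mu I.
set a := runmax y I; set b := runmax z I.
have hp := p1; have hq := conj_gt1 p1 pq.
pose al J := 3 * B * (b * (a^-1 * (mass_min mu J * trunc_jump mu F a J ^+ 2) +
   (mu (false :: J) * Num.max 0 (y (false :: J) - a) + mu (true :: J) * Num.max 0 (y (true :: J) - a)))
  + (big_value a p (y (false :: J)) * w (false :: J) + big_value a p (y (true :: J)) * w (true :: J))).
pose be J := 3 * B * (a * (b^-1 * (mass_min mu J * trunc_jump mu G b J ^+ 2) +
   (mu (false :: J) * Num.max 0 (z (false :: J) - b) + mu (true :: J) * Num.max 0 (z (true :: J) - b)))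
  + (big_value b q (z (false :: J)) * sg (false :: J) + big_value b q (z (true :: J)) * sg (true :: J))).
have y0 J : 0 <= y J by rewrite divr_ge0// ltW.
have z0 J : 0 <= z J by rewrite divr_ge0// ltW.
have m0 J : 0 < mass_min mu J by exact: mass_min_gt0.
have kap0 : 0 < kappa by have := kappa1; lra.
have E0 : 0 <= chain_cst K kappa s t.
  have K0' := K0.
  rewrite /chain_cst !mulr_ge0 ?exprn_ge0 ?mulr_ge0 ?(ltW kap0) ?(ltW K0')//.
have key J L : size J = s -> size L = t ->
    haar_size mu F (J ++ I) * haar_size mu G (L ++ I) <= al (J ++ I) + be (L ++ I).
  move=> sJ sL.
  have balJ H : mass_min mu (H ++ I) <= kappa ^+ size H * mass_min mu I.
    elim: H => [|c H IH]; first by rewrite mul1r.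
    by rewrite /= exprS -mulrA (le_trans (bal' _ _))// ler_pM2l.
  have balJ' H : mass_min mu I <= kappa ^+ size H * mass_min mu (H ++ I).
    elim: H => [|c H IH]; first by rewrite mul1r.
    by rewrite /= exprSr -mulrA (le_trans IH)// ler_wpM2l ?exprn_ge0// ltW.
  pose S := Num.sqrt (mass_min mu (J ++ I)) * Num.sqrt (mass_min mu (L ++ I)).
  have SI : S <= kappa ^+ (s + t) * mass_min mu I.
    rewrite /S -sqrtrM ?(ltW (m0 _))// -(ler_pXn2r (n := 2)) ?nnegrE ?sqrtr_ge0//; last first.
      by apply: mulr_ge0 (ltW (m0 _)); rewrite exprn_ge0// ltW.
    rewrite sqr_sqrtr; last exact: mulr_ge0 (ltW (m0 _)) (ltW (m0 _)).
    have := ler_pM (ltW (m0 _)) (ltW (m0 _)) (balJ J) (balJ L); rewrite sJ sL.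
    move/le_trans; apply.
    have -> : kappa ^+ s * mass_min mu I * (kappa ^+ t * mass_min mu I) =
       kappa ^+ (s + t) * mass_min mu I ^+ 2 by rewrite exprD; ring.
    rewrite [leRHS]exprMn ler_wpM2r ?sqr_ge0// expr2 ler_peMr ?exprn_ege1//.
    by rewrite exprn_ge0// ltW.
  have kB n : (n <= s + t)%N -> kappa ^+ (s + t) * kappa ^+ n <= B.
    move=> nst; rewrite /B -exprD; apply: (@le_trans _ _ (kappa ^+ (2 * (s + t)))).
      by rewrite ler_weXn2l//; lia.
    by rewrite ler_peMr ?exprn_ge0 ?(ltW kap0)// lerDl.
  have Smu H n c : size H = n -> (n <= s + t)%N -> S <= B * mu (c :: H ++ I).
    move=> sH nst; apply: (le_trans SI).
    apply: (@le_trans _ _ (kappa ^+ (s + t) * (kappa ^+ n * mass_min mu (H ++ I)))).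
      by rewrite ler_wpM2l ?exprn_ge0 ?(ltW kap0)// -sH.
    rewrite mulrA; apply: ler_pM; [|exact: ltW|exact: kB|exact: mass_min_le].
    by rewrite mulr_ge0 ?exprn_ge0 ?(ltW kap0).
  rewrite /al /be /haar_size.
  have := @product_bound R a b B S (mass_min mu (J ++ I)) (mass_min mu (L ++ I)) p q
    (fun c => y (c :: J ++ I)) (fun c => z (c :: L ++ I))
    (fun c => mu (c :: J ++ I)) (fun c => mu (c :: L ++ I))
    (fun c => w (c :: J ++ I)) (fun c => sg (c :: L ++ I)).
  apply => //; try by move=> *; apply: ltW.
  - exact: runmax_ge0.
  - exact: runmax_ge0.
  - by rewrite /B mulr_ege1 ?exprn_ege1// lerDl.
  - by move=> c; apply: Smu sJ _; lia.
  - by move=> c; apply: Smu sL _; lia.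
  move=> c d.
  have SC : S <= B * (w (c :: J ++ I) `^ p^-1 * sg (d :: L ++ I) `^ q^-1).
    apply: (le_trans SI).
    have := @mass_min_le_cross R mu (fun I => w I `^ p^-1) (fun I => sg I `^ q^-1) K kappa mu0 muD.
    move=> /(_ (fun I => powR_gt0 _ (w0 I)) (fun I => powR_gt0 _ (sg0 I))).
    have sub (v : seq bool -> R) e : (forall I, 0 < v I) -> tree_additive v -> 1 < e -> forall I,
        v I `^ e^-1 <= v (false :: I) `^ e^-1 + v (true :: I) `^ e^-1.
      move=> v0 vD e1 I'; rewrite {1}vD powR_subadditive// invf_le1; lra.
    move=> /(_ (sub _ _ w0 wD hp) (sub _ _ sg0 sgD hq) K0 kappa1 mulow muup bal cross cross' c d J L I).
    rewrite sJ sL /= => H.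
    apply: (le_trans (ler_wpM2l _ H)); first by rewrite exprn_ge0// ltW.
    rewrite [leLHS]mulrA; apply: ler_wpM2r; first by rewrite mulr_ge0 ?powR_ge0.
    rewrite /B.
    apply: ler_pM; rewrite ?exprn_ge0 ?(ltW kap0)//; last by lra.
    by rewrite ler_weXn2l//; lia.
  have := young p1 pq (x := y (c :: J ++ I) * w (c :: J ++ I) `^ p^-1)
     (y := z (d :: L ++ I) * sg (d :: L ++ I) `^ q^-1).
  move=> /(_ (mulr_ge0 (y0 _) (powR_ge0 _ _)) (mulr_ge0 (z0 _) (powR_ge0 _ _))).
  rewrite (powRM _ (y0 _) (powR_ge0 _ _)) (powRM _ (z0 _) (powR_ge0 _ _)) -!powRrM !mulVf ?powRr1 ?(ltW (w0 _)) ?(ltW (sg0 _))//; [|lra|lra].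
  move=> H.
  have B0 : 0 <= B by rewrite mulr_ge0 ?exprn_ge0 ?(ltW kap0)// addr_ge0.
  apply: le_trans (ler_wpM2l B0 H).
  apply: le_trans (ler_wpM2r (mulr_ge0 (y0 _) (z0 _)) SC) _.
  by rewrite le_eqVlt; apply/orP; left; apply/eqP; ring.
apply: (le_trans (gsum_pair_le key)).
by rewrite /al /be !(gsumZ, gsumD, gsumSr).
Qed.

(** The constant precedes the trees and the depth, as it must serve every root and every truncation.
    Young's inequality and [tw_lower] bound the mixed sum of [mu a b] by the two weighted maximal
    sums. *)
Lemma tree_shift_bound : exists2 C : R, 0 <= C & forall mu w sg F G : seq bool -> R,
  tree_weights p q K kappa mu w sg ->
  (forall I, 0 <= F I) -> tree_additive F ->
  (forall I, 0 <= G I) -> tree_additive G ->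
  forall n0 M, (n0 + s + t < M)%N ->
  \sum_(n < n0) gsum n (fun I => gsum s (haar_size mu F) I * gsum t (haar_size mu G) I) [::]
  <= C * (gsum M (fun I => (F I / sg I) `^ p * sg I) [::] +
          gsum M (fun I => (G I / w I) `^ q * w I) [::]).
Proof.
have hp := p1; have hq := conj_gt1 p1 pq.
have qp : q^-1 + p^-1 = 1 by rewrite addrC.
have kap0 : 0 < kappa by have := kappa1; lra.
pose Cf := (K `^ p) `^ q * (2 * p) `^ q * (2 * q) `^ p.
pose Cg := (K `^ q) `^ p * (2 * q) `^ p * (2 * p) `^ q.
have E0 : 0 <= chain_cst K kappa s t.
  have K0' := K0.
  rewrite /chain_cst !mulr_ge0 ?exprn_ge0 ?mulr_ge0 ?(ltW kap0) ?(ltW K0')//.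
have B0 : 0 <= B by rewrite mulr_ge0 ?exprn_ge0 ?(ltW kap0)// addr_ge0.
pose A := 2 ^+ t * (3 * B) * (s.+1%:R * 6) + 2 ^+ s * (3 * B) * (t.+1%:R * 6).
have nn c : 0 <= 2 ^+ c * (3 * B) by apply: mulr_ge0; [rewrite exprn_ge0|apply: mulr_ge0].
have A0 : 0 <= A by apply: addr_ge0; apply: mulr_ge0 (nn _) _; rewrite mulr_ge0.
have Cf0 : 0 <= Cf by rewrite !mulr_ge0 ?powR_ge0.
have Cg0 : 0 <= Cg by rewrite !mulr_ge0 ?powR_ge0.
exists (A * (Cf + Cg)); first by apply: mulr_ge0 => //; exact: addr_ge0.
move=> mu w sg F G TW F0 FD G0 GD n0 M n0M.
have key := one_trees M n0 TW F0 FD G0 GD.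
have [mu0 muD w0 wD sg0 sgD mulow muup _ _ _ _] := TW.
move: key; cbv zeta; set y := fun I => F I / mu I; set z := fun I => G I / mu I.
set a := runmax y; set b := runmax z => key.
have y0 J : 0 <= y J by rewrite divr_ge0// ltW.
have z0 J : 0 <= z J by rewrite divr_ge0// ltW.
have a0 J : 0 <= a J by exact: runmax_ge0.
have b0 J : 0 <= b J by exact: runmax_ge0.
have Wf : gsum M (fun I => a I `^ p * w I) [::] <= Cf * gsum M (fun I => (F I / sg I) `^ p * sg I) [::].
  exact: (@weighted_maximal _ p q p1 pq mu w sg K).
have Wg : gsum M (fun I => b I `^ q * sg I) [::] <= Cg * gsum M (fun I => (G I / w I) `^ q * w I) [::].
  by apply: (@weighted_maximal _ q p hq qp mu sg w K) => // I; rewrite mulrC.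
have P1 : gsum M (fun I => mu I * (a I * b I)) [::] <=
    gsum M (fun I => a I `^ p * w I) [::] + gsum M (fun I => b I `^ q * sg I) [::].
  rewrite -gsumD; apply: ler_gsum => J _; move: (J ++ [::]) => I.
  apply: (@le_trans _ _ ((a I * w I `^ p^-1) * (b I * sg I `^ q^-1))).
    have -> : a I * w I `^ p^-1 * (b I * sg I `^ q^-1) = (w I `^ p^-1 * sg I `^ q^-1) * (a I * b I) by ring.
    by rewrite ler_wpM2r// mulr_ge0.
  have := young p1 pq (x := a I * w I `^ p^-1) (y := b I * sg I `^ q^-1).
  move=> /(_ (mulr_ge0 (a0 _) (powR_ge0 _ _)) (mulr_ge0 (b0 _) (powR_ge0 _ _))).
  by rewrite (powRM _ (a0 _) (powR_ge0 _ _)) (powRM _ (b0 _) (powR_ge0 _ _)) -!powRrM !mulVf ?powRr1 ?(ltW (w0 _)) ?(ltW (sg0 _))//; lra.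
have amono I J : a I <= a (J ++ I) by exact: runmax_mono.
have bmono I J : b I <= b (J ++ I) by exact: runmax_mono.
have Ef := energy_tree mu0 muD F0 FD b0 bmono (s := s) (n0 := n0) (M := M).
have Eg := energy_tree mu0 muD G0 GD a0 amono (s := t) (n0 := n0) (M := M).
have Df := doubling_tree p1 w0 wD y0 (s := s) (n0 := n0) (M := M).
have Dg := doubling_tree hq sg0 sgD z0 (s := t) (n0 := n0) (M := M).
have sM : (n0 + s < M)%N by apply: leq_ltn_trans n0M; rewrite leq_addr.
have tM : (n0 + t < M)%N by apply: leq_ltn_trans n0M; rewrite leq_add2r leq_addr.
move: (Ef sM) (Eg tM) (Df sM) (Dg tM) => {Ef Eg Df Dg}; rewrite -/a -/b -/y -/z.
have -> : gsum M (fun I => mu I * (b I * a I)) [::] = gsum M (fun I => mu I * (a I * b I)) [::].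
  by apply: eq_gsum => J _; rewrite [b _ * _]mulrC.
set sEf := \sum_(n < n0) _; set sEg := \sum_(n < n0) _.
set sDf := \sum_(n < n0) _; set sDg := \sum_(n < n0) _ => Ef Eg Df Dg.
have total : \sum_(n < n0) gsum n (fun I => gsum s (haar_size mu F) I * gsum t (haar_size mu G) I) [::]
  <= 2 ^+ t * (3 * B) * (sEf + sDf) + 2 ^+ s * (3 * B) * (sEg + sDg).
  rewrite /sEf /sEg /sDf /sDg -!big_split /= !mulr_sumr -big_split /=.
  apply: ler_sum => n _; rewrite -!gsumD -!gsumZ -gsumD.
  apply: ler_gsum => J _; move: (J ++ [::]) => I; apply: (le_trans (key I)).
  rewrite [2 ^+ t * (3 * B * _)]mulrA [2 ^+ s * (3 * B * _)]mulrA.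
  apply: lerD; apply: ler_wpM2l => //; rewrite lerD2r ler_wpM2l// lerD2l.
    rewrite -[leLHS]mul1r ler_wpM2r ?ler1n//; apply: gsum_ge0 => H.
    by rewrite mulr_ge0 ?(ltW (mu0 _))// le_max lexx.
  rewrite -[leLHS]mul1r ler_wpM2r ?ler1n//; apply: gsum_ge0 => H.
  by rewrite mulr_ge0 ?(ltW (mu0 _))// le_max lexx.
apply: (le_trans total).
set Xf := gsum M (fun I => a I `^ p * w I) [::] in Wf P1 Df *.
set Xg := gsum M (fun I => b I `^ q * sg I) [::] in Wg P1 Dg *.
set P := gsum M (fun I => mu I * (a I * b I)) [::] in P1 Ef Eg *.
have Xf0 : 0 <= Xf by apply: gsum_ge0 => J; rewrite mulr_ge0 ?powR_ge0// ltW.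
have Xg0 : 0 <= Xg by apply: gsum_ge0 => J; rewrite mulr_ge0 ?powR_ge0// ltW.
(* The 6 is 4 from the energy and 2 from the doubling sum. *)
have E1 : sEf + sDf <= s.+1%:R * 6 * (Xf + Xg).
  apply: (le_trans (lerD Ef Df)).
  have -> : s.+1%:R * (4 * P) + 2 * s.+1%:R * Xf = s.+1%:R * (4 * P + 2 * Xf) by ring.
  by rewrite -mulrA ler_wpM2l//; lra.
have E2 : sEg + sDg <= t.+1%:R * 6 * (Xf + Xg).
  apply: (le_trans (lerD Eg Dg)).
  have -> : t.+1%:R * (4 * P) + 2 * t.+1%:R * Xg = t.+1%:R * (4 * P + 2 * Xg) by ring.
  by rewrite -mulrA ler_wpM2l//; lra.
apply: (le_trans (lerD (ler_wpM2l (nn t) E1) (ler_wpM2l (nn s) E2))).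
have -> : 2 ^+ t * (3 * B) * (s.+1%:R * 6 * (Xf + Xg)) +
    2 ^+ s * (3 * B) * (t.+1%:R * 6 * (Xf + Xg)) = A * (Xf + Xg) by rewrite /A; ring.
rewrite -mulrA ler_wpM2l//.
set Yf := gsum M _ _ in Wf *; set Yg := gsum M _ _ in Wg *.
have Yf0 : 0 <= Yf by apply: gsum_ge0 => J; rewrite mulr_ge0 ?powR_ge0// ltW.
have Yg0 : 0 <= Yg by apply: gsum_ge0 => J; rewrite mulr_ge0 ?powR_ge0// ltW.
have := mulr_ge0 Cf0 Yg0; have := mulr_ge0 Cg0 Yf0; lra.
Qed.

End tree_shift.

(** * Dyadic intervals and their measures *)

Section dyadic_tree.

Definition child (c : bool) (I : dyadic) : dyadic := if c then rchild I else lchild I.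

Definition node (I : dyadic) (J : seq bool) : dyadic := foldr child I J.

Lemma parent_child c I : parent (child c I) = I.
Proof.
case: I => k j; rewrite /parent; case: c => /=; congr pair; rewrite ?addrK//.
  by rewrite divzMDl// divz_small// addr0.
by rewrite mulzK.
Qed.

Lemma child_inj c d I : child c I = child d I -> c = d.
Proof. by case: c; case: d => //= -[] => /eqP; rewrite -subr_eq0; lia. Qed.

(** The generations differ; this selects the off-diagonal branch of [cpb] for the cross pairs. *)
Lemma child_neq_grandchild c d e I : (child c I == child d (child e I)) = false.
Proof. by apply/eqP; case: I => k j; case: c; case: d; case: e => -[]; lia. Qed.

Lemma child_parent J : exists c, J = child c (parent J).
Proof.
case: J => k j; exists ((j %% 2)%Z == 1).
have := divz_eq j 2; have := modz_ge0 j (isT : (2 : int) != 0).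
have := ltz_mod j (isT : (2 : int) != 0).
rewrite /child /parent; case: eqP => /= h0 h1 h2 h3.
  by rewrite /rchild/= subrK {1}h3 h0.
have h4 : (j %% 2)%Z = 0 by lia.
by rewrite /lchild /= subrK {1}h3 h4 addr0.
Qed.

Lemma sibling_child c I : sibling (child c I) = child (~~ c) I.
Proof.
rewrite /sibling parent_child; case: c => /=; last by rewrite eqxx.
case: eqP => // h; by have := @child_inj true false I h.
Qed.

Lemma node_cat I J K : node I (J ++ K) = node (node I K) J.
Proof. exact: foldr_cat. Qed.

Fixpoint dlist n I : seq dyadic :=
  if n is n'.+1 then dlist n' (lchild I) ++ dlist n' (rchild I) else [:: I].

Lemma mem_dlist n I J : (J \in dlist n I) = (ancestor n J == I).
Proof.
elim: n I => [|n IH] I; first by rewrite /= inE.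
rewrite /= mem_cat !IH.
apply/idP/eqP => [/orP[]/eqP -> |<-].
- exact: (parent_child false).
- exact: (parent_child true).
have [[] {1 3}->] := child_parent (ancestor n J); by rewrite eqxx ?orbT.
Qed.

Lemma uniq_dlist n I : uniq (dlist n I).
Proof.
elim: n I => //= n IH I; rewrite cat_uniq !IH andbT /=.
apply/hasPn => J; rewrite !mem_dlist => /eqP ->.
by apply/negP => /eqP /(@child_inj true false).
Qed.

Lemma descendantsE n I : descendants n I = [set` dlist n I].
Proof. by apply/seteqP; split => J /=; rewrite mem_dlist => /eqP. Qed.

Section sums.
Context {R : realType}.
Implicit Type phi : dyadic -> R.

Lemma sum_dlist n phi I : \sum_(J <- dlist n I) phi J = gsum n (phi \o node I) [::].
Proof.
have H L : \sum_(J <- dlist n (node I L)) phi J = gsum n (phi \o node I) L.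
  elim: n L => [|n IH] L; first by rewrite /= big_seq1.
  by rewrite /= big_cat /= (IH (false :: L)) (IH (true :: L)).
exact: (H [::]).
Qed.

Lemma fsum_descendants n phi I :
  \sum_(J \in descendants n I) phi J = \sum_(J <- dlist n I) phi J.
Proof. by rewrite descendantsE -fsbig_seq ?uniq_dlist. Qed.

Lemma gsum_shift n phi I L :
  gsum n (phi \o node (node I L)) [::] = gsum n (phi \o node I) L.
Proof.
have H K : gsum n (phi \o node (node I L)) K = gsum n (phi \o node I) (K ++ L).
  by elim: n K => [|n IH] K /=; rewrite ?node_cat// !IH.
exact: (H [::]).
Qed.

Lemma ler_sum_subset (A L : seq dyadic) phi : (forall J, 0 <= phi J) -> uniq A ->
  {subset A <= L} -> \sum_(J <- A) phi J <= \sum_(J <- L) phi J.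
Proof.
move=> p0 uA AL; rewrite [leRHS](bigID (mem A)) /=.
apply: (@le_trans _ _ (\sum_(J <- L | J \in A) phi J)); last first.
  by rewrite lerDl sumr_ge0.
elim: A uA AL => [_ _|a A IH /= /andP[aA uA] AL]; first by rewrite big_nil sumr_ge0.
rewrite big_cons [leRHS](bigID (pred1 a)) /=; apply: lerD.
  have aL : a \in L by apply: AL; rewrite inE eqxx.
  rewrite (eq_bigl (pred1 a)); last first.
    by move=> J /=; rewrite inE; case: eqP => [->|] //; rewrite ?eqxx ?andbF.
  by rewrite (big_rem a)//= eqxx lerDl sumr_ge0.
apply: (@le_trans _ _ (\sum_(J <- L | J \in A) phi J)).
  by apply: IH => // J JA; apply: AL; rewrite inE JA orbT.
rewrite [leRHS](eq_bigl (fun J => J \in A))// => J /=.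
rewrite inE; case: (eqVneq J a) => [->|_]; by rewrite ?andbT ?eqxx ?(negbTE aA).
Qed.

End sums.

(** The intervals $[0,2^n)$ and $[-2^n,0)$; [b] marks the negative half-line. *)
Definition root (b : bool) (n : nat) : dyadic := (- n%:Z, if b then -1 else 0).

Lemma ancestor_iter n (I : dyadic) : ancestor n I = (I.1 - n%:Z, (I.2 %/ (2 ^ n)%:Z)%Z).
Proof.
elim: n => [|n IH]; first by case: I => k j; rewrite /= subr0 divz1.
rewrite /ancestor iterS -/(ancestor n I) IH /parent /=; congr pair.
  by rewrite -addrA -opprD; congr (_ - _); lia.
by rewrite -divzMA_ge0// expnSr PoszM.
Qed.

(** With [k] the number of steps, the index is divided by $2^k$ and rounded down. The bound on [n]
    gives $|I.2| \le k < 2^k$, so the result is 0 or -1. *)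
Lemma ancestor_root (I : dyadic) n : (absz I.1 + absz I.2 <= n)%N ->
  ancestor (absz (I.1 + n%:Z)) I = root (I.2 < 0) n.
Proof.
move=> In; rewrite ancestor_iter /root.
have e : (absz (I.1 + n%:Z))%:Z = I.1 + n%:Z by lia.
congr pair; first by rewrite e; lia.
set k := absz (I.1 + n%:Z).
have kI : (absz I.2 <= k)%N by rewrite /k; lia.
have k2 : (k < 2 ^ k)%N by exact: ltn_expl.
case: (ltP I.2 0) => h.
  have -> : I.2 = -1 * (2 ^ k)%:Z + (I.2 + (2 ^ k)%:Z) by lia.
  rewrite divzMDl; last by lia.
  by rewrite divz_small ?addr0//; apply/andP; split; lia.
by rewrite divz_small//; apply/andP; split; lia.
Qed.

(** The two half-lines have no common dyadic ancestor, so a finite family needs two trees. Scales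
    between [-n] and [n] account for the [2 n + 1] generations. *)
Lemma sum_fset_le {R : realType} (A : seq dyadic) : uniq A -> exists n n0,
  forall phi : dyadic -> R, (forall J, 0 <= phi J) ->
  \sum_(J <- A) phi J <=
   \sum_(k < n0) gsum k (phi \o node (root false n)) [::] +
   \sum_(k < n0) gsum k (phi \o node (root true n)) [::].
Proof.
move=> uA.
pose n := \max_(I <- A) (absz I.1 + absz I.2)%N; pose n0 := (n + n).+1.
exists n, n0 => phi p0.
pose L b := flatten [seq dlist k (root b n) | k <- iota 0 n0].
have E b : \sum_(k < n0) gsum k (phi \o node (root b n)) [::] = \sum_(J <- L b) phi J.
  under eq_bigr do rewrite -sum_dlist.
  by rewrite big_flatten big_map -(big_mkord xpredT (fun k => \sum_(J <- dlist k (root b n)) phi J)) /index_iota subn0.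
rewrite !E -big_cat; apply: ler_sum_subset => // I IA.
rewrite mem_cat; have In : (absz I.1 + absz I.2 <= n)%N.
  by rewrite /n (big_rem I)//= leq_maxl.
have H : I \in L (I.2 < 0).
  apply/flattenP; exists (dlist (absz (I.1 + n%:Z)) (root (I.2 < 0) n)).
    by apply/mapP; exists (absz (I.1 + n%:Z)) => //; rewrite mem_iota /n0; lia.
  by rewrite mem_dlist ancestor_root.
by case: (I.2 < 0) H => ->; rewrite ?orbT.
Qed.

End dyadic_tree.

(** * Masses of dyadic intervals and Haar coefficients *)

Section dyadic_measure.
Context {R : realType} (mu : {measure set (measurableTypeR R) -> \bar R}).
Hypothesis mu_pos : dyadic_pos_finite mu.
Local Notation T := (measurableTypeR R).
Implicit Types (f g w sg : T -> R) (I : dyadic).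

Lemma measurable_dset I : measurable (dset R I : set T).
Proof. exact: measurable_itv. Qed.
Local Hint Resolve measurable_dset : core.

Lemma dsetP I x : dset R I x <->
  I.2%:~R <= x * 2 ^ I.1 /\ x * 2 ^ I.1 < (I.2 + 1)%:~R.
Proof.
have P : 0 < (2 : R) ^ I.1 by rewrite exprz_gt0.
rewrite /dset /= in_itv /= -invr_expz; split => [/andP[h1 h2]|[h1 h2]].
  by rewrite -ler_pdivrMr// -ltr_pdivlMr.
by rewrite ler_pdivrMr// ltr_pdivlMr// h1.
Qed.

Lemma dset_children I : dset R I = dset R (lchild I) `|` dset R (rchild I).
Proof.
apply/seteqP; split => x; rewrite /setU /= !dsetP /=.
  move=> [h1 h2].
  rewrite exprzDr ?pnatr_eq0 ?unitfE// expr1z mulrA !intrD !intrM.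
  set t := x * 2 ^ I.1 in h1 h2 *.
  move: h2; rewrite intrD => h2.
  have [h|h] := ltP (t * 2) (I.2%:~R * 2 + 1); [left|right]; lra.
rewrite exprzDr ?pnatr_eq0 ?unitfE// expr1z mulrA !intrD !intrM.
by case=> -[]; lra.
Qed.

Lemma dset_disjoint I : [disjoint dset R (lchild I) & dset R (rchild I)].
Proof.
apply/disj_setPS => x [] /dsetP /= [_ h1] /dsetP /= [h2 _].
by move: h1 h2; set t := x * _; lra.
Qed.

Lemma dset_child c I : dset R (child c I) `<=` dset R I.
Proof. by rewrite (dset_children I) => x; case: c => ?; [right|left]. Qed.

Lemma dset_node I J : dset R (node I J) `<=` dset R I.
Proof. by elim: J => [//|c J IH] x /dset_child /IH. Qed.

Lemma dmu_gt0 I : 0 < dmu mu I.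
Proof. by apply: fine_gt0; exact: mu_pos. Qed.

Lemma dmuE I : (dmu mu I)%:E = mu (dset R I).
Proof.
by rewrite /dmu fineK// ge0_fin_numE//; have /andP[] := mu_pos I.
Qed.

Definition locint f := forall I, mu.-integrable (dset R I) (EFin \o f).

Definition mass f I : R := \int[mu]_(x in dset R I) f x.

Lemma mass_additive f I : locint f -> mass f I = mass f (lchild I) + mass f (rchild I).
Proof.
move=> Lf; rewrite /mass {1}dset_children Rintegral_setU//.
  by rewrite -dset_children.
exact: dset_disjoint.
Qed.

Lemma mass_tree f I : locint f -> tree_additive (mass f \o node I).
Proof. by move=> Lf J; exact: mass_additive. Qed.

Lemma dmu_mass : dmu mu = mass (cst 1).
Proof.
apply/funext => I; rewrite /mass /dmu Rintegral_cst// ?mul1r//.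
Qed.

Lemma locint_cst c : locint (cst c).
Proof.
move=> I; apply/integrableP; split; first by apply/measurable_EFinP; exact: measurable_cst.
have /andP[_ h] := mu_pos I.
by rewrite (integral_cst mu (measurable_dset I) `|c|%:E) lte_mul_pinfty// lee_fin.
Qed.

Lemma dmu_tree I : tree_additive (dmu mu \o node I).
Proof. by rewrite dmu_mass; apply: mass_tree; exact: locint_cst. Qed.

Lemma dmu_children I : dmu mu I = dmu mu (lchild I) + dmu mu (rchild I).
Proof. by rewrite dmu_mass; apply: mass_additive; exact: locint_cst. Qed.

Lemma massE f I : locint f -> (mass f I)%:E = (\int[mu]_(x in dset R I) (f x)%:E)%E.
Proof. by move=> Lf; rewrite /mass /Rintegral fineK//; apply: integrable_fin_num. Qed.

Lemma mass_ge0 f I : (forall x, 0 <= f x) -> 0 <= mass f I.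
Proof. by move=> f0; apply: Rintegral_ge0. Qed.

Lemma haarE I x : haar mu I x =
  Num.sqrt (mI mu I) / dmu mu (lchild I) * \1_(dset R (lchild I)) x -
  Num.sqrt (mI mu I) / dmu mu (rchild I) * \1_(dset R (rchild I)) x.
Proof. by rewrite /haar; ring. Qed.

Lemma integrable_indic_mul f I c : locint f ->
  mu.-integrable setT (EFin \o (fun x => c * (f x * \1_(dset R I) x))).
Proof.
move=> Lf.
have := Lf I; rewrite integrable_mkcond// => H.
apply: eq_integrable (integrableZl measurableT c H) => // x _.
by rewrite /= /patch indicE; case: ifP => _; rewrite /= ?mulr1 ?mulr0 ?mule0 ?EFinM.
Qed.

Lemma Rintegral_indic_mul f I c : locint f ->
  \int[mu]_x (c * (f x * \1_(dset R I) x)) = c * mass f I.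
Proof.
move=> Lf.
have := Lf I; rewrite integrable_mkcond// => H.
have H' : mu.-integrable setT (EFin \o (f \_ (dset R I))).
  by apply: eq_integrable H => // x _; rewrite /= /patch; case: ifP.
rewrite /mass [in RHS]Rintegral_mkcond -RintegralZl//.
apply: eq_Rintegral => x _; rewrite /patch indicE.
by case: ifP => _; rewrite ?mulr1 ?mulr0.
Qed.

Lemma mul_haarE f I x : f x * haar mu I x =
  Num.sqrt (mI mu I) / dmu mu (lchild I) * (f x * \1_(dset R (lchild I)) x) -
  Num.sqrt (mI mu I) / dmu mu (rchild I) * (f x * \1_(dset R (rchild I)) x).
Proof. by rewrite haarE; ring. Qed.

Lemma integrable_mul_haar f I : locint f ->
  mu.-integrable setT (EFin \o (fun x => f x * haar mu I x)).
Proof.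
move=> Lf.
have := integrableB measurableT (integrable_indic_mul (lchild I) (Num.sqrt (mI mu I) / dmu mu (lchild I)) Lf)
  (integrable_indic_mul (rchild I) (Num.sqrt (mI mu I) / dmu mu (rchild I)) Lf).
by move=> H; apply: eq_integrable H => // x _; rewrite /= mul_haarE.
Qed.

Lemma pairing_haar f I : locint f -> pairing mu f (haar mu I) =
  Num.sqrt (mI mu I) * (mass f (lchild I) / dmu mu (lchild I) -
                        mass f (rchild I) / dmu mu (rchild I)).
Proof.
move=> Lf; rewrite /pairing.
under eq_Rintegral do rewrite mul_haarE.
rewrite RintegralB//; try exact: integrable_indic_mul.
by rewrite !Rintegral_indic_mul//; ring.
Qed.

End dyadic_measure.

#[global] Hint Extern 0 (measurable (dset _ _)) => exact: measurable_dset : core.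

(** * Hoelder's inequality between a weight and its dual weight *)

Section hoelder_dyadic.
Context {R : realType} (mu : {measure set (measurableTypeR R) -> \bar R}).
Hypothesis mu_pos : dyadic_pos_finite mu.
Local Notation T := (measurableTypeR R).
Variables (p q : R) (w sg : T -> R).
Hypotheses (p1 : 1 < p) (pq : p^-1 + q^-1 = 1).
Hypotheses (mw : measurable_fun setT w) (msg : measurable_fun setT sg).
Hypotheses (w0 : forall x, 0 < w x) (sg0 : forall x, 0 < sg x).
Hypothesis wsg : forall x, w x `^ p^-1 * sg x `^ q^-1 = 1.
Implicit Types (f g : T -> R) (I : dyadic).

Lemma measurable_powR_comp (r : R) f : measurable_fun setT f ->
  measurable_fun setT (fun x => f x `^ r).
Proof. by move=> mf; apply: (measurableT_comp (measurable_powR r) mf). Qed.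

Definition wpow (p : R) (w f : T -> R) : T -> R := fun x => `|f x| `^ p * w x.

Lemma measurable_wpow f : measurable_fun setT f -> measurable_fun setT (wpow p w f).
Proof.
move=> mf; apply: measurable_funM => //.
by apply: measurable_powR_comp; apply: measurableT_comp.
Qed.

Lemma wpow_ge0 f x : 0 <= wpow p w f x.
Proof. by rewrite mulr_ge0 ?powR_ge0// ltW. Qed.

(** Stated with extended reals, so that local integrability of [f] can be deduced from it. The
    factors are [|f| w^(1/p)] and [sg^(1/q)], restricted to [I]. *)
Lemma hoelder_dset f I : measurable_fun setT f ->
  (\int[mu]_(x in dset R I) `|f x|%:E <=
   (\int[mu]_(x in dset R I) (wpow p w f x)%:E) `^ p^-1 *
   (\int[mu]_(x in dset R I) (sg x)%:E) `^ q^-1)%E.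
Proof.
move=> mf; have hp := p1; have hq := conj_gt1 p1 pq.
have p0 : 0 < p by lra.
have q0 : 0 < q by lra.
have mI1 : measurable_fun setT (\1_(dset R I) : T -> R).
  exact: measurable_indic.
pose F x := `|f x| * w x `^ p^-1 * \1_(dset R I) x.
pose G x := sg x `^ q^-1 * \1_(dset R I) x.
have mF : measurable_fun setT F.
  apply: measurable_funM => //; apply: measurable_funM; first exact: measurableT_comp.
  exact: measurable_powR_comp.
have mG : measurable_fun setT G.
  by apply: measurable_funM => //; exact: measurable_powR_comp.
have := hoelder mu mF mG p0 q0 pq.
rewrite Lnorm1 unlock.
have -> : (\int[mu]_x `|(EFin \o (F \* G)%R) x| = \int[mu]_(x in dset R I) `|f x|%:E)%E.
  rewrite [in RHS]integral_mkcond; apply: eq_integral => x _.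
  rewrite /= /patch /F /G indicE; case: (x \in _) => /=; last by rewrite !mulr0 normr0.
  by rewrite !mulr1 -mulrA wsg mulr1 normr_id.
have -> : (\int[mu]_x `|(EFin \o F) x| `^ p = \int[mu]_(x in dset R I) (wpow p w f x)%:E)%E.
  rewrite [in RHS]integral_mkcond; apply: eq_integral => x _.
  rewrite /= /patch /F indicE; case: (x \in _) => /=; last first.
    by rewrite !mulr0 normr0 powR0// gt_eqF.
  rewrite mulr1 ger0_norm ?mulr_ge0 ?powR_ge0// powRM ?powR_ge0//.
  by rewrite -powRrM mulVf ?gt_eqF// powRr1// ltW.
have -> : (\int[mu]_x `|(EFin \o G) x| `^ q = \int[mu]_(x in dset R I) (sg x)%:E)%E.
  rewrite [in RHS]integral_mkcond; apply: eq_integral => x _.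
  rewrite /= /patch /G indicE; case: (x \in _) => /=; last first.
    by rewrite !mulr0 normr0 powR0// gt_eqF.
  rewrite mulr1 ger0_norm ?mulr_ge0 ?powR_ge0//.
  by rewrite -powRrM mulVf ?gt_eqF// powRr1// ltW.
by [].
Qed.

Hypotheses (Lw : locint mu w) (Lsg : locint mu sg).

Lemma integrable_wpow f : measurable_fun setT f ->
  (\int[mu]_x (wpow p w f x)%:E < +oo)%E -> mu.-integrable setT (EFin \o wpow p w f).
Proof.
move=> mf fin; apply/integrableP; split.
  by apply/measurable_EFinP; exact: measurable_wpow.
by under eq_integral => x _ do rewrite gee0_abs ?lee_fin ?wpow_ge0//.
Qed.

Lemma integrable_locint f : mu.-integrable setT (EFin \o f) -> locint mu f.
Proof. by move=> H I; apply: integrableS H. Qed.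

Lemma locint_wpow f : measurable_fun setT f ->
  (\int[mu]_x (wpow p w f x)%:E < +oo)%E -> locint mu f.
Proof.
move=> mf /(integrable_wpow mf)/integrable_locint Lf I.
apply/integrableP; split.
  by apply/measurable_EFinP; exact: measurable_funTS.
apply: (le_lt_trans (hoelder_dset I mf)).
by rewrite -!massE// !poweR_EFin ltry.
Qed.

Lemma mass_hoelder f I : measurable_fun setT f ->
  (\int[mu]_x (wpow p w f x)%:E < +oo)%E ->
  mass mu (fun x => `|f x|) I <= mass mu (wpow p w f) I `^ p^-1 * mass mu sg I `^ q^-1.
Proof.
move=> mf fin; have Lf := locint_wpow mf fin.
have Lp := integrable_locint (integrable_wpow mf fin).
have La : locint mu (fun x => `|f x|) by move=> J; exact: (integrable_norm (Lf J)).
by rewrite -lee_fin EFinM -!poweR_EFin (massE I La) (massE I Lp) (massE I Lsg) hoelder_dset.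
Qed.

Lemma Rintegral_gt0 (v : T -> R) (A : set T) : measurable A -> (0 < mu A)%E ->
  measurable_fun setT v -> mu.-integrable A (EFin \o v) ->
  (forall x, 0 < v x) -> 0 < \int[mu]_(x in A) v x.
Proof.
move=> mA A0 mv Lv v0.
rewrite lt_def Rintegral_ge0 ?andbT; last by move=> x _; exact: ltW.
apply/eqP => v00.
have : (\int[mu]_(x in A) `|(EFin \o v) x| = 0)%E.
  under eq_integral => x _ do rewrite /= ger0_norm ?(ltW (v0 _))//.
  by rewrite -[LHS]fineK ?integrable_fin_num// -/(Rintegral _ _ _) v00.
move/ae_eq_integral_abs => /(_ mA) [].
  by apply/measurable_EFinP; exact: measurable_funTS.
move=> N [mN N0 sub].
have : (mu A <= mu N)%E.
  apply: le_measure; rewrite ?inE// => x Ix; apply: sub => /= /(_ Ix) [] vx.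
  by have := v0 x; rewrite vx ltxx.
by rewrite N0 leNgt A0.
Qed.

Lemma mass_gt0 (v : T -> R) I : measurable_fun setT v -> locint mu v ->
  (forall x, 0 < v x) -> 0 < mass mu v I.
Proof.
by move=> mv Lv v0; apply: Rintegral_gt0 => //; have /andP[] := mu_pos I.
Qed.

(** The norm of [f / sg] in $L^p(sg)$ is that of [f] in $L^p(w)$, and averaging over [I] contracts
    it. This brings the right side of the tree bound back to [f]. *)
Lemma mass_wpow f I : measurable_fun setT f ->
  (\int[mu]_x (wpow p w f x)%:E < +oo)%E ->
  (mass mu (fun x => `|f x|) I / mass mu sg I) `^ p * mass mu sg I <=
  mass mu (wpow p w f) I.
Proof.
move=> mf fin; have S0 : 0 < mass mu sg I by exact: mass_gt0.
have := mass_hoelder I mf fin.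
set F := mass mu _ I; set X := mass mu _ I; set S := mass mu sg I in S0 *.
have F0 : 0 <= F by apply: mass_ge0.
have X0 : 0 <= X by apply: mass_ge0 => x; exact: wpow_ge0.
move/(powR_dual_le p1 pq F0 X0 (ltW S0)) => H.
rewrite powRM ?invr_ge0 ?(ltW S0)//.
have -> : S^-1 `^ p = (S `^ p)^-1.
  by rewrite -powR_inv1 ?(ltW S0)// powRAC powR_inv1 ?powR_ge0.
rewrite -(powRB1 p1 (ltW S0)) invfM mulrA -mulrA mulVf ?gt_eqF// mulr1.
by rewrite ler_pdivrMr ?powR_gt0.
Qed.

Lemma gsum_mass_wpow f M I : measurable_fun setT f ->
  (\int[mu]_x (wpow p w f x)%:E < +oo)%E ->
  gsum M (fun J => (mass mu (fun x => `|f x|) (node I J) / mass mu sg (node I J)) `^ p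
                 * mass mu sg (node I J)) [::] <= \int[mu]_x wpow p w f x.
Proof.
move=> mf fin; have If := integrable_wpow mf fin; have Lp := integrable_locint If.
apply: (@le_trans _ _ (gsum M (mass mu (wpow p w f) \o node I) [::])).
  by apply: ler_gsum => J _; exact: mass_wpow.
rewrite gsum_additive; last exact: mass_tree.
rewrite /= -lee_fin massE// /Rintegral fineK; last exact: integrable_fin_num.
apply: ge0_subset_integral => //.
- by apply/measurable_EFinP; exact: measurable_wpow.
- by move=> x _; rewrite lee_fin wpow_ge0.
Qed.

(** Hoelder's inequality for the constant function 1. *)
Lemma dmu_le_mass I : dmu mu I <= mass mu w I `^ p^-1 * mass mu sg I `^ q^-1.
Proof.
have := hoelder_dset I (measurable_cst (1 : R)).
have -> : wpow p w (cst 1) = w.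
  by apply/funext => x; rewrite /wpow normr1 powR1 mul1r.
rewrite -(massE I Lw) -(massE I Lsg) !poweR_EFin -EFinM.
under eq_integral do rewrite normr1.
by rewrite integral_cst// mul1e -dmuE// lee_fin.
Qed.

End hoelder_dyadic.

(** * Sufficiency *)

Section finite_form.
Context {R : realType} (mu : {measure set (measurableTypeR R) -> \bar R}).
Hypothesis mu_pos : dyadic_pos_finite mu.
Local Notation T := (measurableTypeR R).
Variables (p q K kappa : R) (w sg : T -> R).
Hypotheses (p1 : 1 < p) (pq : p^-1 + q^-1 = 1) (K0 : 0 < K) (kappa1 : 1 <= kappa).
Hypotheses (mw : measurable_fun setT w) (msg : measurable_fun setT sg).
Hypotheses (w0 : forall x, 0 < w x) (sg0 : forall x, 0 < sg x).
Hypothesis wsg : forall x, w x `^ p^-1 * sg x `^ q^-1 = 1.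
Hypotheses (Lw : locint mu w) (Lsg : locint mu sg).
Hypothesis TW : forall I, tree_weights p q K kappa
  (dmu mu \o node I) (mass mu w \o node I) (mass mu sg \o node I).
Implicit Types (f g : T -> R) (I : dyadic).

Definition haar_coef f J : R := Num.sqrt (mI mu J) *
  `|mass mu f (lchild J) / dmu mu (lchild J) - mass mu f (rchild J) / dmu mu (rchild J)|.

Definition block_form s t f g I : R :=
  (\sum_(J <- dlist s I) haar_coef f J) * (\sum_(J <- dlist t I) haar_coef g J).

Lemma haar_coef_ge0 f J : 0 <= haar_coef f J.
Proof. by rewrite mulr_ge0 ?sqrtr_ge0. Qed.

Lemma haar_coef_le f f1 f2 J : mass mu f =1 (fun J => mass mu f1 J - mass mu f2 J) ->
  haar_coef f J <= haar_coef f1 J + haar_coef f2 J.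
Proof.
move=> E; rewrite /haar_coef !E -mulrDr ler_wpM2l ?sqrtr_ge0//.
apply: le_trans (ler_normB _ _); rewrite le_eqVlt; apply/orP; left; apply/eqP.
congr (`|_|); ring.
Qed.

Lemma pairing_coef f J : locint mu f -> `|pairing mu f (haar mu J)| = haar_coef f J.
Proof. by move=> Lf; rewrite pairing_haar// normrM ger0_norm ?sqrtr_ge0. Qed.

Lemma block_form_ge0 s t f g I : 0 <= block_form s t f g I.
Proof. by rewrite mulr_ge0// sumr_ge0// => J _; exact: haar_coef_ge0. Qed.

Lemma gsum_block_form s t f g r n :
  gsum n (block_form s t f g \o node r) [::] =
  gsum n (fun L => gsum s (haar_size (dmu mu \o node r) (mass mu f \o node r)) L *
                   gsum t (haar_size (dmu mu \o node r) (mass mu g \o node r)) L) [::].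
Proof.
apply: eq_gsum => L _; rewrite cats0 /= /block_form !sum_dlist.
by congr (_ * _); rewrite gsum_shift.
Qed.

Section nonneg_form.
Variables (s t : nat).

Definition form_cst : R := sval (cid2 (tree_shift_bound p1 pq K0 kappa1 s t)).

Lemma form_cst_ge0 : 0 <= form_cst.
Proof. by rewrite /form_cst; case: cid2. Qed.

Lemma root_form_bound f g r n0 :
  measurable_fun setT f -> measurable_fun setT g ->
  (forall x, 0 <= f x) -> (forall x, 0 <= g x) ->
  (\int[mu]_x (wpow p w f x)%:E < +oo)%E -> (\int[mu]_x (wpow q sg g x)%:E < +oo)%E ->
  \sum_(n < n0) gsum n (block_form s t f g \o node r) [::] <=
  form_cst * (\int[mu]_x wpow p w f x + \int[mu]_x wpow q sg g x).
Proof.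
move=> mf mg f0 g0 ff fg; rewrite /form_cst; case: cid2 => C C0 HC /=.
have qp : q^-1 + p^-1 = 1 by rewrite addrC.
have hq := conj_gt1 p1 pq.
have sgw x : sg x `^ q^-1 * w x `^ p^-1 = 1 by rewrite mulrC.
have Lf := locint_wpow p1 pq mw msg w0 sg0 wsg Lsg mf ff.
have Lg := locint_wpow hq qp msg mw sg0 w0 sgw Lw mg fg.
have E (h : T -> R) : (forall x, 0 <= h x) -> mass mu (fun x => `|h x|) = mass mu h.
  by move=> h0; congr (mass mu _); apply/funext => x; rewrite ger0_norm.
under eq_bigr do rewrite gsum_block_form.
have := HC _ _ _ (mass mu f \o node r) (mass mu g \o node r) (TW r).
move=> /(_ (fun J => mass_ge0 mu (node r J) f0) (mass_tree r Lf)).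
move=> /(_ (fun J => mass_ge0 mu (node r J) g0) (mass_tree r Lg)).
move=> /(_ n0 (n0 + s + t).+1 (ltnSn _)) /le_trans; apply.
rewrite ler_wpM2l//; apply: lerD.
  have := gsum_mass_wpow mu_pos p1 pq mw msg w0 sg0 wsg Lsg (n0 + s + t).+1 r mf ff.
  by rewrite E.
have := gsum_mass_wpow mu_pos hq qp msg mw sg0 w0 sgw Lw (n0 + s + t).+1 r mg fg.
by rewrite E.
Qed.

Lemma nonneg_form_bound f g A : uniq A ->
  measurable_fun setT f -> measurable_fun setT g ->
  (forall x, 0 <= f x) -> (forall x, 0 <= g x) ->
  (\int[mu]_x (wpow p w f x)%:E < +oo)%E -> (\int[mu]_x (wpow q sg g x)%:E < +oo)%E ->
  \sum_(I <- A) block_form s t f g I <=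
  2 * form_cst * (\int[mu]_x wpow p w f x + \int[mu]_x wpow q sg g x).
Proof.
move=> uA mf mg f0 g0 ff fg; have [n [n0 H]] := @sum_fset_le R A uA.
apply: (le_trans (H _ (block_form_ge0 s t f g))).
rewrite -mulrA mulrDl !mul1r.
by apply: lerD; exact: root_form_bound.
Qed.

Lemma wpow_le (r : R) (v : T -> R) f g : 0 <= r -> (forall x, 0 < v x) ->
  (forall x, `|f x| <= `|g x|) -> forall x, wpow r v f x <= wpow r v g x.
Proof.
move=> r0 v0 fg x; rewrite /wpow ler_pM2r//.
by apply: ge0_ler_powR; rewrite ?nnegrE.
Qed.

Lemma wpow_le_int (r : R) (v : T -> R) f g : 0 <= r -> (forall x, 0 < v x) ->
  measurable_fun setT v -> measurable_fun setT f -> measurable_fun setT g ->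
  (forall x, `|f x| <= `|g x|) ->
  (\int[mu]_x (wpow r v f x)%:E <= \int[mu]_x (wpow r v g x)%:E)%E.
Proof.
move=> r0 v0 mv mf mg fg; apply: ge0_le_integral => //.
- by move=> x _; rewrite lee_fin; exact: wpow_ge0.
- by apply/measurable_EFinP; exact: measurable_wpow.
- by apply/measurable_EFinP; exact: measurable_wpow.
- by move=> x _; rewrite lee_fin; exact: wpow_le.
Qed.

(** Positive and negative parts of [f] and [g] give four nonnegative forms, each with a factor 2
    from the two roots: hence 8. *)
Lemma form_bound f g A : uniq A ->
  measurable_fun setT f -> measurable_fun setT g ->
  (\int[mu]_x (wpow p w f x)%:E < +oo)%E -> (\int[mu]_x (wpow q sg g x)%:E < +oo)%E ->
  \sum_(I <- A) block_form s t f g I <=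
  8 * form_cst * (\int[mu]_x wpow p w f x + \int[mu]_x wpow q sg g x).
Proof.
move=> uA mf mg ff fg.
have qp : q^-1 + p^-1 = 1 by rewrite addrC.
have hq := conj_gt1 p1 pq.
have p0 : 0 <= p by apply: ltW; exact: lt_trans p1.
have q0 : 0 <= q by apply: ltW; exact: lt_trans hq.
have sgw x : sg x `^ q^-1 * w x `^ p^-1 = 1 by rewrite mulrC.
have Lf := locint_wpow p1 pq mw msg w0 sg0 wsg Lsg mf ff.
have Lg := locint_wpow hq qp msg mw sg0 w0 sgw Lw mg fg.
pose pos (b : bool) (h : T -> R) : T -> R := fun x => Num.max (if b then h x else - h x) 0.
have mpos b h : measurable_fun setT h -> measurable_fun setT (pos b h).
  move=> mh; apply: measurable_maxr => //; case: b => //.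
  exact: measurableT_comp.
have pos0 b h x : 0 <= pos b h x by rewrite le_max lexx orbT.
have posn b h x : `|pos b h x| <= `|h x|.
  rewrite ger0_norm// ge_max normr_ge0 andbT; case: b; first exact: ler_norm.
  by rewrite -normrN ler_norm.
have posE h x : h x = pos true h x - pos false h x.
  rewrite /pos; case: (leP 0 (h x)) => h0.
    by rewrite max_r ?oppr_le0// subr0.
  by rewrite max_l ?oppr_ge0 ?(ltW h0)// sub0r opprK.
have mass_pos (h : T -> R) : measurable_fun setT h -> locint mu h ->
    mass mu h =1 (fun J => mass mu (pos true h) J - mass mu (pos false h) J).
  move=> mh Lh J; rewrite /mass -RintegralB//.
  - by apply: eq_Rintegral => x _; exact: posE.
  - apply: le_integrable (Lh J) => //; first by apply/measurable_EFinP; apply: measurable_funTS; exact: mpos.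
    by move=> x _; rewrite /= lee_fin.
  - apply: le_integrable (Lh J) => //; first by apply/measurable_EFinP; apply: measurable_funTS; exact: mpos.
    by move=> x _; rewrite /= lee_fin.
have int_le (r : R) (v : T -> R) b h : 0 <= r -> (forall x, 0 < v x) -> measurable_fun setT v ->
    measurable_fun setT h -> (\int[mu]_x (wpow r v h x)%:E < +oo)%E ->
    (\int[mu]_x (wpow r v (pos b h) x)%:E < +oo)%E /\
    \int[mu]_x wpow r v (pos b h) x <= \int[mu]_x wpow r v h x.
  move=> r0 v0 mv mh fh.
  have le := wpow_le_int r0 v0 mv (mpos b h mh) mh (posn b h).
  have i0 k : (0 <= \int[mu]_x (wpow r v k x)%:E)%E.
    by apply: integral_ge0 => x _; rewrite lee_fin; exact: wpow_ge0.
  have lt := le_lt_trans le fh; split; first exact: lt.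
  by apply: (fine_le _ _ le); rewrite (ge0_fin_numE (i0 _)).
have bf I : block_form s t f g I <=
   block_form s t (pos true f) (pos true g) I + block_form s t (pos true f) (pos false g) I +
   (block_form s t (pos false f) (pos true g) I + block_form s t (pos false f) (pos false g) I).
  rewrite /block_form -!mulrDr -mulrDl -!big_split /=.
  by apply: ler_pM; rewrite ?sumr_ge0// => *; rewrite ?haar_coef_ge0//;
     apply: ler_sum => J _; apply: haar_coef_le; apply: mass_pos.
apply: (@le_trans _ _ _ _ _ (ler_sum _ (fun I _ => bf I))).
rewrite !big_split /=.
have key b c : \sum_(I <- A) block_form s t (pos b f) (pos c g) I <=
    2 * form_cst * (\int[mu]_x wpow p w f x + \int[mu]_x wpow q sg g x).
  have [ff' lf] := int_le p w b f p0 w0 mw mf ff.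
  have [fg' lg] := int_le q sg c g q0 sg0 msg mg fg.
  apply: le_trans (nonneg_form_bound uA (mpos b f mf) (mpos c g mg) (pos0 b f) (pos0 c g) ff' fg') _.
  by rewrite ler_wpM2l ?lerD// mulr_ge0 ?form_cst_ge0.
have -> : 8 * form_cst * (\int[mu]_x wpow p w f x + \int[mu]_x wpow q sg g x) =
  2 * form_cst * (\int[mu]_x wpow p w f x + \int[mu]_x wpow q sg g x) +
  2 * form_cst * (\int[mu]_x wpow p w f x + \int[mu]_x wpow q sg g x) +
  (2 * form_cst * (\int[mu]_x wpow p w f x + \int[mu]_x wpow q sg g x) +
  2 * form_cst * (\int[mu]_x wpow p w f x + \int[mu]_x wpow q sg g x)) by ring.
by rewrite !lerD.
Qed.

End nonneg_form.
End finite_form.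

Lemma absorb (R : realFieldType) (D P V : R) : 0 <= D -> 0 <= P ->
  (2 * D + 1) * V <= D * (P + V) -> V <= P.
Proof.
move=> D0 P0 H; have D1 : 0 < D + 1 by lra.
rewrite -(ler_pM2l D1); apply: (@le_trans _ _ (D * P)); first by lra.
by rewrite ler_wpM2r//; lra.
Qed.

(** * From the bilinear form to finite partial sums of a shift *)

Section finite_operator.
Context {R : realType} (mu : {measure set (measurableTypeR R) -> \bar R}).
Hypothesis mu_pos : dyadic_pos_finite mu.
Local Notation T := (measurableTypeR R).
Implicit Types (f g : T -> R) (I : dyadic).

Lemma Rintegral_sum (I : Type) (s : seq I) (F : I -> T -> R) :
  (forall i, mu.-integrable setT (EFin \o F i)) ->
  mu.-integrable setT (EFin \o (fun x => \sum_(i <- s) F i x)) /\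
  \int[mu]_x (\sum_(i <- s) F i x) = \sum_(i <- s) \int[mu]_x F i x.
Proof.
move=> iF; elim: s => [|i s [IH1 IH2]].
  split; last by rewrite big_nil; under eq_Rintegral do rewrite big_nil; rewrite Rintegral_cst// mul0r.
  by apply: eq_integrable (integrable0 _ _) => // x _; rewrite /= big_nil.
have e : (fun x => \sum_(j <- i :: s) F j x) = (fun x => F i x + \sum_(j <- s) F j x).
  by apply/funext => x; rewrite big_cons.
rewrite e; split; last by rewrite RintegralD// big_cons IH2.
by apply: eq_integrable (integrableD measurableT (iF i) IH1) => // x _.
Qed.

Section power_class.
Variables (p : R) (w : T -> R).
Hypotheses (p1 : 1 < p) (mw : measurable_fun setT w) (w0 : forall x, 0 < w x).

Definition wpow_fin f := measurable_fun setT f /\ (\int[mu]_x (wpow p w f x)%:E < +oo)%E.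

Lemma wpow_fin_cmp f g c : 0 <= c -> measurable_fun setT f -> wpow_fin g ->
  (forall x, wpow p w f x <= c * wpow p w g x) -> wpow_fin f.
Proof.
move=> c0 mf [mg fg] le; split; first exact: mf.
have mwf := measurable_wpow p mw mf; have mwg := measurable_wpow p mw mg.
apply: (@le_lt_trans _ _ (\int[mu]_x (c%:E * (wpow p w g x)%:E))%E).
  apply: ge0_le_integral => //.
  - by move=> x _; rewrite lee_fin; exact: wpow_ge0.
  - exact/measurable_EFinP.
  - by apply/measurable_EFinP; exact: measurable_funM.
  - by move=> x _; rewrite -EFinM lee_fin.
rewrite ge0_integralZl_EFin//; last 2 first.
- by move=> x _; rewrite lee_fin; exact: wpow_ge0.
- exact/measurable_EFinP.
by rewrite lte_mul_pinfty.
Qed.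

Lemma wpow_fin_scale c f : wpow_fin f -> wpow_fin (fun x => c * f x).
Proof.
move=> ff; apply: (@wpow_fin_cmp _ f (`|c| `^ p)); rewrite ?powR_ge0//.
  by apply: measurable_funM => //; case: ff.
by move=> x; rewrite /wpow normrM powRM// mulrA.
Qed.

Lemma wpow_fin_add f g : wpow_fin f -> wpow_fin g -> wpow_fin (fun x => f x + g x).
Proof.
move=> [mf ff] [mg fg]; have p0 : 0 <= p := ltW (lt_trans ltr01 p1).
have mwf := measurable_wpow p mw mf; have mwg := measurable_wpow p mw mg.
have mfg : measurable_fun setT (fun x => f x + g x) by exact: measurable_funD.
split; first exact: mfg.
apply: (@le_lt_trans _ _ (\int[mu]_x ((2 `^ p)%:E * ((wpow p w f x)%:E + (wpow p w g x)%:E)))%E).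
  apply: ge0_le_integral => //.
  - by move=> x _; rewrite lee_fin; exact: wpow_ge0.
  - by apply/measurable_EFinP; exact: measurable_wpow.
  - by apply/measurable_EFinP; apply: measurable_funM => //; exact: measurable_funD.
  move=> x _; rewrite -EFinD -EFinM lee_fin /wpow -mulrDl mulrA ler_pM2r//.
  have key (a b : R) : 0 <= a -> 0 <= b -> (a + b) `^ p <= 2 `^ p * (a `^ p + b `^ p).
    move=> a0 b0; wlog ab : a b a0 b0 / a <= b.
      by move=> H; case: (leP a b) => [|/ltW] ?; [|rewrite addrC [_ `^ p + _]addrC]; exact: H.
    apply: (@le_trans _ _ ((2 * b) `^ p)).
      by apply: ge0_ler_powR; rewrite ?nnegrE ?addr_ge0 ?mulr_ge0//; lra.
    by rewrite powRM// ler_wpM2l ?powR_ge0// lerDr powR_ge0.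
  apply: le_trans (key _ _ (normr_ge0 _) (normr_ge0 _)).
  by apply: ge0_ler_powR; rewrite ?nnegrE ?addr_ge0// ler_normD.
have pos f' x : (0 <= (wpow p w f' x)%:E)%E by rewrite lee_fin; exact: wpow_ge0.
rewrite ge0_integralZl_EFin ?powR_ge0//; last 2 first.
- by move=> x _; rewrite adde_ge0.
- by apply: emeasurable_funD; exact/measurable_EFinP.
rewrite ge0_integralD//; [|exact/measurable_EFinP|exact/measurable_EFinP].
by apply: lte_mul_pinfty; [rewrite lee_fin powR_ge0|by []|exact: lte_add_pinfty ff fg].
Qed.

Lemma wpow_fin_sum (I : Type) (s : seq I) (F : I -> T -> R) :
  (forall i, wpow_fin (F i)) -> wpow_fin (fun x => \sum_(i <- s) F i x).
Proof.
move=> FF; elim: s => [|i s IH].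
  have -> : (fun x : T => \sum_(i <- [::]) F i x) = cst 0.
    by apply/funext => x; rewrite big_nil.
  split; first exact: measurable_cst.
  under eq_integral => x _.
    rewrite /wpow /= normr0 powR0 ?mul0r; last by rewrite gt_eqF// (lt_trans ltr01).
    over.
  by rewrite integral0.
have -> : (fun x => \sum_(j <- i :: s) F j x) = (fun x => F i x + \sum_(j <- s) F j x).
  by apply/funext => x; rewrite big_cons.
exact: wpow_fin_add (FF i) IH.
Qed.

Lemma wpow_fin_indic I : locint mu w -> wpow_fin (\1_(dset R I)).
Proof.
move=> Lw; split; first exact: measurable_indic.
have -> : (\int[mu]_x (wpow p w \1_(dset R I) x)%:E = \int[mu]_(x in dset R I) (w x)%:E)%E.
  rewrite [in RHS]integral_mkcond; apply: eq_integral => x _.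
  rewrite /wpow /patch indicE; case: (x \in _) => /=.
    by rewrite normr1 powR1 mul1r.
  by rewrite normr0 powR0 ?mul0r// gt_eqF// (lt_trans ltr01).
exact: integrable_lty.
Qed.

Lemma wpow_fin_haar I : locint mu w -> wpow_fin (haar mu I).
Proof.
move=> Lw.
have -> : haar mu I = (fun x => (Num.sqrt (mI mu I) / dmu mu (lchild I)) * \1_(dset R (lchild I)) x
   + (- (Num.sqrt (mI mu I) / dmu mu (rchild I))) * \1_(dset R (rchild I)) x).
  by apply/funext => x; rewrite haarE mulNr.
by apply: wpow_fin_add; apply: wpow_fin_scale; exact: wpow_fin_indic.
Qed.

End power_class.

Lemma haar_block_sum s t alpha f I x : haar_block mu s t alpha f I x =
  \sum_(J <- dlist s I) \sum_(K <- dlist t I)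
    alpha I J K * pairing mu f (haar mu J) * haar mu K x.
Proof.
rewrite /haar_block fsum_descendants; apply: eq_bigr => J _.
by rewrite fsum_descendants.
Qed.

End finite_operator.

Section finite_bound.
Context {R : realType} (mu : {measure set (measurableTypeR R) -> \bar R}).
Hypothesis mu_pos : dyadic_pos_finite mu.
Local Notation T := (measurableTypeR R).
Variables (p q K kappa : R) (w sg : T -> R).
Hypotheses (p1 : 1 < p) (pq : p^-1 + q^-1 = 1) (K0 : 0 < K) (kappa1 : 1 <= kappa).
Hypotheses (mw : measurable_fun setT w) (msg : measurable_fun setT sg).
Hypotheses (w0 : forall x, 0 < w x) (sg0 : forall x, 0 < sg x).
Hypothesis wsg : forall x, w x `^ p^-1 * sg x `^ q^-1 = 1.
Hypotheses (Lw : locint mu w) (Lsg : locint mu sg).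
Hypothesis TW : forall I, tree_weights p q K kappa
  (dmu mu \o node I) (mass mu w \o node I) (mass mu sg \o node I).
Variables (s t : nat) (alpha : dyadic -> dyadic -> dyadic -> R).
Hypothesis alpha1 : forall I J K, descendants s I J -> descendants t I K -> `|alpha I J K| <= 1.
Implicit Types (f g : T -> R) (I : dyadic).

Let D := 8 * form_cst p1 pq K0 kappa1 s t.
Let D0 : 0 <= D. Proof. by rewrite mulr_ge0// form_cst_ge0. Qed.

(** The extremal function for the duality of $L^p(w)$ and $L^q(sg)$ under the pairing with respect
    to [mu]. For [p < 2], the factor [g x] settles the value at the zeros of [g]. *)
Let dual g : T -> R := fun x => g x * (`|g x| `^ (p - 2) * w x).

Let mul_dual g x : g x * dual g x = wpow p w g x.
Proof.
have hp := p1.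
rewrite /dual /wpow; have [->|gx] := eqVneq (g x) 0.
  by rewrite mul0r normr0 powR0 ?mul0r// gt_eqF//; lra.
rewrite !mulrA -expr2 -real_normK ?num_real// -powR_mulrn// -powRD.
  by congr (_ `^ _ * _); ring.
by rewrite normr_eq0 gx implybT.
Qed.

Let wpow_dual g x : wpow q sg (dual g) x = wpow p w g x.
Proof.
have hp := p1; have hq := conj_gt1 p1 pq.
rewrite /wpow /dual; have [->|gx] := eqVneq (g x) 0.
  by rewrite mul0r !normr0 !powR0 ?mul0r// gt_eqF//; lra.
have g0 : 0 < `|g x| by rewrite normr_gt0.
rewrite normrM (ger0_norm (mulr_ge0 (powR_ge0 _ _) (ltW (w0 x)))).
rewrite mulrA.
have -> : `|g x| * `|g x| `^ (p - 2) = `|g x| `^ (p - 1).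
  rewrite -{1}(powRr1 (ltW g0)) -powRD; last by rewrite (gt_eqF g0) implybT.
  by congr (_ `^ _); ring.
rewrite powRM ?powR_ge0 ?(ltW (w0 _))// -powRrM (conj_mul p1 pq) -mulrA; congr (_ * _).
have e : w x `^ (q - 1) * sg x = 1.
  have := congr1 (fun z => z `^ q) (wsg x); rewrite powR1 powRM ?powR_ge0//.
  rewrite -!powRrM (mulrC p^-1) (conj_divr p1 pq) mulVf ?powRr1 ?(ltW (sg0 _))//.
  by rewrite gt_eqF//; lra.
by rewrite -(powRB1 hq (ltW (w0 x))) mulrAC e mul1r.
Qed.

(* Duality: with [g] the partial sum and [V] the integral of [|g|^p w], [V] is the
   pairing of [g] with [dual g], whose dual power is again [V]; applying the form
   bound to [lam * f] gives [lam V <= D (lam^p X + V)], and [V] is absorbed *)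
Lemma finite_sum_bound f A : uniq A -> wpow_fin mu p w f ->
  wpow_fin mu p w (fun x => \sum_(I <- A) haar_block mu s t alpha f I x) /\
  \int[mu]_x wpow p w (fun x => \sum_(I <- A) haar_block mu s t alpha f I x) x <=
    (2 * D + 1) `^ p * \int[mu]_x wpow p w f x.
Proof.
move=> uA [mf ff].
set g : T -> R := fun x => \sum_(I <- A) haar_block mu s t alpha f I x.
have hp := p1; have hq := conj_gt1 p1 pq.
have gE x : g x = \sum_(I <- A) \sum_(J <- dlist s I) \sum_(K <- dlist t I)
    alpha I J K * pairing mu f (haar mu J) * haar mu K x.
  by rewrite /g; under eq_bigr do rewrite haar_block_sum.
(* Finiteness is known before any estimate, because [g] is a finite combination of Haar functions;
   the absorption of [V] relies on it. *)
have [mg fg] : wpow_fin mu p w g.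
  have -> : g = (fun x => \sum_(I <- A) \sum_(J <- dlist s I) \sum_(K <- dlist t I)
    alpha I J K * pairing mu f (haar mu J) * haar mu K x) by apply/funext => x; exact: gE.
  apply: (wpow_fin_sum p1 mw w0) => I; apply: (wpow_fin_sum p1 mw w0) => J.
  apply: (wpow_fin_sum p1 mw w0) => L; apply: (wpow_fin_scale mw w0).
  exact: (wpow_fin_haar p1 mw w0).
split; first by [].
have mdual : measurable_fun setT (dual g).
  apply: measurable_funM => //; apply: measurable_funM => //.
  by apply: measurable_powR_comp; exact: measurableT_comp.
have wd : wpow q sg (dual g) = wpow p w g by apply/funext => x; exact: wpow_dual.
have fdual : (\int[mu]_x (wpow q sg (dual g) x)%:E < +oo)%E by rewrite wd.
have sgw x : sg x `^ q^-1 * w x `^ p^-1 = 1 by rewrite mulrC.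
have qp : q^-1 + p^-1 = 1 by rewrite addrC.
have Lf := locint_wpow p1 pq mw msg w0 sg0 wsg Lsg mf ff.
have Ld := locint_wpow hq qp msg mw sg0 w0 sgw Lw mdual fdual.
set V := \int[mu]_x wpow p w g x; set X := \int[mu]_x wpow p w f x.
have V0 : 0 <= V by apply: Rintegral_ge0 => x _; exact: wpow_ge0.
have X0 : 0 <= X by apply: Rintegral_ge0 => x _; exact: wpow_ge0.
have VE : V = \sum_(I <- A) \sum_(J <- dlist s I) \sum_(K <- dlist t I)
    alpha I J K * pairing mu f (haar mu J) * pairing mu (dual g) (haar mu K).
  have i1 c I : mu.-integrable setT (EFin \o (fun x => c * (dual g x * haar mu I x))).
    by apply: eq_integrable (integrableZl measurableT c (integrable_mul_haar I Ld)) => // x _.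
  have -> : V = \int[mu]_x (\sum_(I <- A) \sum_(J <- dlist s I) \sum_(K <- dlist t I)
     alpha I J K * pairing mu f (haar mu J) * (dual g x * haar mu K x)).
    apply: eq_Rintegral => x _; rewrite -mul_dual {1}gE mulr_suml.
    apply: eq_bigr => I _; rewrite mulr_suml; apply: eq_bigr => J _.
    rewrite mulr_suml; apply: eq_bigr => L _; ring.
  have i2 I J : _ := @Rintegral_sum R mu _ (dlist t I) (fun L x =>
     alpha I J L * pairing mu f (haar mu J) * (dual g x * haar mu L x)) (fun L => i1 _ _).
  have i3 I : _ := @Rintegral_sum R mu _ (dlist s I) _ (fun J => (i2 I J).1).
  have [_ ->] := @Rintegral_sum R mu _ A _ (fun I => (i3 I).1).
  apply: eq_bigr => I _; rewrite (i3 I).2; apply: eq_bigr => J _.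
  rewrite (i2 I J).2; apply: eq_bigr => L _.
  by rewrite RintegralZl//; exact: integrable_mul_haar.
have VB : V <= \sum_(I <- A) block_form mu s t f (dual g) I.
  rewrite VE; apply: ler_sum => I _; rewrite /block_form mulr_suml.
  rewrite big_seq [leRHS]big_seq; apply: ler_sum => J.
  rewrite mem_dlist => /eqP dJ; rewrite mulr_sumr.
  rewrite big_seq [leRHS]big_seq; apply: ler_sum => L.
  rewrite mem_dlist => /eqP dL; apply: (le_trans (ler_norm _)).
  rewrite !normrM !pairing_coef// -mulrA ler_piMl ?mulr_ge0 ?haar_coef_ge0//.
  exact: alpha1.
(* Then [(lam - D) V <= D lam^p X] with [lam - D = D + 1 > D], so that [V <= lam^p X]. *)
pose lam := 2 * D + 1.
have lam0 : 0 < lam by rewrite ltr_wpDl// mulr_ge0.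
have [mlf flf] : wpow_fin mu p w (fun x => lam * f x).
  exact: (wpow_fin_scale mw w0 lam (conj mf ff)).
have XE : \int[mu]_x wpow p w (fun x => lam * f x) x = lam `^ p * X.
  rewrite /X -(RintegralZl _ measurableT (integrable_wpow mw w0 mf ff)).
  apply: eq_Rintegral => x _; rewrite /wpow normrM powRM// (ger0_norm (ltW lam0)).
  by rewrite mulrA.
have := form_bound mu_pos p1 pq K0 kappa1 mw msg w0 sg0 wsg Lw Lsg TW s t uA mlf mdual flf fdual.
rewrite XE wd -/V -/D.
have -> : \sum_(I <- A) block_form mu s t (fun x => lam * f x) (dual g) I =
   lam * \sum_(I <- A) block_form mu s t f (dual g) I.
  rewrite mulr_sumr; apply: eq_bigr => I _; rewrite /block_form mulrA; congr (_ * _).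
  rewrite mulr_sumr; apply: eq_bigr => J _; rewrite /haar_coef.
  have m I' : mass mu (fun x => lam * f x) I' = lam * mass mu f I' by rewrite /mass RintegralZl.
  rewrite !m -!mulrA -mulrBr normrM (ger0_norm (ltW lam0)); ring.
move=> H; have H2 : lam * V <= D * (lam `^ p * X + V).
  by apply: le_trans H; rewrite ler_pM2l.
by apply: absorb H2; rewrite ?D0// mulr_ge0 ?powR_ge0.
Qed.

End finite_bound.

(** * Passing from partial sums to the operator *)

Section liminf.
Context {R : realType}.
Local Open Scope ereal_scope.

Lemma limn_einf_ge (u : (\bar R)^nat) (c : \bar R) N :
  (forall n, (N <= n)%N -> c <= u n) -> c <= limn_einf u.
Proof.
move=> H; rewrite limn_einf_lim; apply: lime_ge; first exact: is_cvg_einfs.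
exists N => // n /= Nn; apply: le_ereal_inf_tmp => _ [m /= nm <-].
by apply: H; exact: leq_trans nm.
Qed.

Lemma limn_einf_le (u : (\bar R)^nat) (c : \bar R) :
  (forall n, u n <= c) -> limn_einf u <= c.
Proof.
move=> H; rewrite limn_einf_lim; apply: lime_le; first exact: is_cvg_einfs.
exists 0%N => // n _; apply: le_trans (H n).
by apply: ereal_inf_lbound; exists n => /=.
Qed.

Lemma nneseries_terms_small (u : R^nat) (e : R) : (forall n, 0 <= u n)%R ->
  \sum_(0 <= n <oo) (u n)%:E < +oo -> (0 < e)%R ->
  exists N, forall n, (N <= n)%N -> (u n < e)%R.
Proof.
move=> u0 fin e0.
have u0' n : 0 <= (u n)%:E by rewrite lee_fin.
have := @nneseries_tail_cvg R (fun n => (u n)%:E) xpredT fin (fun n _ => u0' n).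
move/fine_cvgP => [[N1 _ H1]].
move/cvgrPdist_lt => /(_ _ e0) [N2 _ H2].
exists (maxn N1 N2) => n; rewrite geq_max => /andP[n1 n2].
have := H2 n n2; rewrite sub0r normrN /=.
have fn := H1 n n1.
move/(le_lt_trans (ler_norm _)); apply: le_lt_trans.
rewrite -lee_fin fineK//.
have := @nneseries_lim_ge R (fun i => (u i)%:E) xpredT n n.+1 (fun i _ _ => u0' i).
by rewrite big_nat1.
Qed.

End liminf.

Lemma half_le (R : realFieldType) (a b c : R) : b < a / 2 -> a <= b + c -> a <= 2 * c.
Proof. by lra. Qed.

Section L2_limit.
Context {R : realType} (mu : {measure set (measurableTypeR R) -> \bar R}).
Local Notation T := (measurableTypeR R).
Variables (p : R) (w : T -> R).
Hypotheses (p1 : 1 < p) (mw : measurable_fun setT w) (w0 : forall x, 0 < w x).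

Lemma measurable_Lfun2 (f : T -> R) : f \in Lfun mu 2%:E -> measurable_fun setT f.
Proof. by move=> fL; exact: (set_mem (sub_Lfun_mfun fL)). Qed.

Lemma L2_norm_lt (h : T -> R) (e : R) : 0 <= e -> ('N[mu]_2%:E [EFin \o h] < e%:E)%E ->
  (\int[mu]_x (h x ^+ 2)%:E <= (e ^+ 2)%:E)%E.
Proof.
move=> e0 He.
have -> : (\int[mu]_x (h x ^+ 2)%:E = 'N[mu]_2%:E [EFin \o h] `^ 2)%E.
  rewrite poweR_Lnorm//; apply: eq_integral => x _.
  by rewrite /= powR_mulrn// real_normK// num_real.
rewrite -powR_mulrn// -poweR_EFin; apply: gt0_ler_poweR => //.
- by rewrite in_itv /= Lnorm_ge0 leey.
- by rewrite in_itv /= lee_fin e0 leey.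
- exact: ltW.
Qed.

(* Along partial sums [S_n] with [sum_n |g - S_n|_2^2] finite, almost everywhere
   [|S_n| >= |g| / 2] eventually, so Fatou's lemma applies with a loss of [2^p] *)
Lemma L2_sum_bound (F : dyadic -> T -> R) (g : T -> R) (B : R) : L2_sum mu F g ->
  (forall A : seq dyadic, uniq A -> measurable_fun setT (fun x => \sum_(I <- A) F I x)) ->
  (forall A : seq dyadic, uniq A ->
    (\int[mu]_x (wpow p w (fun x => \sum_(I <- A) F I x) x)%:E <= B%:E)%E) ->
  (\int[mu]_x (wpow p w g x)%:E <= (2 `^ p * B)%:E)%E.
Proof.
move=> [gL Hg] mS HB; have p0 : 0 <= p := ltW (lt_trans ltr01 p1).
have mg := measurable_Lfun2 gL.
(* Geometric errors make the squared distances summable, so the differences tend to 0 almost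
   everywhere along this sequence of partial sums. *)
have /choice[A HA] : forall n, exists A : {fset dyadic},
    ('N[mu]_2%:E [EFin \o (fun x => g x - \sum_(I <- A) F I x)%R] < (2^-1 ^+ n.+1)%:E)%E.
  move=> n; have e0 : 0 < (2^-1 : R) ^+ n.+1 by rewrite exprn_gt0// invr_gt0.
  by have [A0 HA0] := Hg _ e0; exists A0; apply: HA0.
pose S n x := \sum_(I <- A n) F I x.
pose h n x := g x - S n x.
have mSn n : measurable_fun setT (S n) by apply: mS; exact: fset_uniq.
have mh n : measurable_fun setT (h n) by exact: measurable_funB.
have mh2 n : measurable_fun setT (fun x => (h n x ^+ 2)%:E).
  by apply/measurable_EFinP; exact: measurable_funX.
have h20 n (x : T) : (0 <= (h n x ^+ 2)%:E)%E by rewrite lee_fin sqr_ge0.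
have sumfin : (\int[mu]_x (\sum_(0 <= n <oo) (h n x ^+ 2)%:E) < +oo)%E.
  rewrite integral_nneseries//.
  apply: (@le_lt_trans _ _ (\sum_(0 <= n <oo) (1 / (2 ^ n.+1)%:R)%:E)%E); last first.
    by apply: (le_lt_trans (epsilon_trick0 xpredT _)) => //; exact: ltry.
  apply: lee_nneseries => n _.
    by move=> _; apply: integral_ge0.
  apply: (le_trans (L2_norm_lt _ (HA n))); first by rewrite exprn_ge0// invr_ge0.
  rewrite lee_fin expr2 -[leRHS]mulr1 mul1r natrX -exprVn.
  by rewrite ler_pM ?exprn_ge0 ?invr_ge0// exprn_ile1 ?invr_ge0// invf_le1// ler1n.
have sint : mu.-integrable setT (fun x => \sum_(0 <= n <oo) (h n x ^+ 2)%:E)%E.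
  apply/integrableP; split; first exact: ge0_emeasurable_sum.
  by under eq_integral => x _ do rewrite gee0_abs ?nneseries_ge0//.
have ae := integrable_ae measurableT sint.
pose u n x : \bar R := (2 `^ p * wpow p w (S n) x)%:E.
have mu_ n : measurable_fun setT (u n).
  by apply/measurable_EFinP; apply: measurable_funM => //; exact: measurable_wpow.
have u0 n x : (0 <= u n x)%E by rewrite lee_fin mulr_ge0 ?powR_ge0// wpow_ge0.
have fat := fatou mu measurableT mu_ (fun n x _ => u0 n x).
apply: le_trans (le_trans _ fat) _; last first.
  apply: limn_einf_le => n; rewrite /u.
  have -> : (\int[mu]_x (2 `^ p * wpow p w (S n) x)%:E =
            (2 `^ p)%:E * \int[mu]_x (wpow p w (S n) x)%:E)%E.
    under eq_integral do rewrite EFinM.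
    rewrite ge0_integralZl_EFin ?powR_ge0//.
      by move=> x _; rewrite lee_fin wpow_ge0.
    by apply/measurable_EFinP; exact: measurable_wpow.
  rewrite EFinM lee_pmul2l ?lte_fin ?powR_gt0//.
  by apply: HB; exact: fset_uniq.
apply: ae_ge0_le_integral => //.
- by move=> x _; rewrite lee_fin wpow_ge0.
- by apply/measurable_EFinP; exact: measurable_wpow.
- by move=> x _; apply: (@limn_einf_ge _ _ _ 0%N) => n _.
- apply: measurableT_comp => //; apply: measurable_fun_limn_esup => n.
  exact: measurableT_comp.
apply: filterS ae => x /(_ I); rewrite fin_numE => /andP[_ sx] _.
have {}sx : (\sum_(0 <= n <oo) (h n x ^+ 2)%:E < +oo)%E by rewrite ltey.
have [gx|gx] := eqVneq (g x) 0.
  rewrite {1}/wpow gx normr0 powR0 ?mul0r; last by rewrite gt_eqF// (lt_trans ltr01).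
  by apply: (@limn_einf_ge _ _ _ 0%N).
have e0 : 0 < (`|g x| / 2) ^+ 2 by rewrite exprn_gt0// divr_gt0// normr_gt0.
have [N HN] := nneseries_terms_small (fun n => sqr_ge0 (h n x)) sx e0.
apply: (@limn_einf_ge _ _ _ N) => n Nn; rewrite /u lee_fin /wpow mulrA ler_pM2r//.
rewrite -powRM//; apply: ge0_ler_powR; rewrite ?nnegrE ?mulr_ge0//.
have := HN n Nn; rewrite -[ltLHS]real_normK ?num_real//.
rewrite ltr_pXn2r ?nnegrE ?divr_ge0// => hn.
by apply: half_le hn _; apply: le_trans (ler_normD _ _); rewrite /h subrK.
Qed.

End L2_limit.

(** * From the weight condition to the hypotheses on the trees *)

Section weight_condition.
Context {R : realType}.

Lemma powR_invl (x r : R) : 0 <= x -> x^-1 `^ r = (x `^ r)^-1.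
Proof. by move=> x0; rewrite -(powR_inv1 x0) powRAC powR_inv1 ?powR_ge0. Qed.

(** With [z = M / k], [z^p] is at most the product of the powers [p / 2] of [mi] and [mj]. Clearing
    masses leaves [z^p W S^(p-1) <= Cb mui^p muj^p], and the claim is its [p]-th root. In the
    application [M] is [m] of a common ancestor and [k] comes from balance. *)
Lemma cross_real (p q M k mi mj mui muj W S Cb : R) :
  1 < p -> p^-1 + q^-1 = 1 -> 0 <= M -> 0 < k -> 0 < mui -> 0 < muj ->
  0 <= W -> 0 <= S -> 0 <= mi -> 0 <= mj -> 0 <= Cb ->
  M <= k * mi -> M <= k * mj ->
  mi `^ (p / 2) * mj `^ (p / 2) / (muj * mui `^ (p - 1)) * (W / mui) * (S / muj) `^ (p - 1) <= Cb ->
  M * (W `^ p^-1 * S `^ q^-1) <= k * Cb `^ p^-1 * (mui * muj).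
Proof.
move=> p1 pq M0 k0 mui0 muj0 W0 S0 mi0 mj0 C0 Mi Mj H.
have p0 : 0 < p by lra.
have A0 : 0 <= M / k by rewrite divr_ge0// ltW.
have Ai : M / k <= mi by rewrite ler_pdivrMr// mulrC.
have Aj : M / k <= mj by rewrite ler_pdivrMr// mulrC.
have Mz : M = k * (M / k) by rewrite mulrC divfK// gt_eqF.
move: A0 Ai Aj Mz; set z := M / k; clearbody z => A0 Ai Aj Mz.
have Ap : z `^ p <= mi `^ (p / 2) * mj `^ (p / 2).
  rewrite {1}(_ : p = p / 2 + p / 2); last by field.
  rewrite powRD; last by apply/implyP => /eqP; lra.
  by apply: ler_pM; rewrite ?powR_ge0//; apply: ge0_ler_powR; rewrite ?nnegrE//; lra.
have H2 : z `^ p * W * S `^ (p - 1) <= Cb * mui `^ p * muj `^ p.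
  have : z `^ p * (W * S `^ (p - 1)) <=
         mi `^ (p / 2) * mj `^ (p / 2) * (W * S `^ (p - 1)).
    by rewrite ler_wpM2r// mulr_ge0 ?powR_ge0.
  rewrite mulrA; move/le_trans; apply.
  rewrite -(powRB1 p1 (ltW mui0)) -(powRB1 p1 (ltW muj0)).
  move: H; rewrite powRM ?invr_ge0 ?(ltW muj0)// (powR_invl _ (ltW muj0)).
  have a0 : 0 < mui `^ (p - 1) by exact: powR_gt0.
  have b0 : 0 < muj `^ (p - 1) by exact: powR_gt0.
  set a := mui `^ (p - 1) in a0 *; set b := muj `^ (p - 1) in b0 *.
  set X := mi `^ (p / 2) * mj `^ (p / 2).
  have -> : X / (muj * a) * (W / mui) * (S `^ (p - 1) / b) =
     X * (W * S `^ (p - 1)) / (a * mui * (b * muj)).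
    by field; rewrite !gt_eqF.
  by rewrite ler_pdivrMr ?mulr_gt0// !mulrA.
have H3 : (z `^ p * W * S `^ (p - 1)) `^ p^-1 <= (Cb * mui `^ p * muj `^ p) `^ p^-1.
  apply: ge0_ler_powR => //; rewrite ?nnegrE ?invr_ge0 ?(ltW p0)// !mulr_ge0 ?powR_ge0//.
move: H3; rewrite !powRM ?mulr_ge0 ?powR_ge0// -!powRrM !mulfV ?gt_eqF//.
rewrite !powRr1 ?(ltW mui0) ?(ltW muj0)//.
have -> : (p - 1) * p^-1 = q^-1.
  have -> : q^-1 = 1 - p^-1 by lra.
  by field; lra.
by move=> H4; rewrite Mz -!(mulrA k) ler_pM2l// !mulrA.
Qed.

(** [cross_real] with every mass equal to [mu] and [k = 1], where the off-diagonal coefficient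
    becomes 1. *)
Lemma diag_real (p q mu W S Cb : R) :
  1 < p -> p^-1 + q^-1 = 1 -> 0 < mu -> 0 <= W -> 0 <= S -> 0 <= Cb ->
  (W / mu) * (S / mu) `^ (p - 1) <= Cb ->
  W `^ p^-1 * S `^ q^-1 <= Cb `^ p^-1 * mu.
Proof.
move=> p1 pq mu0 W0 S0 C0 H.
have := @cross_real p q mu 1 mu mu mu mu W S Cb p1 pq (ltW mu0) ltr01 mu0 mu0 W0 S0
  (ltW mu0) (ltW mu0) C0.
rewrite !mul1r => /(_ (lexx _) (lexx _)).
have -> : mu `^ (p / 2) * mu `^ (p / 2) / (mu * mu `^ (p - 1)) = 1.
  rewrite -powRD; last by rewrite (gt_eqF mu0) implybT.
  rewrite [mu * _]mulrC (powRB1 p1 (ltW mu0)) (_ : p / 2 + p / 2 = p); last by field.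
  by rewrite divff// gt_eqF// powR_gt0.
rewrite mul1r => /(_ H).
by rewrite [_ * (mu * mu)]mulrCA (ler_pM2l mu0).
Qed.

Lemma conjugate_fine (p : R) : 1 < p ->
  p^-1 + (fine (hoelder_conjugate p%:E))^-1 = 1.
Proof.
move=> p1; have -> : fine (hoelder_conjugate p%:E) = p / (p - 1).
  rewrite /hoelder_conjugate /= eqe gt_eqF; last by lra.
  by rewrite -EFinB inver gt_eqF ?subr_gt0.
by field; lra.
Qed.

End weight_condition.

Section weight_tree.
Context {R : realType} (mu : {measure set (measurableTypeR R) -> \bar R}).
Hypothesis mu_pos : dyadic_pos_finite mu.
Local Notation T := (measurableTypeR R).
Variables (p : R) (w : T -> R).
Hypotheses (p1 : 1 < p) (mw : measurable_fun setT w) (w0 : forall x, 0 < w x).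
Hypothesis Lw : locint mu w.
Let q := fine (hoelder_conjugate p%:E).
Let sg : T -> R := fun x => w x `^ (1 - q).
Let pq : p^-1 + q^-1 = 1 := conjugate_fine p1.

Lemma dual_weight_mul x : w x `^ p^-1 * sg x `^ q^-1 = 1.
Proof.
have hq := conj_gt1 p1 pq.
rewrite /sg -powRrM -powRD; last by rewrite (gt_eqF (w0 x)) implybT.
rewrite (_ : p^-1 + _ = 0) ?powRr0// mulrBl mul1r divff ?gt_eqF//; last by lra.
by rewrite addrA pq subrr.
Qed.

Lemma dual_weight_gt0 x : 0 < sg x.
Proof. exact: powR_gt0. Qed.

Lemma measurable_dual_weight : measurable_fun setT sg.
Proof. exact: measurable_powR_comp. Qed.

Lemma avg_mass (f : T -> R) I : locint mu f -> avg mu I f = (mass mu f I / dmu mu I)%:E.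
Proof. by move=> Lf; rewrite /avg -massE// -EFinM mulrC. Qed.

(** The diagonal term at [I] is finite and the average of [w] is positive, so the average of [sg]
    cannot be infinite. *)
Lemma Apb_locint : Apb mu p w -> locint mu sg.
Proof.
move=> Ab I; have hp := p1.
have H : ((cpb mu p I I)%:E * avg mu I w * avg mu I sg `^ (p - 1) < +oo)%E.
  apply: le_lt_trans Ab; apply: ereal_sup_ubound; exists (I, I) => //=.
  by left; left.
have wI : 0 < mass mu w I / dmu mu I by rewrite divr_gt0 ?mass_gt0 ?dmu_gt0.
move: H; rewrite /cpb eqxx mul1e avg_mass// => H.
have : (avg mu I sg `^ (p - 1) < +oo)%E.
  rewrite ltNge leye_eq; apply/eqP => E.
  by move: H; rewrite E gt0_muley ?ltxx.
move/(lty_poweRy (lt0r_neq0 _)) => /(_ (ltac:(by rewrite subr_gt0))).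
rewrite /avg => H2.
apply/integrableP; split.
  by apply/measurable_EFinP; apply: measurable_funTS; exact: measurable_dual_weight.
under eq_integral => x _ do rewrite gee0_abs ?lee_fin ?(ltW (dual_weight_gt0 x))//.
rewrite ltNge leye_eq; apply/eqP => E; move: H2.
by rewrite E gt0_muley ?ltxx// lte_fin invr_gt0 dmu_gt0.
Qed.

Lemma Apb_real : Apb mu p w -> exists2 Cb : R, 0 <= Cb & forall I J, Apb_pair I J ->
  cpb mu p I J * (mass mu w I / dmu mu I) * (mass mu sg J / dmu mu J) `^ (p - 1) <= Cb.
Proof.
move=> Ab; have Lsg := Apb_locint Ab.
pose v I J := cpb mu p I J * (mass mu w I / dmu mu I) * (mass mu sg J / dmu mu J) `^ (p - 1).
move: Ab; rewrite /Apb -/q -/sg; set s := ereal_sup _ => Ab.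
have ub I J : Apb_pair I J -> ((v I J)%:E <= s)%E.
  move=> IJ; apply: ereal_sup_ubound; exists (I, J) => //=.
  by rewrite !avg_mass// poweR_EFin -!EFinM.
pose I0 : dyadic := (0, 0).
have P0 : Apb_pair I0 I0 by left; left.
have v0 : 0 <= v I0 I0.
  rewrite /v /cpb eqxx mul1r mulr_ge0 ?powR_ge0// divr_ge0 ?ltW ?dmu_gt0//.
  exact: mass_gt0.
have sfin : s \is a fin_num.
  by rewrite ge0_fin_numE//; apply: le_trans (ub _ _ P0); rewrite lee_fin.
exists (fine s) => [|I J IJ].
  by rewrite -lee_fin fineK//; apply: le_trans (ub _ _ P0); rewrite lee_fin.
by rewrite -lee_fin fineK//; exact: ub.
Qed.

Lemma mI_gt0 I : 0 < mI mu I.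
Proof. by rewrite /mI divr_gt0 ?mulr_gt0 ?dmu_gt0. Qed.

(** The condition involves [m] of the two members of a pair, which lie one and two generations below
    the top interval; hence [c ^+ 2]. The summand 1 keeps [K] positive. *)
Lemma Apb_tree : balanced mu -> Apb mu p w -> exists K kappa : R,
  [/\ 0 < K, 1 <= kappa & forall I, tree_weights p q K kappa
    (dmu mu \o node I) (mass mu w \o node I) (mass mu sg \o node I)].
Proof.
move=> [_ [c c1 bal]] Ab; have Lsg := Apb_locint Ab.
have [Cb C0 HC] := Apb_real Ab.
have c0 : 0 < c by exact: lt_le_trans c1.
have m0 I : 0 <= mI mu I by rewrite ltW// mI_gt0.
have d0 I := dmu_gt0 mu_pos I.
have mw0 I : 0 < mass mu w I by exact: mass_gt0.
have ms0 I : 0 < mass mu sg I.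
  by apply: mass_gt0 => //; [exact: measurable_dual_weight|exact: dual_weight_gt0].
have up d P : mI mu P <= c * mI mu (child d P).
  have /andP[h _] := bal (child d P); move: h; rewrite parent_child.
  by rewrite ler_pdivrMl// mulrC.
have dn d P : mI mu (child d P) <= c * mI mu P.
  by have /andP[_] := bal (child d P); rewrite parent_child.
have CC : Cb `^ p^-1 <= 1 + c ^+ 2 * Cb `^ p^-1.
  have h : 1 <= c ^+ 2 by rewrite exprn_ege1.
  have := powR_ge0 Cb p^-1; set z := Cb `^ p^-1 => z0.
  by rewrite -[leLHS]mul1r (le_trans (ler_wpM2r z0 h))// lerDr.
have up1 d e P : mI mu P <= c ^+ 2 * mI mu (child e (child d P)).
  by apply: (le_trans (up d P)); rewrite expr2 -mulrA ler_pM2l.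
have up2 d P : mI mu P <= c ^+ 2 * mI mu (child d P).
  by apply: (le_trans (up d P)); rewrite ler_wpM2r// expr2 ler_peMr// ltW.
have cross I J P : Apb_pair I J -> I != J -> mI mu P <= c ^+ 2 * mI mu I ->
   mI mu P <= c ^+ 2 * mI mu J ->
   mI mu P * (mass mu w I `^ p^-1 * mass mu sg J `^ q^-1) <=
     (1 + c ^+ 2 * Cb `^ p^-1) * (dmu mu I * dmu mu J).
  move=> IJ nIJ h1 h2.
  have := HC I J IJ; rewrite /cpb (negbTE nIJ) => h3.
  have k0 : 0 < c ^+ 2 by rewrite exprn_gt0.
  apply: le_trans (cross_real p1 pq (m0 P) k0 (d0 I) (d0 J) (ltW (mw0 I)) (ltW (ms0 J)) (m0 I) (m0 J) C0 h1 h2 h3) _.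
  by rewrite ler_wpM2r ?lerDr// mulr_ge0 ?ltW.
exists (1 + c ^+ 2 * Cb `^ p^-1), c; split => //.
  by rewrite ltr_pwDl// mulr_ge0 ?powR_ge0 ?exprn_ge0 ?(ltW c0).
move=> r; split => /=.
- by move=> J; exact: d0.
- exact: dmu_tree.
- by move=> J; exact: mw0.
- exact: mass_tree.
- by move=> J; exact: ms0.
- exact: mass_tree.
- move=> J; have := dmu_le_mass mu_pos p1 pq mw measurable_dual_weight w0
    dual_weight_gt0 dual_weight_mul Lw Lsg (node r J).
  exact.
- move=> J; have := HC _ _ (or_introl (or_introl (erefl (node r J)))).
  rewrite /cpb eqxx mul1r => H.
  apply: le_trans (diag_real p1 pq (d0 _) (ltW (mw0 _)) (ltW (ms0 _)) C0 H) _.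
  by rewrite ler_wpM2r// ltW.
- by move=> d J; exact: up.
- by move=> d J; exact: dn.
- move=> d e J; apply: cross.
  + left; right; rewrite /= -/child sibling_child.
    by case: e; [right|left].
  + by rewrite child_neq_grandchild.
  + exact: up2.
  + exact: up1.
- move=> d e J; rewrite [X in _ * X <= _]mulrC [X in _ <= _ * X]mulrC.
  rewrite [mass mu sg _ `^ _ * _]mulrC; apply: cross.
  + right; rewrite /= -/child sibling_child.
    by case: e; [right|left].
  + by rewrite eq_sym child_neq_grandchild.
  + exact: up1.
  + exact: up2.
Qed.

End weight_tree.

(** * The norm bound for each complexity *)

Section sufficiency.
Context {R : realType} (mu : {measure set (measurableTypeR R) -> \bar R}).
Hypothesis mu_pos : dyadic_pos_finite mu.
Local Notation T := (measurableTypeR R).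
Variables (p : R) (w : T -> R).
Hypotheses (p1 : 1 < p) (mw : measurable_fun setT w) (w0 : forall x, 0 < w x).
Hypothesis Lw : locint mu w.

Lemma wnorm_fin (f : T -> R) : (wnorm mu w p f < +oo)%E ->
  (\int[mu]_x (wpow p w f x)%:E < +oo)%E.
Proof. by apply: lty_poweRy; rewrite invr_eq0 gt_eqF// (lt_trans ltr01). Qed.

Lemma HS_opnorm s t : balanced mu -> Apb mu p w ->
  exists2 C : R, 0 <= C & forall U, HS mu s t U -> (opnorm mu w p U <= C%:E)%E.
Proof.
move=> bal Ab; have Lsg := Apb_locint mu_pos p1 mw w0 Lw Ab.
have [K [kappa [K0 kappa1 TW]]] := Apb_tree mu_pos p1 mw w0 Lw bal Ab.
set D := 8 * form_cst p1 (conjugate_fine p1) K0 kappa1 s t.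
have D0 : 0 <= D by rewrite mulr_ge0// form_cst_ge0.
(* [2 * D + 1] bounds the finite partial sums; the outer 2 is the loss in the limit. *)
have C0 : 0 <= 2 * (2 * D + 1) by rewrite mulr_ge0// addr_ge0// mulr_ge0.
exists (2 * (2 * D + 1)) => // U [alpha [alpha1 HU]].
apply: ereal_inf_lbound; exists (2 * (2 * D + 1)) => //; split => // f fL [mf /wnorm_fin ff].
pose X := \int[mu]_x wpow p w f x.
have key := finite_sum_bound mu_pos p1 (conjugate_fine p1) K0 kappa1 mw (measurable_dual_weight p mw) w0
  (dual_weight_gt0 p w0) (dual_weight_mul p1 w0) Lw Lsg TW alpha1.
have XE : X%:E = (\int[mu]_x (wpow p w f x)%:E)%E.
  rewrite /X /Rintegral fineK//; apply: integrable_fin_num => //.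
  exact: integrable_wpow.
have X0 : 0 <= X by apply: Rintegral_ge0 => x _; exact: wpow_ge0.
have H : (\int[mu]_x (wpow p w (U f) x)%:E <= (2 `^ p * ((2 * D + 1) `^ p * X))%:E)%E.
  apply: (L2_sum_bound p1 mw w0 (HU f fL)) => A uA.
    by have [[]] := key f A uA (conj mf ff).
  have [[mg fg] le] := key f A uA (conj mf ff).
  rewrite -[leLHS]fineK ?lee_fin//; apply: integrable_fin_num => //.
  exact: integrable_wpow.
rewrite /wnorm -/(wpow p w f) -XE poweR_EFin.
apply: (@le_trans _ _ ((2 `^ p * ((2 * D + 1) `^ p * X))%:E `^ p^-1)%E).
  apply: gt0_ler_poweR => //; rewrite ?in_itv /= ?leey ?andbT.
  - by rewrite invr_ge0 ltW// (lt_trans ltr01).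
  - by apply: integral_ge0 => x _; rewrite lee_fin; exact: wpow_ge0.
  - by rewrite lee_fin !mulr_ge0 ?powR_ge0.
have D1 : 0 <= 2 * D + 1 by rewrite addr_ge0// mulr_ge0.
have pn : p != 0 by rewrite gt_eqF// (lt_trans ltr01).
rewrite poweR_EFin -EFinM lee_fin mulrA -powRM// powRM ?powR_ge0// -powRrM mulfV// powRr1//.
Qed.

Lemma Apb_bound N : balanced mu -> Apb mu p w -> exists C : R,
  forall s t, (s + t <= N)%N -> forall U, HS mu s t U -> (opnorm mu w p U <= C%:E)%E.
Proof.
move=> bal Ab.
pose C s t := sval (cid2 (HS_opnorm s t bal Ab)).
have C0 s t : 0 <= C s t by rewrite /C; case: cid2.
exists (\sum_(s < N.+1) \sum_(t < N.+1) C s t) => s t stN U HU.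
have sN : (s < N.+1)%N by rewrite ltnS (leq_trans _ stN)// leq_addr.
have tN : (t < N.+1)%N by rewrite ltnS (leq_trans _ stN)// leq_addl.
apply: (@le_trans _ _ (C s t)%:E); first by rewrite /C; case: cid2 => c _ /= ->.
rewrite lee_fin (bigD1 (Ordinal sN))//= (bigD1 (Ordinal tN))//= -addrA lerDl.
by rewrite addr_ge0 ?sumr_ge0// => i _; rewrite sumr_ge0.
Qed.

End sufficiency.

(** * Necessity *)

Section finite_shift.
Context {R : realType} (mu : {measure set (measurableTypeR R) -> \bar R}).
Hypothesis mu_pos : dyadic_pos_finite mu.
Local Notation T := (measurableTypeR R).
Implicit Types (f : T -> R).

Lemma wpow2_Lfun f : wpow_fin mu 2 (cst 1) f -> f \in Lfun mu 2%:E.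
Proof.
move=> [mf ff]; apply/andP; split; first exact: mem_set.
apply: mem_set; rewrite /finite_norm unlock.
apply: poweR_lty; apply: le_lt_trans ff; rewrite le_eqVlt; apply/orP; left; apply/eqP.
by apply: eq_integral => x _; rewrite /wpow /= mulr1.
Qed.

(** The net of partial sums is constant beyond [L], so the finite sum itself is a shift, with values
    prescribed at every point. *)
Lemma HS_finite s t alpha (L : seq dyadic) : uniq L ->
  (forall I J K, `|alpha I J K| <= 1) ->
  (forall I J K, I \notin L -> alpha I J K = 0) ->
  HS mu s t (fun f x => \sum_(I <- L) haar_block mu s t alpha f I x).
Proof.
move=> uL a1 a0; exists alpha; split=> [I J K _ _|f fL]; first exact: a1.
have c1 : locint mu (cst 1) by exact: locint_cst.
have lt12 : (1 : R) < 2 by rewrite ltr1n.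
have L1 (x : T) : 0 < cst (1 : R) x by [].
have m1 : measurable_fun setT (cst 1 : T -> R) by exact: measurable_cst.
split.
  apply: wpow2_Lfun.
  apply: (wpow_fin_sum lt12 m1 L1) => I.
  have -> : haar_block mu s t alpha f I = (fun x => \sum_(J <- dlist s I) \sum_(K <- dlist t I)
    alpha I J K * pairing mu f (haar mu J) * haar mu K x).
    by apply/funext => x; exact: haar_block_sum.
  apply: (wpow_fin_sum lt12 m1 L1) => J; apply: (wpow_fin_sum lt12 m1 L1) => K.
  apply: wpow_fin_scale => //; exact: wpow_fin_haar.
move=> e e0; exists [fset x in L]%fset => A LA.
have E x : \sum_(I <- A) haar_block mu s t alpha f I x = \sum_(I <- L) haar_block mu s t alpha f I x.
  have z I : I \notin L -> haar_block mu s t alpha f I x = 0.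
    move=> IL; rewrite haar_block_sum big1// => J _; rewrite big1// => K _.
    by rewrite a0// !mul0r.
  rewrite (bigID (mem L)) /= [X in _ + X]big1 ?addr0; last by move=> I; exact: z.
  rewrite -big_filter; apply: perm_big; apply: uniq_perm => //.
    by rewrite filter_uniq// fset_uniq.
  move=> I; rewrite mem_filter andb_idr// => IL.
  by apply: (fsubsetP LA); rewrite inE.
have -> : (EFin \o (fun x => (\sum_(I <- L) haar_block mu s t alpha f I x -
    \sum_(I <- A) haar_block mu s t alpha f I x)%R)) = cst 0%E.
  by apply/funext => x /=; rewrite E subrr.
by rewrite Lnorm0// lte_fin.
Qed.

End finite_shift.

Lemma poweR_inv_le (R : realType) (p C : R) (Y Z : \bar R) : 0 < p -> 0 <= C ->
  (0 <= Y)%E -> (0 <= Z)%E ->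
  (Y `^ p^-1 <= C%:E * Z `^ p^-1)%E -> (Y <= (C `^ p)%:E * Z)%E.
Proof.
move=> p0 C0 Y0 Z0 H; have := @gt0_ler_poweR R p (ltW p0) _ _ _ _ H.
rewrite !in_itv /= !leey !andbT poweR_ge0 mule_ge0 ?lee_fin ?poweR_ge0//.
move=> /(_ isT isT); rewrite poweRM ?lee_fin ?poweR_ge0//.
by rewrite -!poweRrM !mulVf ?gt_eqF// !poweRe1// poweR_EFin.
Qed.

(** * Testing an operator whose kernel has constant modulus on a product *)

Section testing.
Context {R : realType} (mu : {measure set (measurableTypeR R) -> \bar R}).
Hypothesis mu_pos : dyadic_pos_finite mu.
Local Notation T := (measurableTypeR R).
Variables (p q : R) (w sg : T -> R).
Hypotheses (p1 : 1 < p) (pq : p^-1 + q^-1 = 1).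
Hypotheses (mw : measurable_fun setT w) (msg : measurable_fun setT sg).
Hypotheses (w0 : forall x, 0 < w x) (sg0 : forall x, 0 < sg x).
Hypothesis wsg : forall x, w x `^ p^-1 * sg x `^ q^-1 = 1.
Hypothesis Lw : locint mu w.
Variables (U : (T -> R) -> T -> R) (C kap : R) (A B : set T) (I : dyadic).
Hypotheses (C0 : 0 <= C) (kap0 : 0 < kap) (mA : measurable A) (mB : measurable B).
Hypotheses (AI : A `<=` dset R I) (BI : B `<=` dset R I).
Hypothesis B0 : 0 < \int[mu]_(x in B) w x.
Hypothesis mU : forall f, f \in Lfun mu 2%:E -> measurable_fun setT (U f).
Hypothesis HU : forall f, f \in Lfun mu 2%:E -> wLp mu w p f ->
  (wnorm mu w p (U f) <= C%:E * wnorm mu w p f)%E.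
Hypothesis Uker : forall f, locint mu f -> mu.-integrable setT (EFin \o f) ->
  (forall x, ~ A x -> f x = 0) ->
  forall x, B x -> `|U f x| = kap * `|\int[mu]_y f y|.

(** Integrability of [sg] is a conclusion here, hence the truncation: a bounded function supported
    in a dyadic interval lies in $L^2$. *)
Let trunc (n : nat) : T -> R := fun x => \1_A x * Num.min (sg x) n%:R.

Let trunc_ge0 n x : 0 <= trunc n x.
Proof. by rewrite mulr_ge0// ?le_min ?(ltW (sg0 _)) ?ler0n// indicE ler0n. Qed.

Let mtrunc n : measurable_fun setT (trunc n).
Proof.
apply: measurable_funM; first exact: measurable_indic.
exact: measurable_minr.
Qed.

Let wsg1 x : sg x `^ (p - 1) * w x = 1.
Proof.
have hp := p1.
have := congr1 (fun z => z `^ p) (wsg x); rewrite powR1 powRM ?powR_ge0//.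
rewrite -!powRrM (mulrC q^-1) (conj_divl p1 pq) mulVf; last by rewrite gt_eqF//; lra.
by rewrite powRr1 ?(ltW (w0 _))// mulrC.
Qed.

Let trunc_wpow n x : wpow p w (trunc n) x <= trunc n x.
Proof.
have hp := p1.
have t0 := trunc_ge0 n x.
rewrite /wpow ger0_norm// -(powRB1 p1 t0) mulrAC ler_piMl//.
rewrite -[leRHS](wsg1 x) ler_pM2r//; apply: ge0_ler_powR; rewrite ?nnegrE ?(ltW (sg0 _))//.
  by lra.
rewrite /trunc indicE; case: (_ \in _); rewrite ?mul1r ?mul0r ?(ltW (sg0 _))//.
by rewrite ge_min lexx.
Qed.

Let trunc_le n x : trunc n x <= n%:R * \1_(dset R I) x.
Proof.
rewrite /trunc !indicE; case: (boolP (x \in A)) => xA /=; last by rewrite mul0r mulr_ge0.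
have -> : x \in dset R I by rewrite inE; apply: AI; rewrite inE in xA.
by rewrite mul1r mulr1 ge_min lexx orbT.
Qed.

Let trunc_int n : mu.-integrable setT (EFin \o trunc n).
Proof.
have H : mu.-integrable setT (EFin \o (fun x : T => n%:R * (cst 1 x * \1_(dset R I) x))).
  by apply: integrable_indic_mul; exact: locint_cst.
apply: le_integrable H => //; first exact/measurable_EFinP.
move=> x _; rewrite /= lee_fin ger0_norm// mul1r; apply: le_trans (ler_norm _).
exact: trunc_le.
Qed.

Let trunc_Lfun n : trunc n \in Lfun mu 2%:E.
Proof.
have lt12 : (1 : R) < 2 by rewrite ltr1n.
have c1 : locint mu (cst 1) by exact: locint_cst.
have m1 : measurable_fun setT (cst 1 : T -> R) by exact: measurable_cst.
apply: wpow2_Lfun.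
apply: (@wpow_fin_cmp _ _ _ _ m1 _ _ (\1_(dset R I)) (n%:R `^ 2)) => //.
  exact: wpow_fin_indic.
move=> x; rewrite /wpow /= !mulr1 -powRM//; apply: ge0_ler_powR; rewrite ?nnegrE ?mulr_ge0//.
by rewrite !ger0_norm// ?trunc_le// indicE.
Qed.

Let a n := \int[mu]_x trunc n x.

Let a0 n : 0 <= a n. Proof. by apply: Rintegral_ge0. Qed.

Let aE n : (a n)%:E = (\int[mu]_x (trunc n x)%:E)%E.
Proof. by rewrite /a /Rintegral fineK//; exact: integrable_fin_num (trunc_int n). Qed.

Let W := \int[mu]_(x in B) w x.

Let WE : W%:E = (\int[mu]_(x in B) (w x)%:E)%E.
Proof.
rewrite /W /Rintegral fineK//; apply: integrable_fin_num => //.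
exact: integrableS (Lw I).
Qed.

Let trunc_fin n : (\int[mu]_x (wpow p w (trunc n) x)%:E <= (a n)%:E)%E.
Proof.
rewrite aE; apply: ge0_le_integral => //.
- by move=> x _; rewrite lee_fin wpow_ge0.
- by apply/measurable_EFinP; exact: measurable_wpow.
- exact/measurable_EFinP.
- by move=> x _; rewrite lee_fin.
Qed.

(** Restricting the norm inequality to [B] gives [(kap a)^p W <= C^p a], and one factor [a] is
    divided out. *)
Let test n : kap `^ p * W * a n `^ (p - 1) <= C `^ p.
Proof.
have p0 : 0 < p := lt_trans ltr01 p1.
have ip0 : 0 < p^-1 by rewrite invr_gt0.
have [an0|an0] := eqVneq (a n) 0.
  by rewrite an0 powR0 ?mulr0 ?powR_ge0// gt_eqF// subr_gt0.
have apos : 0 < a n by rewrite lt_def an0 a0.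
have fL := trunc_Lfun n.
have Z0 : (0 <= \int[mu]_x (wpow p w (trunc n) x)%:E)%E.
  by apply: integral_ge0 => x _; rewrite lee_fin wpow_ge0.
have Y0 : (0 <= \int[mu]_x (wpow p w (U (trunc n)) x)%:E)%E.
  by apply: integral_ge0 => x _; rewrite lee_fin wpow_ge0.
have tLp : wLp mu w p (trunc n).
  split => //; rewrite /wnorm; apply: poweR_lty.
  by apply: le_lt_trans (trunc_fin n) _; exact: ltry.
have := HU fL tLp; rewrite /wnorm -/(wpow p w _) => H.
have {}H : (\int[mu]_x (wpow p w (U (trunc n)) x)%:E <= (C `^ p * a n)%:E)%E.
  apply: le_trans (poweR_inv_le p0 C0 Y0 Z0 H) _.
  rewrite EFinM; apply: lee_wpmul2l (trunc_fin n).
  by rewrite lee_fin powR_ge0.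
have mUf := mU fL.
have : (((kap * a n) `^ p * W)%:E <= (C `^ p * a n)%:E)%E.
  apply: le_trans H.
  apply: (@le_trans _ _ (\int[mu]_(x in B) (wpow p w (U (trunc n)) x)%:E)%E); last first.
    apply: ge0_subset_integral => //.
      by apply/measurable_EFinP; exact: measurable_wpow.
    by move=> x _; rewrite lee_fin wpow_ge0.
  rewrite EFinM WE -(ge0_integralZl_EFin mu mB _ _ (powR_ge0 _ _)).
  - apply: ge0_le_integral => //.
    + by move=> x _; rewrite -EFinM lee_fin mulr_ge0 ?powR_ge0// ltW.
    + apply/measurable_EFinP; apply: measurable_funM => //.
      exact: measurable_funTS.
    + by apply/measurable_EFinP; apply: measurable_funTS; exact: measurable_wpow.
    move=> x Bx; rewrite -EFinM lee_fin /wpow ler_pM2r//.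
    rewrite Uker//.
    + by rewrite (ger0_norm (a0 n)).
    + exact: integrable_locint (trunc_int n).
    + by move=> y yA; rewrite /trunc indicE memNset// mul0r.
  - by move=> x _; rewrite lee_fin ltW.
  - by apply/measurable_EFinP; exact: measurable_funTS.
rewrite lee_fin (powRM _ (ltW kap0) (a0 n)) -(powRB1 p1 (a0 n)).
have -> : kap `^ p * (a n `^ (p - 1) * a n) * W = kap `^ p * W * a n `^ (p - 1) * a n by ring.
by rewrite ler_pM2r.
Qed.

(* Test on [f = 1_A min(sg, n)], for which [|f|^p w <= f], and let [n] tend to
   infinity *)
Lemma test_bound : mu.-integrable A (EFin \o sg) /\
  kap `^ p * \int[mu]_(x in B) w x * (\int[mu]_(x in A) sg x) `^ (p - 1) <= C `^ p.
Proof.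
have pm : 0 < p - 1 by rewrite subr_gt0.
have ipm : 0 < (p - 1)^-1 by rewrite invr_gt0.
have KW : 0 < kap `^ p * W by rewrite mulr_gt0 ?powR_gt0.
have CK0 : 0 <= C `^ p / (kap `^ p * W) by rewrite divr_ge0 ?powR_ge0// ltW.
pose M := (C `^ p / (kap `^ p * W)) `^ (p - 1)^-1.
have aM n : a n <= M.
  have : a n `^ (p - 1) <= C `^ p / (kap `^ p * W) by rewrite ler_pdivlMr// mulrC test.
  move=> H; have : (a n `^ (p - 1)) `^ (p - 1)^-1 <= M.
    by apply: ge0_ler_powR; rewrite ?nnegrE ?powR_ge0// ltW.
  by rewrite -powRrM mulfV ?powRr1// gt_eqF.
have SM : (\int[mu]_(x in A) (sg x)%:E <= M%:E)%E.
  have -> : (\int[mu]_(x in A) (sg x)%:E = \int[mu]_x (\1_A x * sg x)%:E)%E.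
    rewrite integral_mkcond; apply: eq_integral => x _.
    by rewrite /patch indicE; case: (x \in A); rewrite ?mul1r ?mul0r.
  have mt n : measurable_fun setT (EFin \o trunc n) by exact/measurable_EFinP.
  have fat := fatou mu measurableT mt (fun n x _ => ltac:(by rewrite /= lee_fin)).
  apply: le_trans (le_trans _ fat) _; last first.
    by apply: limn_einf_le => n; rewrite -aE lee_fin.
  apply: ge0_le_integral => //.
  - by move=> x _; rewrite lee_fin mulr_ge0 ?(ltW (sg0 _))// indicE ler0n.
  - by apply/measurable_EFinP; apply: measurable_funM => //; exact: measurable_indic.
  - apply: measurableT_comp => //; apply: measurable_fun_limn_esup => n.
    exact: measurableT_comp.
  move=> x _; apply: (@limn_einf_ge _ _ _ (Num.bound (sg x))) => n Nn.
  rewrite /= lee_fin /trunc; have -> // : Num.min (sg x) n%:R = sg x.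
  apply: min_l; apply: ltW; apply: lt_le_trans (archi_boundP (ltW (sg0 x))) _.
  by rewrite ler_nat.
have Si : mu.-integrable A (EFin \o sg).
  apply/integrableP; split; first by apply/measurable_EFinP; exact: measurable_funTS.
  under eq_integral => x _ do rewrite /= ger0_norm ?(ltW (sg0 _))//.
  by apply: le_lt_trans SM _; exact: ltry.
split => //; rewrite -/W mulrC -ler_pdivlMr//.
set S := \int[mu]_(x in A) sg x.
have S0 : 0 <= S by apply: Rintegral_ge0 => x _; exact: ltW.
have {}SM : S <= M.
  by rewrite -lee_fin /S /Rintegral fineK//; exact: integrable_fin_num Si.
have : S `^ (p - 1) <= M `^ (p - 1).
  by apply: ge0_ler_powR; rewrite ?nnegrE ?powR_ge0// ltW.
by rewrite /M -powRrM mulVf ?powRr1// gt_eqF.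
Qed.

End testing.

(** * Haar projections along a branch *)

Section kernels.
Context {R : realType} (mu : {measure set (measurableTypeR R) -> \bar R}).
Hypothesis mu_pos : dyadic_pos_finite mu.
Local Notation T := (measurableTypeR R).
Implicit Types (f : T -> R) (I : dyadic).

Lemma dset_child_disjoint c I x : dset R (child c I) x -> ~ dset R (child (~~ c) I) x.
Proof.
have /disj_setPS H := dset_disjoint I (R := R).
by case: c => /= h1 h2; apply: (H x).
Qed.

Lemma dset_child_cases I x : dset R I x -> exists c, dset R (child c I) x.
Proof. by rewrite dset_children => -[h|h]; [exists false|exists true]. Qed.

Lemma haar_child c I x : dset R (child c I) x ->
  haar mu I x = (-1) ^+ c * (Num.sqrt (mI mu I) / dmu mu (child c I)).
Proof.
move=> cx; have ncx := dset_child_disjoint cx.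
rewrite /haar !indicE; case: c cx ncx => /= h1 h2.
  by rewrite (mem_set h1) (memNset h2) /=; ring.
by rewrite (mem_set h1) (memNset h2) /=; ring.
Qed.

Lemma haar_out I x : ~ dset R I x -> haar mu I x = 0.
Proof.
move=> Ix; rewrite /haar !indicE !memNset ?mul0r ?subr0 ?mulr0//.
- by move/(@dset_child _ true I).
- by move/(@dset_child _ false I).
Qed.

Lemma mass_supp f I (A : set T) : (forall x, ~ A x -> f x = 0) -> A `<=` dset R I ->
  mass mu f I = \int[mu]_x f x.
Proof.
move=> fA AI; rewrite /mass Rintegral_mkcond; apply: eq_Rintegral => x _.
rewrite /patch; case: ifPn => // /negP xI; rewrite fA// => /AI h.
by apply: xI; rewrite inE.
Qed.

Lemma mass_out f I : (forall x, dset R I x -> f x = 0) -> mass mu f I = 0.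
Proof.
move=> f0; transitivity (\int[mu]_(x in dset R I) (0 : R)); last by rewrite Rintegral_cst ?mul0r.
by apply: eq_Rintegral => x; rewrite inE => /f0.
Qed.

Lemma pairing_supp f c I (A : set T) : locint mu f ->
  (forall x, ~ A x -> f x = 0) -> A `<=` dset R (child c I) ->
  pairing mu f (haar mu I) =
  (-1) ^+ c * (Num.sqrt (mI mu I) / dmu mu (child c I)) * \int[mu]_x f x.
Proof.
move=> Lf fA AI; rewrite pairing_haar//.
have fc := mass_supp fA AI.
have fn : mass mu f (child (~~ c) I) = 0.
  apply: mass_out => x nx; apply: fA => /AI cx.
  exact: (dset_child_disjoint cx).
case: c AI fc fn => /= AI fc fn; rewrite fc fn mul0r; ring.
Qed.

Fixpoint chain I (J : seq bool) : seq dyadic :=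
  if J is _ :: J' then node I J' :: chain I J' else [::].

Lemma node_level I J : (node I J).1 = I.1 + (size J)%:Z.
Proof. by elim: J => [|c J IH] /=; rewrite ?addr0//; case: c => /=; rewrite IH; lia. Qed.

Lemma chain_level I J L : L \in chain I J -> (L.1 < I.1 + (size J)%:Z)%R.
Proof.
elim: J => [//|c J IH] /=; rewrite inE => /predU1P[->|/IH h].
  by rewrite node_level ltrD2l ltz_nat.
by apply: lt_trans h _; rewrite ltrD2l ltz_nat.
Qed.

Lemma chain_uniq I J : uniq (chain I J).
Proof.
elim: J => [//|c J IH] /=; rewrite IH andbT; apply/negP => /chain_level.
by rewrite node_level ltxx.
Qed.

Let mdiv I c : mI mu I / dmu mu (child c I) = dmu mu (child (~~ c) I) / dmu mu I.
Proof.
have h := dmu_gt0 mu_pos.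
by rewrite /mI; case: c => /=; field; rewrite !gt_eqF.
Qed.

(** A Haar projection at [P] is the change of average from [P] to the child containing [x]; the sum
    telescopes. *)
Lemma chain_kernel f I J x : locint mu f -> dset R (node I J) x ->
  \sum_(L <- chain I J) pairing mu f (haar mu L) * haar mu L x =
  mass mu f (node I J) / dmu mu (node I J) - mass mu f I / dmu mu I.
Proof.
move=> Lf; elim: J => [|c J IH] Jx; first by rewrite big_nil subrr.
rewrite /= big_cons IH; last exact: dset_child Jx.
set P := node I J; have h := dmu_gt0 mu_pos.
rewrite (haar_child Jx) pairing_haar//.
have m0 : 0 <= mI mu P by rewrite /mI divr_ge0 ?mulr_ge0 ?(ltW (h _)).
have -> (X : R) : Num.sqrt (mI mu P) * X * ((-1) ^+ c * (Num.sqrt (mI mu P) / dmu mu (child c P))) =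
   (-1) ^+ c * X * (mI mu P / dmu mu (child c P)).
  by rewrite -{3}(sqr_sqrtr m0) expr2; ring.
rewrite mdiv (mass_additive P Lf) (dmu_children mu_pos P).
have := h (lchild P); have := h (rchild P).
by case: c Jx => Jx h1 h2 /=; field; rewrite !gt_eqF ?addr_gt0.
Qed.

(** At the interval [P] where the branch separates from [x], the Haar term is minus the average over
    [P] and cancels what was accumulated above; further down the Haar functions vanish at [x]. *)
Lemma chain_kernel_out f I J x : locint mu f ->
  (forall y, ~ dset R (node I J) y -> f y = 0) ->
  dset R I x -> ~ dset R (node I J) x ->
  \sum_(L <- chain I J) pairing mu f (haar mu L) * haar mu L x =
  - ((\int[mu]_y f y) / dmu mu I).
Proof.
move=> Lf; elim: J => [//|c J IH] fJ Ix Jx; rewrite /= big_cons.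
set P := node I J; have h := dmu_gt0 mu_pos.
have fP y : ~ dset R P y -> f y = 0 by move=> Py; apply: fJ => /dset_child.
case: (pselect (dset R P x)) => Px; last first.
  by rewrite haar_out// mulr0 add0r IH.
have [e ex] := dset_child_cases Px.
have ec : e = ~~ c.
  by case: e ex => ex; case: c Jx {fJ} => //= /(_ ex).
have cP : dset R (child c P) `<=` dset R (child c P) by [].
rewrite chain_kernel// (pairing_supp Lf fJ cP) (haar_child ex) ec.
rewrite !(mass_supp fP)//; last exact: dset_node.
have m0 : 0 <= mI mu P by rewrite /mI divr_ge0 ?mulr_ge0 ?(ltW (h _)).
set F := \int[mu]_y f y.
have -> : (-1) ^+ c * (Num.sqrt (mI mu P) / dmu mu (child c P)) * F *
    ((-1) ^+ (~~ c) * (Num.sqrt (mI mu P) / dmu mu (child (~~ c) P))) =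
   - (mI mu P / dmu mu (child c P) / dmu mu (child (~~ c) P) * F).
  by rewrite -{3}(sqr_sqrtr m0) expr2; case: c {Jx fJ ec cP} => /=; ring.
rewrite mdiv -/P.
have := h P; have := h I; have := h (child (~~ c) P).
by move=> h1 h2 h3; field; rewrite !gt_eqF.
Qed.

Hypothesis atomless : forall x : R, mu [set x] = 0%E.

Lemma dset_dist I x y : dset R I x -> dset R I y -> `|x - y| < 2 ^ (- I.1).
Proof.
move=> /dsetP[x1 x2] /dsetP[y1 y2].
have P : 0 < (2 : R) ^ I.1 by rewrite exprz_gt0.
rewrite -invr_expz -[ltRHS]mul1r ltr_pdivlMr// -(gtr0_norm P) -normrM mulrBl.
rewrite ltr_norml; move: x1 x2 y1 y2; rewrite intrD.
by set u := x * _; set v := y * _ => x1 x2 y1 y2; apply/andP; split; lra.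
Qed.

(** The nested intervals meet in at most one point, which is not an atom, and the measure is
    continuous from above. *)
Lemma node_mass_cvg0 I (J : nat -> seq bool) : (forall n, exists c, J n.+1 = c :: J n) ->
  J 0%N = [::] -> forall e : R, 0 < e -> exists n, dmu mu (node I (J n)) < e.
Proof.
move=> Jn J0 e e0.
pose F n : set T := dset R (node I (J n)).
have sub n : F n.+1 `<=` F n.
  by have [c] := Jn n; rewrite /F => -> /=; exact: dset_child.
have level n : (node I (J n)).1 = I.1 + n%:Z.
  rewrite node_level; congr (_ + _%:Z).
  by elim: n => [|n IH]; [rewrite J0|have [c ->] := Jn n; rewrite /= IH].
have mF n : measurable (F n) by exact: measurable_dset.
have cap0 : mu (\bigcap_n F n) = 0%E.
  case: (pselect (exists x, (\bigcap_n F n) x)) => [[x Fx]|none]; last first.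
    rewrite (_ : \bigcap_n F n = set0) ?measure0//.
    by apply/seteqP; split => // x Fx; apply: none; exists x.
  apply/eqP; rewrite eq_le measure_ge0 andbT -(atomless x).
  apply: le_measure; rewrite ?inE//; first exact: bigcapT_measurable.
  move=> y Fy /=; apply/eqP; rewrite eq_sym -subr_eq0 -normr_eq0; apply/eqP.
  apply: contrapT => /eqP d0.
  have dpos : 0 < `|x - y| * 2 ^ I.1.
    by rewrite mulr_gt0 ?exprz_gt0// lt_def d0 /=.
  have [n] : exists n : nat, (`|x - y| * 2 ^ I.1)^-1 < n%:R.
    by exists (Num.bound (`|x - y| * 2 ^ I.1)^-1); apply: archi_boundP; rewrite invr_ge0 ltW.
  move=> Hn; have := dset_dist (Fx n Logic.I) (Fy n Logic.I).
  rewrite level opprD exprzDr ?pnatr_eq0 ?unitfE// -!invr_expz.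
  rewrite ltNge => /negP; apply.
  have n2 : (n%:R : R) <= 2 ^+ n by rewrite -natrX ler_nat ltnW// ltn_expl.
  have i0 : 0 < (2 : R) ^ I.1 by rewrite exprz_gt0.
  rewrite mulrC ler_pdivrMr// -exprnP invf_ple ?posrE ?exprn_gt0//.
  by apply: ltW; apply: lt_le_trans Hn _.
have fin : (mu (F 0%N) < +oo)%E by have /andP[] := mu_pos (node I (J 0%N)).
have ni : nonincreasing_seq F.
  by apply/nonincreasing_seqP => n; apply/subsetPset; exact: sub.
have := nonincreasing_cvg_mu fin mF (bigcapT_measurable mF) ni.
rewrite cap0 => /fine_cvgP[_ /cvgrPdist_lt /(_ _ e0) [n _ /(_ n (leqnn n))]].
rewrite sub0r normrN /= => H; exists n; apply: le_lt_trans H.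
exact: ler_norm.
Qed.

(** Follow the heavier child until the mass first drops to 3/4 of the total: the previous interval
    exceeds 3/4, and its heavier child has at least half of that. *)
Lemma exists_medium I : exists J, 3 / 8 * dmu mu I <= dmu mu (node I J) <= 3 / 4 * dmu mu I.
Proof.
have h := dmu_gt0 mu_pos.
pose big P := dmu mu (lchild P) <= dmu mu (rchild P).
have big_ge P : dmu mu P / 2 <= dmu mu (child (big P) P).
  rewrite (dmu_children mu_pos P) /big.
  by case: (leP (dmu mu (lchild P)) (dmu mu (rchild P))) => /= hh; lra.
pose J := fix J n := if n is n'.+1 then big (node I (J n')) :: J n' else [::].
have e0 : 0 < 3 / 4 * dmu mu I by rewrite mulr_gt0.
have ex : exists n, dmu mu (node I (J n)) <= 3 / 4 * dmu mu I.
  have [n Hn] := @node_mass_cvg0 I J (fun n => ex_intro _ _ (erefl _)) (erefl _) _ e0.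
  by exists n; exact: ltW.
have [n Hn nmin] := ex_minnP ex.
case: n Hn nmin => [|n] Hn nmin.
  by have := h I; move: Hn => /=; lra.
have Hn1 : 3 / 4 * dmu mu I < dmu mu (node I (J n)).
  by rewrite ltNge; apply/negP => /nmin; rewrite ltnn.
exists (J n.+1); rewrite Hn andbT.
apply: le_trans (big_ge (node I (J n))); lra.
Qed.

End kernels.

(** * Real inequalities behind the necessary conditions *)

Section necessity_real.
Context {R : realType}.

(** Converse to [cross_real]. The kernel carries [m] of the intervals whose Haar functions occur,
    the parents of the tested pair; balance exchanges it for [m] of the pair at the cost of
    [c^p]. *)
Lemma cross_back (p c mi mj mP mQ mui muj W S E : R) :
  1 < p -> 0 <= c -> 0 <= mi -> 0 <= mj -> 0 <= mP -> 0 <= mQ -> 0 < mui -> 0 < muj ->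
  0 <= W -> 0 <= S -> mi <= c * mP -> mj <= c * mQ ->
  (Num.sqrt mP * Num.sqrt mQ / (mui * muj)) `^ p * W * S `^ (p - 1) <= E ->
  mi `^ (p / 2) * mj `^ (p / 2) / (muj * mui `^ (p - 1)) * (W / mui) * (S / muj) `^ (p - 1)
    <= c `^ p * E.
Proof.
move=> p1 c0 mi0 mj0 mP0 mQ0 mui0 muj0 W0 S0 hi hj H.
have half (x y : R) : 0 <= x -> 0 <= y -> x <= c * y ->
    x `^ (p / 2) <= c `^ (p / 2) * Num.sqrt y `^ p.
  move=> x0 y0 xy; apply: (@le_trans _ _ ((c * y) `^ (p / 2))).
    by apply: ge0_ler_powR; rewrite ?nnegrE ?mulr_ge0//; lra.
  rewrite powRM// -{1}(sqr_sqrtr y0) -powR_mulrn ?sqrtr_ge0// -powRrM.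
  by rewrite (_ : 2 * (p / 2) = p)//; field.
have X : mi `^ (p / 2) * mj `^ (p / 2) <= c `^ p * (Num.sqrt mP * Num.sqrt mQ) `^ p.
  have -> : c `^ p * (Num.sqrt mP * Num.sqrt mQ) `^ p =
     c `^ (p / 2) * Num.sqrt mP `^ p * (c `^ (p / 2) * Num.sqrt mQ `^ p).
    rewrite powRM ?sqrtr_ge0// {1}(_ : p = p / 2 + p / 2); last by field.
    rewrite powRD; last by apply/implyP => /eqP; lra.
    by ring.
  by apply: ler_pM; rewrite ?powR_ge0// half.
have a0 : 0 < mui `^ (p - 1) by exact: powR_gt0.
have b0 : 0 < muj `^ (p - 1) by exact: powR_gt0.
move: H; rewrite (powRM _ (mulr_ge0 (sqrtr_ge0 _) (sqrtr_ge0 _))) ?invr_ge0 ?mulr_ge0 ?(ltW mui0) ?(ltW muj0)//.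
rewrite powR_invl ?mulr_ge0 ?(ltW mui0) ?(ltW muj0)//.
rewrite (powRM _ (ltW mui0) (ltW muj0)) -(powRB1 p1 (ltW mui0)) -(powRB1 p1 (ltW muj0)).
rewrite (powRM _ S0) ?invr_ge0 ?(ltW muj0)// (powR_invl _ (ltW muj0)).
move: a0 b0 X; set a := mui `^ (p - 1); set b := muj `^ (p - 1).
set s := (Num.sqrt mP * Num.sqrt mQ) `^ p; set X := mi `^ (p / 2) * mj `^ (p / 2).
move=> a0 b0 HX H.
have Z0 : 0 <= W * S `^ (p - 1) / (a * mui * (b * muj)).
  by rewrite divr_ge0 ?mulr_ge0 ?powR_ge0// ltW.
have -> : X / (muj * a) * (W / mui) * (S `^ (p - 1) / b) =
   X * (W * S `^ (p - 1) / (a * mui * (b * muj))) by field; rewrite !gt_eqF.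
apply: (le_trans (ler_wpM2r Z0 HX)).
have -> : c `^ p * s * (W * S `^ (p - 1) / (a * mui * (b * muj))) =
   c `^ p * (s / (a * mui * (b * muj)) * W * S `^ (p - 1)) by field; rewrite !gt_eqF.
by rewrite ler_wpM2l ?powR_ge0.
Qed.

(** The term on [D * D] times the term on [L * L] equals the product of the two mixed terms, and
    [low] bounds the term on [L * L] from below by [(3/8 mu)^p]; hence 8/3. The 3 comes from
    [kap >= 1 / (3 mu)]. *)
Lemma diag_comb (p mu muL WL WD SL SD E kap : R) : 1 < p -> 0 < mu ->
  0 < muL -> 3 / 8 * mu <= muL -> 1 / (3 * mu) <= kap ->
  0 < WL -> 0 <= WD -> 0 < SL -> 0 <= SD -> 0 <= E ->
  kap `^ p * WL * SL `^ (p - 1) <= E ->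
  mu^-1 `^ p * WL * SD `^ (p - 1) <= E ->
  mu^-1 `^ p * WD * SL `^ (p - 1) <= E ->
  muL `^ p <= WL * SL `^ (p - 1) ->
  (WL + WD) / mu * ((SL + SD) / mu) `^ (p - 1) <=
  2 `^ (p - 1) * (3 `^ p * E + 2 * E + (8 / 3) `^ p * E ^+ 2).
Proof.
move=> p1 mu0 muL0 muLe kape WL0 WD0 SL0 SD0 E0 t1 t2 t3 low.
have P0 : 0 < mu `^ p by exact: powR_gt0.
move: t2 t3; rewrite (powR_invl _ (ltW mu0)) => t2 t3.
have LL : WL * SL `^ (p - 1) <= 3 `^ p * E * mu `^ p.
  have k1 : (1 / (3 * mu)) `^ p <= kap `^ p.
    have k0 : 0 <= 1 / (3 * mu) by rewrite divr_ge0 ?mulr_ge0 ?(ltW mu0).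
    have p0 : 0 <= p by lra.
    by apply: ge0_ler_powR; rewrite ?nnegrE ?(le_trans k0 kape).
  have : (1 / (3 * mu)) `^ p * (WL * SL `^ (p - 1)) <= E.
    by apply: le_trans t1; rewrite -mulrA ler_wpM2r// mulr_ge0 ?powR_ge0// ltW.
  rewrite mul1r powR_invl ?mulr_ge0 ?(ltW mu0)// powRM ?(ltW mu0)//.
  by rewrite ler_pdivrMl ?mulr_gt0 ?powR_gt0// mulrAC.
have LD : WL * SD `^ (p - 1) <= E * mu `^ p.
  by rewrite [E * _]mulrC -ler_pdivrMl// mulrA.
have DL : WD * SL `^ (p - 1) <= E * mu `^ p.
  by rewrite [E * _]mulrC -ler_pdivrMl// mulrA.
have lo : (3 / 8) `^ p * mu `^ p <= WL * SL `^ (p - 1).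
  apply: le_trans low; rewrite -powRM ?(ltW mu0)//.
  have p0 : 0 <= p by lra.
  have h : 0 <= 3 / 8 * mu by rewrite mulr_ge0 ?(ltW mu0).
  by apply: (ge0_ler_powR p0); rewrite ?nnegrE ?h ?(ltW muL0).
have x0 : 0 < (3 / 8 : R) `^ p by rewrite powR_gt0.
have DD : WD * SD `^ (p - 1) <= (8 / 3) `^ p * E ^+ 2 * mu `^ p.
  have -> : (8 / 3 : R) `^ p = ((3 / 8) `^ p)^-1.
    by rewrite -powR_invl//; congr (_ `^ _); field.
  have LLp : 0 < WL * SL `^ (p - 1) by rewrite mulr_gt0 ?powR_gt0.
  rewrite -(ler_pM2r LLp).
  have -> : WD * SD `^ (p - 1) * (WL * SL `^ (p - 1)) =
    (WL * SD `^ (p - 1)) * (WD * SL `^ (p - 1)) by ring.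
  apply: (@le_trans _ _ (E * mu `^ p * (E * mu `^ p))).
    by apply: ler_pM; rewrite ?mulr_ge0 ?powR_ge0// ltW.
  apply: (@le_trans _ _ (((3 / 8) `^ p)^-1 * E ^+ 2 * mu `^ p * ((3 / 8) `^ p * mu `^ p))).
    rewrite le_eqVlt; apply/orP; left; apply/eqP; field.
    by rewrite gt_eqF.
  by rewrite ler_wpM2l// !mulr_ge0 ?invr_ge0 ?powR_ge0 ?sqr_ge0.
have sum : (SL + SD) `^ (p - 1) <= 2 `^ (p - 1) * (SL `^ (p - 1) + SD `^ (p - 1)).
  have key (x y : R) : 0 <= x -> 0 <= y -> x <= y ->
     (x + y) `^ (p - 1) <= 2 `^ (p - 1) * (x `^ (p - 1) + y `^ (p - 1)).
    move=> h1 h2 xy; apply: (@le_trans _ _ ((2 * y) `^ (p - 1))).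
      apply: ge0_ler_powR; rewrite ?nnegrE; [lra|exact: addr_ge0|exact: mulr_ge0|lra].
    by rewrite powRM// ler_wpM2l ?powR_ge0// lerDr powR_ge0.
  have [h|/ltW h] := leP SL SD; first by apply: key => //; exact: ltW.
  rewrite addrC [_ `^ _ + _]addrC; apply: key => //; exact: ltW.
rewrite (powRM _ (addr_ge0 (ltW SL0) SD0)) ?invr_ge0 ?(ltW mu0)// (powR_invl _ (ltW mu0)).
have -> : (WL + WD) / mu * ((SL + SD) `^ (p - 1) / mu `^ (p - 1)) =
   (WL + WD) * (SL + SD) `^ (p - 1) / mu `^ p.
  rewrite -(powRB1 p1 (ltW mu0)); field.
  by rewrite !gt_eqF// powR_gt0.
rewrite ler_pdivrMr//.
have W0 : 0 <= WL + WD by rewrite addr_ge0// ltW.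
apply: (le_trans (ler_wpM2l W0 sum)); rewrite mulrCA -mulrA ler_wpM2l ?powR_ge0//.
move: LL LD DL DD; lra.
Qed.

End necessity_real.

(** * The test operators *)

Section necessity_tests.
Context {R : realType} (mu : {measure set (measurableTypeR R) -> \bar R}).
Hypothesis mu_pos : dyadic_pos_finite mu.
Local Notation T := (measurableTypeR R).
Variables (p q : R) (w sg : T -> R).
Hypotheses (p1 : 1 < p) (pq : p^-1 + q^-1 = 1).
Hypotheses (mw : measurable_fun setT w) (msg : measurable_fun setT sg).
Hypotheses (w0 : forall x, 0 < w x) (sg0 : forall x, 0 < sg x).
Hypothesis wsg : forall x, w x `^ p^-1 * sg x `^ q^-1 = 1.
Hypothesis Lw : locint mu w.
Variable C : R.
Hypothesis C0 : 0 <= C.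
Hypothesis HC : forall s t, (s + t <= 1)%N -> forall U, HS mu s t U ->
  forall f, f \in Lfun mu 2%:E -> wLp mu w p f ->
  (wnorm mu w p (U f) <= C%:E * wnorm mu w p f)%E.

Lemma HS_test s t U kap (A B : set T) I : (s + t <= 1)%N -> HS mu s t U -> 0 < kap ->
  measurable A -> measurable B -> A `<=` dset R I -> B `<=` dset R I -> (0 < mu B)%E ->
  (forall f, locint mu f -> (forall x, ~ A x -> f x = 0) ->
     forall x, B x -> `|U f x| = kap * `|\int[mu]_y f y|) ->
  mu.-integrable A (EFin \o sg) /\
  kap `^ p * \int[mu]_(x in B) w x * (\int[mu]_(x in A) sg x) `^ (p - 1) <= C `^ p.
Proof.
move=> st HU k0 mA mB AI BI B0 Uk.
have iB : mu.-integrable B (EFin \o w) by exact: integrableS (Lw I).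
apply: (test_bound mu_pos p1 pq mw msg w0 sg0 wsg Lw C0 k0 mA mB AI BI _ _ (HC st HU)).
- exact: Rintegral_gt0.
- by move=> f fL; have [al [_ Hal]] := HU; have [gL _] := Hal f fL; exact: measurable_Lfun2 gL.
- by move=> f Lf _; exact: Uk.
Qed.

Let h := dmu_gt0 mu_pos.
Let mupos I : (0 < mu (dset R I))%E. Proof. by have /andP[] := mu_pos I. Qed.

Section cross.
Variables (c d : bool) (P : dyadic).
Let Q := child (~~ c) P.
Let K := child c P.
Let J := child d Q.
(** The modulus of $h_P(x) h_Q(y)$ for [x] in [K] and [y] in [J]. *)
Let kap := Num.sqrt (mI mu P) * Num.sqrt (mI mu Q) / (dmu mu K * dmu mu J).

Let kap0 : 0 < kap.
Proof. by rewrite divr_gt0 ?mulr_gt0 ?sqrtr_gt0 ?mI_gt0. Qed.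

Let kapE (F : R) : `|(-1) ^+ d * (Num.sqrt (mI mu Q) / dmu mu J) * F *
  ((-1) ^+ c * (Num.sqrt (mI mu P) / dmu mu K))| = kap * `|F|.
Proof.
rewrite !normrM !normr_sign !mul1r !normfV !(ger0_norm (sqrtr_ge0 _)) !(ger0_norm (ltW (h _))) /kap.
by field; rewrite !gt_eqF ?h.
Qed.

Let JP : (dset R J : set T) `<=` dset R P.
Proof. by move=> x /dset_child /dset_child. Qed.

(** The operator is $f \mapsto \langle f,h_Q\rangle h_P$, of complexity (1,0). *)
Lemma cross_test_down : mu.-integrable (dset R J) (EFin \o sg) /\
  kap `^ p * mass mu w K * mass mu sg J `^ (p - 1) <= C `^ p.
Proof.
pose al (I J' K' : dyadic) : R := ((I == P) && (J' == Q))%:R.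
have al1 I J' K' : `|al I J' K'| <= 1 by rewrite normr_nat lern1 leq_b1.
have al0 I J' K' : I \notin [:: P] -> al I J' K' = 0 by rewrite inE /al => /negbTE ->.
have HU := @HS_finite _ _ mu_pos 1 0 al [:: P] isT al1 al0.
apply: (HS_test (isT : (1 + 0 <= 1)%N) HU kap0 (measurable_dset J) (measurable_dset K)
  JP (@dset_child _ c P) (mupos K)).
move=> f Lf fJ x Kx.
rewrite big_seq1 haar_block_sum.
have -> : \sum_(J' <- dlist 1 P) \sum_(K' <- dlist 0 P)
    al P J' K' * pairing mu f (haar mu J') * haar mu K' x =
  pairing mu f (haar mu Q) * haar mu P x.
  rewrite /= big_cons !big_seq1 /al eqxx /= /Q.
  have ne : (lchild P == rchild P) = false.
    by apply/eqP => /(@child_inj false true).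
  by case: c => /=; rewrite ?eqxx ?ne ?(eq_sym (rchild P)) ?ne mul1r !mul0r ?addr0 ?add0r.
by rewrite (pairing_supp Lf fJ (@subset_refl _ _)) (haar_child _ Kx) kapE.
Qed.

(** The transposed operator $f \mapsto \langle f,h_P\rangle h_Q$, of complexity (0,1). *)
Lemma cross_test_up : mu.-integrable (dset R K) (EFin \o sg) /\
  kap `^ p * mass mu w J * mass mu sg K `^ (p - 1) <= C `^ p.
Proof.
pose al (I J' K' : dyadic) : R := ((I == P) && (K' == Q))%:R.
have al1 I J' K' : `|al I J' K'| <= 1 by rewrite normr_nat lern1 leq_b1.
have al0 I J' K' : I \notin [:: P] -> al I J' K' = 0 by rewrite inE /al => /negbTE ->.
have HU := @HS_finite _ _ mu_pos 0 1 al [:: P] isT al1 al0.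
apply: (HS_test (isT : (0 + 1 <= 1)%N) HU kap0 (measurable_dset K) (measurable_dset J)
  (@dset_child _ c P) JP (mupos J)).
move=> f Lf fK x Jx.
rewrite big_seq1 haar_block_sum.
have -> : \sum_(J' <- dlist 0 P) \sum_(K' <- dlist 1 P)
    al P J' K' * pairing mu f (haar mu J') * haar mu K' x =
  pairing mu f (haar mu P) * haar mu Q x.
  rewrite /= big_seq1 big_cons !big_seq1 /al eqxx /= /Q.
  have ne : (lchild P == rchild P) = false.
    by apply/eqP => /(@child_inj false true).
  by case: c => /=; rewrite ?eqxx ?ne ?(eq_sym (rchild P)) ?ne mul1r !mul0r ?addr0 ?add0r.
rewrite (pairing_supp Lf fK (@subset_refl _ _)) (haar_child _ Jx).
rewrite -kapE; congr `|_|; ring.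
Qed.

End cross.

Hypothesis Lsg : locint mu sg.

Hypothesis atomless : forall x : R, mu [set x] = 0%E.

(* The kernel of the sum of the Haar projections along the branch from [I] down to
   [L] is constant on [L * L], [L * D] and [D * L], where [D = I \ L]; the missing
   product on [D * D] is estimated from these and from Hoelder's inequality on [L] *)
Lemma diag_test I :
  mass mu w I / dmu mu I * (mass mu sg I / dmu mu I) `^ (p - 1) <=
  2 `^ (p - 1) * (3 `^ p * C `^ p + 2 * C `^ p + (8 / 3) `^ p * (C `^ p) ^+ 2).
Proof.
have [J /andP[lo hi]] := exists_medium mu_pos atomless I.
set L := node I J in lo hi.
pose D : set T := dset R I `\` dset R L.
have LI : dset R L `<=` dset R I by exact: dset_node.
have mD : measurable D by exact: measurableD.
have DI : D `<=` dset R I by move=> x [].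
have hI := h I; have hL := h L.
have q4 : (3 / 4 : R) < 1 by lra.
have D0 : (0 < mu D)%E.
  rewrite lt_def measure_ge0 andbT; apply/eqP => D0.
  have : (mu (dset R I) = mu D + mu (dset R L))%E.
    by rewrite [LHS](measureDI mu (measurable_dset I) (measurable_dset L)) (setIidr LI).
  rewrite D0 add0e -!dmuE// => -[e].
  by move: hi; rewrite -e leNgt gtr_pMl// q4.
pose al (I' J' K' : dyadic) : R := (I' \in chain I J)%:R.
have al1 I' J' K' : `|al I' J' K'| <= 1 by rewrite normr_nat lern1 leq_b1.
have al0 I' J' K' : I' \notin chain I J -> al I' J' K' = 0 by rewrite /al => /negbTE ->.
pose U f x := \sum_(I' <- chain I J) haar_block mu 0 0 al f I' x.
have HU : HS mu 0 0 U := HS_finite mu_pos 0 0 (chain_uniq I J) al1 al0.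
have UE f x : U f x = \sum_(I' <- chain I J) pairing mu f (haar mu I') * haar mu I' x.
  by rewrite /U; apply: eq_big_seq => I' HI'; rewrite haar_block_sum /= !big_seq1 /al HI' mul1r.
(* The kernel is this difference on [L * L] and [- (dmu mu I)^-1] on the mixed products; [L] having
   at most 3/4 of the mass keeps the difference away from 0. *)
have kge : 1 / (3 * dmu mu I) <= (dmu mu L)^-1 - (dmu mu I)^-1.
  have : 4 / 3 * (dmu mu I)^-1 <= (dmu mu L)^-1.
    rewrite -(invf_div 3 4) -invfM lef_pV2 ?posrE ?mulr_gt0//.
  by rewrite mul1r invfM; lra.
have k0 : 0 < (dmu mu L)^-1 - (dmu mu I)^-1.
  by apply: lt_le_trans kge; rewrite divr_gt0// mulr_gt0.
have i0 : 0 < (dmu mu I)^-1 by rewrite invr_gt0.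
have st0 : (0 + 0 <= 1)%N by [].
have [_ t1] := HS_test st0 HU k0 (measurable_dset L) (measurable_dset L) LI LI (mupos L)
  (ltac:(move=> f Lf fL x Lx;
    rewrite UE (chain_kernel mu_pos Lf Lx) (mass_supp mu fL (@subset_refl _ _)) (mass_supp mu fL LI) -mulrBr normrM mulrC;
    by rewrite gtr0_norm)).
have [_ t2] := HS_test st0 HU i0 mD (measurable_dset L) DI LI (mupos L)
  (ltac:(move=> f Lf fD x Lx;
    rewrite UE (chain_kernel mu_pos Lf Lx) (mass_supp mu fD DI) mass_out;
    [by rewrite mul0r sub0r normrN normrM mulrC gtr0_norm | by move=> y Ly; apply: fD => -[]])).
have [_ t3] := HS_test st0 HU i0 (measurable_dset L) mD LI DI D0
  (ltac:(move=> f Lf fL x [Ix Lx];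
    by rewrite UE (chain_kernel_out mu_pos Lf fL Ix Lx) normrN normrM mulrC gtr0_norm)).
have split v : locint mu v -> mass mu v I = mass mu v L + \int[mu]_(x in D) v x.
  move=> Lv; rewrite /mass -[in LHS](setDUK LI) Rintegral_setU//.
    by rewrite setDUK.
  by apply/disj_setPS => x [? []].
rewrite !split//.
apply: (diag_comb p1 hI hL lo kge _ _ _ _ _ t1 t2 t3).
- exact: mass_gt0.
- by apply: Rintegral_ge0 => x _; exact: ltW.
- exact: mass_gt0.
- by apply: Rintegral_ge0 => x _; exact: ltW.
- exact: powR_ge0.
have S0 : 0 <= mass mu sg L by apply: mass_ge0 => x; exact: ltW.
have W0 : 0 <= mass mu w L by apply: mass_ge0 => x; exact: ltW.
exact: (powR_dual_le p1 pq (ltW hL) W0 S0 (dmu_le_mass mu_pos p1 pq mw msg w0 sg0 wsg Lw Lsg L)).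
Qed.

End necessity_tests.

(** * The weight condition from a uniform norm bound *)

Section necessity.
Context {R : realType} (mu : {measure set (measurableTypeR R) -> \bar R}).
Hypothesis mu_pos : dyadic_pos_finite mu.
Local Notation T := (measurableTypeR R).
Variables (p : R) (w : T -> R).
Hypotheses (p1 : 1 < p) (mw : measurable_fun setT w) (w0 : forall x, 0 < w x).
Hypothesis Lw : locint mu w.

(** The norm is an infimum, so an admissible constant is extracted strictly below [C + 1]. *)
Lemma opnorm_le (U : (T -> R) -> T -> R) C : (opnorm mu w p U <= C%:E)%E ->
  forall f, f \in Lfun mu 2%:E -> wLp mu w p f ->
  (wnorm mu w p (U f) <= (C + 1)%:E * wnorm mu w p f)%E.
Proof.
move=> UC f fL fw.
have : (opnorm mu w p U < (C + 1)%:E)%E.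
  by apply: le_lt_trans UC _; rewrite lte_fin ltrDl.
move=> /ereal_inf_lt[_ [A [A0 /(_ f fL fw) HA] <-]]; rewrite lte_fin => AC.
apply: le_trans HA _; apply: lee_wpmul2r; first exact: poweR_ge0.
by rewrite lee_fin ltW.
Qed.

Lemma Apb_necessary C : balanced mu ->
  (forall s t, (s + t <= 1)%N -> forall U, HS mu s t U -> (opnorm mu w p U <= C%:E)%E) ->
  Apb mu p w.
Proof.
move=> [atomless [c c1 bal]] HC.
pose C1 := `|C| + 1.
have C10 : 0 <= C1 by rewrite addr_ge0.
have {}HC s t : (s + t <= 1)%N -> forall U, HS mu s t U ->
    forall f, f \in Lfun mu 2%:E -> wLp mu w p f ->
    (wnorm mu w p (U f) <= C1%:E * wnorm mu w p f)%E.
  move=> st U HU; apply: opnorm_le; apply: le_trans (HC s t st U HU) _.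
  by rewrite lee_fin ler_norm.
pose q := fine (hoelder_conjugate p%:E).
pose sg : T -> R := fun x => w x `^ (1 - q).
have pq : p^-1 + q^-1 = 1 := conjugate_fine p1.
have msg : measurable_fun setT sg := measurable_dual_weight p mw.
have sg0 : forall x, 0 < sg x := dual_weight_gt0 p w0.
have wsg : forall x, w x `^ p^-1 * sg x `^ q^-1 = 1 := dual_weight_mul p1 w0.
have cr d e P := cross_test_down mu_pos p1 pq mw msg w0 sg0 wsg Lw C10 HC d e P.
have cu d e P := cross_test_up mu_pos p1 pq mw msg w0 sg0 wsg Lw C10 HC d e P.
have Lsg : locint mu sg.
  (* Every interval is a grandchild, so the cross tests already give the integrability of [sg] that
     the diagonal test presupposes. *)
  move=> I; have [d ->] := child_parent I; have [e ->] := child_parent (parent I).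
  by have [] := cr (~~ e) d (parent (parent I)); rewrite negbK.
pose E := C1 `^ p.
have E0 : 0 <= E by exact: powR_ge0.
pose M := 2 `^ (p - 1) * (3 `^ p * E + 2 * E + (8 / 3) `^ p * E ^+ 2).
have M0 : 0 <= M by rewrite mulr_ge0 ?powR_ge0// !addr_ge0 ?mulr_ge0 ?powR_ge0 ?sqr_ge0.
have c0 : 0 <= c := le_trans ler01 c1.
have W0 I : 0 <= mass mu w I by apply: mass_ge0 => x; exact: ltW.
have S0 I : 0 <= mass mu sg I by apply: mass_ge0 => x; exact: ltW.
have m0 I : 0 <= mI mu I by rewrite ltW// mI_gt0.
have h := dmu_gt0 mu_pos.
have dn d P : mI mu (child d P) <= c * mI mu P.
  by have /andP[_] := bal (child d P); rewrite parent_child.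
pose v I J := cpb mu p I J * (mass mu w I / dmu mu I) * (mass mu sg J / dmu mu J) `^ (p - 1).
have vE I J : Apb_pair I J -> v I J <= M + c `^ p * E.
  have vdown d e P : v (child d P) (child e (child (~~ d) P)) <= M + c `^ p * E.
    rewrite /v /cpb child_neq_grandchild.
    have [_ t] := cr d e P.
    apply: le_trans (cross_back p1 c0 (m0 _) (m0 _) (m0 _) (m0 _) (h _) (h _) (W0 _) (S0 _)
      (dn _ _) (dn _ _) t) _.
    by rewrite lerDr.
  have vup d e P : v (child e (child (~~ d) P)) (child d P) <= M + c `^ p * E.
    rewrite /v /cpb eq_sym child_neq_grandchild.
    have [_ t] := cu d e P.
    rewrite [dmu mu _ * dmu mu _]mulrC [Num.sqrt _ * Num.sqrt _]mulrC in t.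
    apply: le_trans (cross_back p1 c0 (m0 _) (m0 _) (m0 _) (m0 _) (h _) (h _) (W0 _) (S0 _)
      (dn _ _) (dn _ _) t) _.
    by rewrite lerDr.
  case=> [[->|JI]|IJ].
  - rewrite /v /cpb eqxx mul1r.
    apply: le_trans (diag_test mu_pos p1 pq mw msg w0 sg0 wsg Lw C10 HC Lsg atomless I) _.
    by rewrite lerDl mulr_ge0 ?powR_ge0.
  - have [d Id] := child_parent I; move: JI; rewrite {1 2}Id sibling_child => JI; rewrite Id.
    by case: JI => ->; [exact: (vdown d false)|exact: (vdown d true)].
  have [d Jd] := child_parent J; move: IJ; rewrite {1 2}Jd sibling_child => IJ; rewrite Jd.
  by case: IJ => ->; [exact: (vup d false)|exact: (vup d true)].
apply: le_lt_trans (ltry (M + c `^ p * E)).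
apply: ge_ereal_sup => _ [[I J] /= IJ <-].
by rewrite -/q -/sg !avg_mass// poweR_EFin -!EFinM lee_fin vE.
Qed.

End necessity.

(** * Replacing the weight by one positive everywhere *)

Section weight_modification.
Context {R : realType} (mu : {measure set (measurableTypeR R) -> \bar R}).
Local Notation T := (measurableTypeR R).
Variables (p : R) (w v : T -> R).
Hypotheses (mw : measurable_fun setT w) (mv : measurable_fun setT v).
Hypothesis wv : {ae mu, forall x, w x = v x}.

Lemma wnorm_ae f : measurable_fun setT f -> wnorm mu w p f = wnorm mu v p f.
Proof.
move=> mf; rewrite /wnorm; congr (_ `^ _)%E; apply: ae_eq_integral => //.
- by apply/measurable_EFinP; exact: (@measurable_wpow _ p w mw).
- by apply/measurable_EFinP; exact: (@measurable_wpow _ p v mv).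
by apply: filterS wv => x -> _.
Qed.

Lemma opnorm_ae s t U : HS mu s t U -> opnorm mu w p U = opnorm mu v p U.
Proof.
move=> [al [_ HU]]; rewrite /opnorm; congr ereal_inf; congr image.
have E f : f \in Lfun mu 2%:E -> wnorm mu w p (U f) = wnorm mu v p (U f).
  by move=> fL; apply: wnorm_ae; have [gL _] := HU f fL; exact: measurable_Lfun2 gL.
apply/seteqP; split => A [A0 HA]; split => // f fL [mf ff].
  by rewrite -E// -wnorm_ae//; apply: HA => //; split => //; rewrite wnorm_ae.
by rewrite E// wnorm_ae//; apply: HA => //; split => //; rewrite -wnorm_ae.
Qed.

Lemma Apb_ae : Apb mu p w = Apb mu p v.
Proof.
have E (f g : T -> R) I : measurable_fun setT f -> measurable_fun setT g ->
    {ae mu, forall x, f x = g x} -> avg mu I f = avg mu I g.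
  move=> mf mg fg; rewrite /avg; congr (_ * _)%E; apply: ae_eq_integral => //.
  - by apply/measurable_EFinP; exact: measurable_funTS.
  - by apply/measurable_EFinP; exact: measurable_funTS.
  by apply: filterS fg => x -> _.
pose r := 1 - fine (hoelder_conjugate p%:E).
pose Q (a b : dyadic -> \bar R) := (ereal_sup [set ((cpb mu p IJ.1 IJ.2)%:E * a IJ.1
  * (b IJ.2) `^ (p - 1)%R) | IJ in [set IJ : dyadic * dyadic | Apb_pair IJ.1 IJ.2]] < +oo)%E.
have Ew : (fun I => avg mu I w) = (fun I => avg mu I v) by apply/funext => I; exact: E.
have Er : (fun I => avg mu I (fun x => w x `^ r)) = (fun I => avg mu I (fun x => v x `^ r)).
  apply/funext => I; apply: E; [exact: measurable_powR_comp..|].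
  by apply: filterS wv => x ->.
rewrite -[LHS]/(is_true (Q (fun I => avg mu I w) (fun I => avg mu I (fun x => w x `^ r)))).
by rewrite Ew Er.
Qed.

End weight_modification.

(** The value 1 is put where [w] fails to be positive, a null set. Integrability on a half-open
    interval comes from its compact closure. *)
Lemma weight_positive (R : realType) (mu : {measure set (measurableTypeR R) -> \bar R})
    (w : measurableTypeR R -> R) : weight mu w -> exists v : measurableTypeR R -> R,
  [/\ measurable_fun setT v, forall x, 0 < v x, locint mu v &
      {ae mu, forall x, w x = v x}].
Proof.
move=> [[mw Lw] w0].
pose v x : R := if 0 < w x then w x else 1.
have mv : measurable_fun setT v.
  apply: measurable_fun_ifT => //.
  by apply: measurable_fun_ltr => //; exact: measurable_cst.
have wv : {ae mu, forall x, w x = v x} by apply: filterS w0 => x; rewrite /v => ->.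
exists v; split => //.
  by move=> x; rewrite /v; case: ifP.
move=> I; pose K := `[(I.2%:~R * 2 ^ (- I.1) : R), (I.2 + 1)%:~R * 2 ^ (- I.1)]%classic.
have IK : dset R I `<=` K by apply: subset_itv; rewrite bnd_simp.
have mK : measurable (K : set (measurableTypeR R)) by exact: measurable_itv.
have iw : mu.-integrable (dset R I) (EFin \o w).
  apply: integrableS IK _ => //; apply/integrableP; split.
    by apply/measurable_EFinP; exact: measurable_funTS.
  exact: Lw (@segment_compact _ _ _).
apply/integrableP; split; first by apply/measurable_EFinP; exact: measurable_funTS.
move/integrableP : iw => [_]; apply: le_lt_trans; rewrite le_eqVlt; apply/orP; left.
apply/eqP; apply: ae_eq_integral => //.
- by apply: measurableT_comp => //; apply/measurable_EFinP; exact: measurable_funTS.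
- by apply: measurableT_comp => //; apply/measurable_EFinP; exact: measurable_funTS.
by apply: filterS wv => x /= -> _.
Qed.

Theorem corollary3p12 (R : realType)
    (mu : {measure set (measurableTypeR R) -> \bar R})
    (mu_pos : dyadic_pos_finite mu) (mu_bal : balanced mu)
    (w : measurableTypeR R -> R) (w_weight : weight mu w)
    (p : R) (p_gt1 : 1 < p) (N : nat) (N_ge1 : (1 <= N)%N) :
  (exists C : R, forall s t : nat, (s + t <= N)%N ->
     forall T, HS mu s t T -> (opnorm mu w p T <= C%:E)%E)
  <-> Apb mu p w.
Proof.
have [v [mv v0 Lv wv]] := weight_positive w_weight.
have mw : measurable_fun setT w by case: w_weight => -[].
rewrite (Apb_ae p mw mv wv); split => [[C HC]|Av].
  apply: (Apb_necessary mu_pos p_gt1 mv v0 Lv mu_bal) => s t st U HU.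
  rewrite -(opnorm_ae p mw mv wv HU); apply: HC HU.
  (* [N >= 1] places the complexities (0,0), (1,0) and (0,1) of the test operators in the family. *)
  exact: leq_trans st N_ge1.
have [C HC] := Apb_bound mu_pos p_gt1 mv v0 Lv N mu_bal Av.
by exists C => s t st U HU; rewrite (opnorm_ae p mw mv wv HU); exact: HC HU.
Qed.
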